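(* For all integers $\alpha\ge1$ and $n\ge0$, \[ b_{13}\!\left(4\cdot3^{2\alpha+1}n+\frac{17\cdot 3^{2\alpha}-1}{2}\right)\equiv 0\pmod 6,\qquad b_{13}\!\left(4\cdot3^{2\alpha}n+\frac{11\cdot 3^{2\alpha-1}-1}{2}\right)\equiv 0\pmod 6. \]
   Context: For a positive integer $\ell$, $b_\ell(n)$ denotes the number of partitions of $n$ having no part divisible by $\ell$. *)

(* Defs.v *)
From mathcomp Require Import all_boot.
Set Implicit Arguments. Unset Strict Implicit. Unset Printing Implicit Defensive.

Definition is_partition (n : nat) (s : seq nat) : bool :=
  [&& sorted geq s, all (fun p => 0 < p) s & sumn s == n].

Fixpoint seqs_of_len (k m : nat) : seq (seq nat) :=
  match k with
  | 0 => [:: [::]]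
  | k'.+1 => [seq p :: s | p <- iota 1 m, s <- seqs_of_len k' m]
  end.

(* Every partition of n has at most n parts, each in {1,...,n}; hence
   this list contains every partition of n exactly once. *)
Definition partitions (n : nat) : seq (seq nat) :=
  [seq s <- flatten [seq seqs_of_len k n | k <- iota 0 n.+1] | is_partition n s].

Definition b (l n : nat) : nat :=
  count (fun s => all (fun p => ~~ (l %| p)) s) (partitions n).

(* Main.v *)
(* Write f_k for the product of the 1 - q^(k n), n > 0, so that the generating function
   of b_13 is F = f_13 / f_1. The theta series of level 13 satisfy the three-term Weierstrass
   relation, which makes their quotients satisfy an equation of the modular curve X_1(13);
   reducing duplication formulas on this curve modulo 2 and 3 yields
     f_13 = f_1^13 (1 + t^3)^2 (1 + t)  mod 2,  where t = q f_13^2 / f_1^2,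
     F^-1 + q F is a cube               mod 3.
   Modulo 2 the even part of F becomes f_1^6 + q^3 f_13^6, whose n-th coefficient vanishes
   unless 4n + 1 is a square or 13 times a square. Modulo 3, writing F^-1 + q F = r^3, the
   3-dissection of F has middle component G = (r^3 + q F) / (r^6 - q), and G in turn is a
   cube plus q (- G)^3, so that the coefficient of index 3n + 2 of G is 0 and that of index
   3n + 1 is minus that of index n. *)
From HB Require Import structures.
Require Import Defs.
From mathcomp Require Import all_boot all_order all_algebra.
From mathcomp Require Import generic_quotient fraction.
From mathcomp Require finfield.
From mathcomp Require Import boolp.
From mathcomp Require Import zify ring.
Set Implicit Arguments. Unset Strict Implicit. Unset Printing Implicit Defensive.
Import Order.TTheory GRing.Theory Num.Theory.
Local Open Scope ring_scope.

(** * Formal power series *)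

(** The substitution $k = 26j + 2a - 13$ completes the square: $104(13j(j-1)/2 + aj) = k^2 -
    (2a-13)^2$. This is why $q = z^{104}$: the theta series become sums of $\pm z^{k^2}$ over
    residue classes, and their products are compared by bijections on pairs of integers, over any
    field. They have positive order in $z$, so the coordinates on the curve live in the field of
    fractions of the series; a cube found there has to be brought back to a series in $z$, and then
    to one in $q$. The link with $t$ is $\rho = E_1E_3E_4/(E_2E_5E_6)$, where $E_a$ is the series
    [theta1 a] and 1, 3, 4 are the squares mod 13 up to sign: $t^{-1}$ is $\rho^{-1}+1+\rho$ modulo
    2 and $\rho-\rho^{-1}$ modulo 3. Modulo 3, $t^{-1}$ is obtained from the discriminant of the
    2-torsion cubic, whose coefficients are recovered from its values at three multiples of the
    13-torsion point. Modulo 2 the value [theta2 0] vanishes, and Frobenius, which turns squares of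
    theta series into theta series, takes over. *)

Record fps (R : fieldType) := Fps { cf : nat -> R }.
Arguments cf {R} f n%_N : rename.

HB.instance Definition _ (R : fieldType) := gen_eqMixin (fps R).
HB.instance Definition _ (R : fieldType) := gen_choiceMixin (fps R).

Section FpsRing.
Variable R : fieldType.
Implicit Types f g h : fps R.

Lemma fpsP f g : (forall n, cf f n = cf g n) -> f = g.
Proof. by case: f g => [f] [g] /= e; congr Fps; apply: funext. Qed.

Definition fps_add f g := Fps (fun n => cf f n + cf g n).
Definition fps_opp f := Fps (fun n => - cf f n).
Definition fps_zero : fps R := Fps (fun=> 0).

Fact fps_addA : associative fps_add.
Proof. by move=> f g h; apply: fpsP => n /=; rewrite addrA. Qed.
Fact fps_addC : commutative fps_add.
Proof. by move=> f g; apply: fpsP => n /=; rewrite addrC. Qed.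
Fact fps_add0 : left_id fps_zero fps_add.
Proof. by move=> f; apply: fpsP => n /=; rewrite add0r. Qed.
Fact fps_addN : left_inverse fps_zero fps_opp fps_add.
Proof. by move=> f; apply: fpsP => n /=; rewrite addNr. Qed.

HB.instance Definition _ :=
  GRing.isZmodule.Build (fps R) fps_addA fps_addC fps_add0 fps_addN.

Definition fps_mul f g := Fps (fun n => \sum_(i < n.+1) cf f i * cf g (n - i)%N).
Definition fps_one : fps R := Fps (fun n => (n == 0%N)%:R).

Definition trunc f n : {poly R} := \poly_(i < n.+1) cf f i.

Lemma coef_trunc f n i : (i <= n)%N -> (trunc f n)`_i = cf f i.
Proof. by move=> le_in; rewrite coef_poly ltnS le_in. Qed.

(** A coefficient of a product depends only on truncations, so the ring axioms are inherited from
    polynomials. *)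
Lemma fps_mul_poly f g n (p q : {poly R}) :
  (forall i, (i <= n)%N -> p`_i = cf f i) ->
  (forall i, (i <= n)%N -> q`_i = cf g i) ->
  cf (fps_mul f g) n = (p * q)`_n.
Proof.
move=> ep eq; rewrite coefM /=; apply: eq_bigr => i _.
by rewrite ep ?eq ?leq_subr // -ltnS.
Qed.

Lemma trunc_mul f g n i : (i <= n)%N ->
  (trunc f n * trunc g n)`_i = cf (fps_mul f g) i.
Proof.
move=> le_in; symmetry; apply: fps_mul_poly => j le_ji;
  by rewrite coef_trunc // (leq_trans le_ji).
Qed.

Fact fps_mulA : associative fps_mul.
Proof.
move=> f g h; apply: fpsP => n.
rewrite (@fps_mul_poly _ _ n (trunc f n) (trunc g n * trunc h n)).
- rewrite (@fps_mul_poly _ _ n (trunc f n * trunc g n) (trunc h n)) ?mulrA //.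
  + by move=> i le_in; rewrite trunc_mul.
  + by move=> i le_in; rewrite coef_trunc.
- by move=> i le_in; rewrite coef_trunc.
- by move=> i le_in; rewrite trunc_mul.
Qed.

Fact fps_mulC : commutative fps_mul.
Proof.
by move=> f g; apply: fpsP => n; rewrite -!(@trunc_mul _ _ n) // mulrC.
Qed.

Fact fps_mul1 : left_id fps_one fps_mul.
Proof.
move=> f; apply: fpsP => n /=; rewrite big_ord_recl /= mul1r subn0.
by rewrite big1 ?addr0 // => i _; rewrite mul0r.
Qed.

Fact fps_mulDl : left_distributive fps_mul fps_add.
Proof.
move=> f g h; apply: fpsP => n /=; rewrite -big_split /=.
by apply: eq_bigr => i _; rewrite mulrDl.
Qed.

Fact fps_1neq0 : fps_one != fps_zero.
Proof. by apply/eqP => /(congr1 (cf^~ 0%N)) /eqP /=; rewrite oner_eq0. Qed.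

HB.instance Definition _ := GRing.Zmodule_isComNzRing.Build (fps R)
  fps_mulA fps_mulC fps_mul1 fps_mulDl fps_1neq0.

Lemma cfD f g n : cf (f + g) n = cf f n + cf g n. Proof. by []. Qed.
Lemma cfN f n : cf (- f) n = - cf f n. Proof. by []. Qed.
Lemma cfB f g n : cf (f - g) n = cf f n - cf g n. Proof. by []. Qed.
Lemma cf0 n : cf (0 : fps R) n = 0. Proof. by []. Qed.
Lemma cf1 n : cf (1 : fps R) n = (n == 0%N)%:R. Proof. by []. Qed.
Lemma cfM f g n : cf (f * g) n = \sum_(i < n.+1) cf f i * cf g (n - i)%N.
Proof. by []. Qed.
Lemma cfM0 f g : cf (f * g) 0 = cf f 0 * cf g 0.
Proof. by rewrite cfM big_ord1. Qed.
Lemma cfX0 f k : cf (f ^+ k) 0 = cf f 0 ^+ k.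
Proof. by elim: k => [|k IH]; rewrite ?expr0 ?cf1 // !exprS cfM0 IH. Qed.

Lemma cf_sum I (s : seq I) (P : pred I) (F : I -> fps R) n :
  cf (\sum_(i <- s | P i) F i) n = \sum_(i <- s | P i) cf (F i) n.
Proof. by elim/big_rec2: _ => // i x y _ <-. Qed.

Fixpoint inv_coefs f n : seq R :=
  if n is m.+1 then
    let s := inv_coefs f m in
    rcons s (- (cf f 0)^-1 * \sum_(i < m.+1) cf f i.+1 * s`_(m - i))
  else [:: (cf f 0)^-1].

Lemma size_inv_coefs f n : size (inv_coefs f n) = n.+1.
Proof. by elim: n => //= n IH; rewrite size_rcons IH. Qed.

(** The value [f] outside the units is the convention imposed by the unit ring structure. *)
Definition fps_inv f : fps R :=
  if cf f 0 == 0 then f else Fps (fun n => (inv_coefs f n)`_n).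

Lemma inv_coefs_nth f n i : (i <= n)%N -> (inv_coefs f n)`_i = (inv_coefs f i)`_i.
Proof.
elim: n => [|n IH]; first by rewrite leqn0 => /eqP->.
rewrite leq_eqVlt => /predU1P [->//|]; rewrite ltnS => le_in /=.
by rewrite nth_rcons size_inv_coefs ltnS le_in IH.
Qed.

Definition fps_unit : pred (fps R) := fun f => cf f 0 != 0.

Fact fps_mulV : {in fps_unit, left_inverse 1 fps_inv *%R}.
Proof.
move=> f; rewrite unfold_in => f0; rewrite mulrC; apply: fpsP => n.
rewrite /fps_inv (negbTE f0) cfM /=.
case: n => [|n]; first by rewrite big_ord1 mulfV.
rewrite big_ord_recl subn0 /= nth_rcons size_inv_coefs ltnn eqxx.
rewrite mulrA mulrN mulfV // mulN1r.
apply/eqP; rewrite addrC subr_eq0; apply/eqP/eq_bigr => i _.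
by rewrite /bump /= add1n subSS -[in LHS](@inv_coefs_nth f n) ?leq_subr.
Qed.

Fact fps_unitP f g : g * f = 1 -> fps_unit f.
Proof.
move=> /(congr1 (cf^~ 0%N)); rewrite cfM0 cf1 /= => e.
by apply/eqP => f0; move: e; rewrite f0 mulr0 => /esym/eqP; rewrite oner_eq0.
Qed.

Fact fps_inv_out : {in [predC fps_unit], fps_inv =1 id}.
Proof. by move=> f; rewrite inE unfold_in negbK /fps_inv => ->. Qed.

HB.instance Definition _ := GRing.ComNzRing_hasMulInverse.Build (fps R)
  fps_mulV fps_unitP fps_inv_out.

Lemma fps_unitE f : (f \is a GRing.unit) = (cf f 0 != 0). Proof. by []. Qed.

Lemma fps_neq0P f : reflect (exists n, cf f n != 0) (f != 0).
Proof.
apply: (iffP idP) => [fN0|[n fn]]; last by apply: contraNneq fn => ->.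
apply: contrapT => nex; move/eqP: fN0; apply.
apply: fpsP => n; apply/eqP; rewrite cf0; apply: contrapT => /negP fn.
by apply: nex; exists n.
Qed.

Fact fps_integral f g : f * g = 0 -> (f == 0) || (g == 0).
Proof.
move=> fg0; apply/negPn/negP; rewrite negb_or => /andP[fN gN].
have [m fm minm] := ex_minnP (fps_neq0P f fN).
have [n gn minn] := ex_minnP (fps_neq0P g gN).
have /eqP := congr1 (cf^~ (m + n)%N) fg0; rewrite /=.
have lt_m : (m < (m + n).+1)%N by lia.
rewrite (bigD1 (Ordinal lt_m)) //= big1 => [|i ne_i].
  by rewrite addr0 addKn mulf_eq0 (negbTE fm) (negbTE gn).
have [lt_im|lt_mi|eq_im] := ltngtP i m; last by case/eqP: ne_i; apply: val_inj.
  apply/eqP; rewrite mulf_eq0; apply/orP; left.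
  by apply/negPn/negP => /minm; lia.
apply/eqP; rewrite mulf_eq0; apply/orP; right.
by apply/negPn/negP => /minn; have := ltn_ord i; lia.
Qed.

HB.instance Definition _ := GRing.ComUnitRing_isIntegral.Build (fps R) fps_integral.

Definition fpsX k : fps R := Fps (fun n => (n == k)%:R).
Arguments fpsX k%_N.

Lemma cf_fpsXM k f n : cf (fpsX k * f) n = if (k <= n)%N then cf f (n - k) else 0.
Proof.
rewrite cfM; case: leqP => [le_kn|lt_nk].
  have lt_k : (k < n.+1)%N by [].
  rewrite (bigD1 (Ordinal lt_k)) //= eqxx mul1r big1 ?addr0 // => i ne_i.
  case: eqVneq => [eq_ik|]; last by rewrite mul0r.
  by case/eqP: ne_i; apply: val_inj.
by rewrite big1 // => i _; rewrite /= ltn_eqF ?mul0r // (leq_trans (ltn_ord i)).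
Qed.

Lemma fpsXD k l : fpsX (k + l) = fpsX k * fpsX l.
Proof.
apply: fpsP => n; rewrite cf_fpsXM /=; case: leqP => le_kn.
  by congr (_%:R); lia.
by rewrite ltn_eqF //; lia.
Qed.

Lemma fpsX0 : fpsX 0 = 1. Proof. by []. Qed.

Lemma fpsXX k n : fpsX k ^+ n = fpsX (k * n).
Proof.
elim: n => [|n IH]; first by rewrite muln0 fpsX0.
by rewrite exprS IH mulnS fpsXD.
Qed.

Lemma fpsX_neq0 k : fpsX k != 0.
Proof. by apply/fps_neq0P; exists k; rewrite /= eqxx oner_eq0. Qed.

End FpsRing.

Arguments fpsX {R} k%_N.

(** * Theta series *)

(** Only the supports have to correspond, so [h] and [g] may be floor divisions or absolute values
    that are inverse to each other nowhere else. *)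
Lemma eq_sum_bij (R : zmodType) (I J : eqType) (s : seq I) (s' : seq J)
    (F : I -> R) (F' : J -> R) (h : I -> J) (g : J -> I) :
  uniq s -> uniq s' ->
  (forall x, x \in s -> F x != 0 -> [/\ h x \in s', F' (h x) = F x & g (h x) = x]) ->
  (forall y, y \in s' -> F' y != 0 -> [/\ g y \in s, F (g y) = F' y & h (g y) = y]) ->
  \sum_(x <- s) F x = \sum_(y <- s') F' y.
Proof.
move=> Us Us' hP gP.
rewrite [LHS](bigID (fun x => F x != 0)) /= [X in _ + X]big1 => [|x /negPn/eqP//].
rewrite [RHS](bigID (fun y => F' y != 0)) /= [X in _ = _ + X]big1 => [|y /negPn/eqP//].
rewrite !addr0 -big_filter -[RHS]big_filter /=.
have pe : perm_eq [seq y <- s' | F' y != 0] [seq h x | x <- [seq x <- s | F x != 0]].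
  apply: uniq_perm; rewrite ?filter_uniq //.
    rewrite map_inj_in_uniq ?filter_uniq // => x y.
    rewrite !mem_filter => /andP[Fx xs] /andP[Fy ys] eh.
    by have [_ _ <-] := hP x xs Fx; have [_ _ <-] := hP y ys Fy; rewrite eh.
  move=> y; rewrite mem_filter; apply/andP/mapP => [[Fy ys]|[x]].
    have [gs Fg hg] := gP y ys Fy; exists (g y) => //.
    by rewrite mem_filter gs Fg Fy.
  rewrite mem_filter => /andP[Fx xs] ->.
  by have [? -> _] := hP x xs Fx.
rewrite [RHS](perm_big _ pe) big_map; apply: eq_big_seq => x; rewrite mem_filter => /andP[Fx xs].
by have [_ -> _] := hP x xs Fx.
Qed.

(** The window $[-n, n]$ is large enough for coefficient $n$ of a theta series, since $ck^2 = n$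
    with $c > 0$ forces $|k| \le n$. *)
Definition zrange (n : nat) : seq int := [seq i%:Z - n%:Z | i <- iota 0 n.*2.+1].

Lemma mem_zrange n (k : int) : (k \in zrange n) = (`|k| <= n)%N.
Proof.
apply/mapP/idP => [[i]|le_kn]; first by rewrite mem_iota => /andP[_ lt_i] ->; lia.
exists (absz (k + n%:Z)); last by lia.
by rewrite mem_iota; lia.
Qed.

Lemma zrange_uniq n : uniq (zrange n).
Proof. by rewrite map_inj_uniq ?iota_uniq // => i j; lia. Qed.

Definition zpairs n := [seq (k, m) | k <- zrange n, m <- zrange n].

Lemma zpairs_uniq n : uniq (zpairs n).
Proof.
by apply: (@allpairs_uniq _ _ _ pair); rewrite ?zrange_uniq // => -[? ?] [? ?].
Qed.

Lemma mem_zpairs n k m :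
  ((k, m) \in zpairs n) = (`|k| <= n)%N && (`|m| <= n)%N.
Proof.
rewrite -!mem_zrange; apply/allpairsP/andP => [[[? ?] /= [? ? [-> ->]]]|[? ?]] //.
by exists (k, m).
Qed.
Arguments zpairs : simpl never.

Section Theta.
Variable R : fieldType.
Implicit Types (w : int -> R) (W : int * int -> R).

Definition theta (c : nat) w : fps R :=
  Fps (fun n => \sum_(k <- zrange n) if c%:Z * k ^+ 2 == n%:Z then w k else 0).

Definition theta_pair (c d : nat) W : fps R := Fps (fun n =>
  \sum_(x <- zpairs n)
    if c%:Z * x.1 ^+ 2 + d%:Z * x.2 ^+ 2 == n%:Z then W x else 0).

Lemma sqz_le (c : nat) (k : int) (n : nat) :
  (0 < c)%N -> (c%:Z * k ^+ 2 <= n%:Z) -> (`|k| <= n)%N.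
Proof. rewrite expr2; nia. Qed.

Lemma eq_theta c w w' : w =1 w' -> theta c w = theta c w'.
Proof. by move=> e; apply: fpsP => n /=; apply: eq_bigr => k _; rewrite e. Qed.

Lemma eq_theta_pair c d W W' : (forall k m, W (k, m) = W' (k, m)) -> theta_pair c d W = theta_pair c d W'.
Proof.
by move=> e; apply: fpsP => n /=; apply: eq_bigr => -[k m] _; rewrite e.
Qed.

Lemma theta_pair_bij c d c' d' W W' (h g : int * int -> int * int) :
  (0 < c)%N -> (0 < d)%N -> (0 < c')%N -> (0 < d')%N ->
  (forall x, W x != 0 -> [/\ c'%:Z * (h x).1 ^+ 2 + d'%:Z * (h x).2 ^+ 2 =
     c%:Z * x.1 ^+ 2 + d%:Z * x.2 ^+ 2, W' (h x) = W x & g (h x) = x]) ->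
  (forall y, W' y != 0 -> [/\ c%:Z * (g y).1 ^+ 2 + d%:Z * (g y).2 ^+ 2 =
     c'%:Z * y.1 ^+ 2 + d'%:Z * y.2 ^+ 2, W (g y) = W' y & h (g y) = y]) ->
  theta_pair c d W = theta_pair c' d' W'.
Proof.
move=> c0 d0 c'0 d'0 hP gP; apply: fpsP => n /=.
apply: (eq_sum_bij (h := h) (g := g)).
- exact: zpairs_uniq.
- exact: zpairs_uniq.
- move=> x _; cbv beta; case: ifP => [/eqP eqn|_]; last by rewrite eqxx.
  move=> /hP; case: (h x) => k m [en -> ->]; rewrite en eqn eqxx; split=> //.
  rewrite mem_zpairs; apply/andP; split.
    by apply: (@sqz_le c'); rewrite // -eqn -en lerDl mulr_ge0 ?sqr_ge0.
  by apply: (@sqz_le d'); rewrite // -eqn -en lerDr mulr_ge0 ?sqr_ge0.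
- move=> y _; cbv beta; case: ifP => [/eqP eqn|_]; last by rewrite eqxx.
  move=> /gP; case: (g y) => k m [en -> ->]; rewrite en eqn eqxx; split=> //.
  rewrite mem_zpairs; apply/andP; split.
    by apply: (@sqz_le c); rewrite // -eqn -en lerDl mulr_ge0 ?sqr_ge0.
  by apply: (@sqz_le d); rewrite // -eqn -en lerDr mulr_ge0 ?sqr_ge0.
Qed.

Lemma theta_bij c c' w w' (h g : int -> int) : (0 < c)%N -> (0 < c')%N ->
  (forall k, w k != 0 ->
     [/\ c'%:Z * h k ^+ 2 = c%:Z * k ^+ 2, w' (h k) = w k & g (h k) = k]) ->
  (forall k, w' k != 0 ->
     [/\ c%:Z * g k ^+ 2 = c'%:Z * k ^+ 2, w (g k) = w' k & h (g k) = k]) ->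
  theta c w = theta c' w'.
Proof.
move=> c0 c'0 hP gP; apply: fpsP => n /=.
apply: (eq_sum_bij (h := h) (g := g)); rewrite ?zrange_uniq //.
- move=> x _; cbv beta; case: ifP => [/eqP eqn|_]; last by rewrite eqxx.
  move=> /hP[en -> ->]; rewrite en eqn eqxx mem_zrange; split=> //.
  by apply: (@sqz_le c'); rewrite // en eqn.
- move=> x _; cbv beta; case: ifP => [/eqP eqn|_]; last by rewrite eqxx.
  move=> /gP[en -> ->]; rewrite en eqn eqxx mem_zrange; split=> //.
  by apply: (@sqz_le c); rewrite // en eqn.
Qed.

Lemma cf_theta_range c w n N : (0 < c)%N -> (n <= N)%N ->
  cf (theta c w) n = \sum_(k <- zrange N) if c%:Z * k ^+ 2 == n%:Z then w k else 0.
Proof.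
move=> c0 le_nN /=; apply: (eq_sum_bij (h := id) (g := id)); rewrite ?zrange_uniq //.
  move=> k; rewrite !mem_zrange => le_k.
  by case: ifP; rewrite ?eqxx //; split=> //; rewrite (leq_trans le_k).
move=> k _; case: ifP => [/eqP e|]; rewrite ?eqxx // => _; split=> //.
by rewrite mem_zrange (@sqz_le c) // e.
Qed.

Lemma theta_mul c d w w' : (0 < c)%N -> (0 < d)%N ->
  theta c w * theta d w' = theta_pair c d (fun x => w x.1 * w' x.2).
Proof.
move=> c0 d0; apply: fpsP => n; rewrite cfM.
under eq_bigr => i _.
  rewrite (@cf_theta_range c w i n) // -1?ltnS // (@cf_theta_range d w' _ n) ?leq_subr //.
  rewrite big_distrlr; over.
rewrite exchange_big /= /zpairs big_allpairs; apply: eq_bigr => k _.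
rewrite exchange_big /=; apply: eq_bigr => m _.
have [lt_k|ge_k] := ltnP (absz (c%:Z * k ^+ 2)) n.+1; last first.
  rewrite big1 => [|i _].
    case: eqP => // en; have : (0 <= d%:Z * m ^+ 2) by rewrite mulr_ge0 ?sqr_ge0.
    by lia.
  by case: eqP; rewrite ?mul0r // => e; have := ltn_ord i; lia.
have c0k : 0 <= c%:Z * k ^+ 2 by rewrite mulr_ge0 ?sqr_ge0.
rewrite (bigD1 (Ordinal lt_k)) //= big1 => [|i ne_i].
  rewrite addr0 (introT eqP); last by lia.
  case: eqP => e1; case: eqP => e2; rewrite ?mulr0 //; lia.
case: eqP => [e|]; rewrite ?mul0r //; case/eqP: ne_i; apply: val_inj => /=; lia.
Qed.

Lemma theta_pairD c d W W' : theta_pair c d W + theta_pair c d W' = theta_pair c d (fun x => W x + W' x).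
Proof.
apply: fpsP => n; rewrite cfD /= -big_split; apply: eq_bigr => x _.
by case: ifP => _ /=; rewrite ?addr0.
Qed.

Lemma theta_pairN c d W : - theta_pair c d W = theta_pair c d (fun x => - W x).
Proof.
apply: fpsP => n; rewrite cfN /= -sumrN; apply: eq_bigr => x _.
by case: ifP => _ /=; rewrite ?oppr0.
Qed.

(* The substitution (k, m) = (u + v, u - v), for which k^2 + m^2 = 2u^2 + 2v^2. *)
Lemma theta_pair_rotate c W :
  (0 < c)%N -> (forall k m, W (k, m) != 0 -> ((k - m) %% 2 = 0)%Z) ->
  theta_pair c c W = theta_pair c.*2 c.*2 (fun x => W (x.1 + x.2, x.1 - x.2)).
Proof.
move=> c0 parW; have c20 : (0 < c.*2)%N by rewrite double_gt0.
apply: (@theta_pair_bij _ _ _ _ _ _ (fun x => (((x.1 + x.2) %/ 2)%Z, ((x.1 - x.2) %/ 2)%Z))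
  (fun x => (x.1 + x.2, x.1 - x.2))) => //.
  case=> k m /= WN0; have par := parW _ _ WN0.
  have ek : ((k + m) %/ 2)%Z + ((k - m) %/ 2)%Z = k by lia.
  have em : ((k + m) %/ 2)%Z - ((k - m) %/ 2)%Z = m by lia.
  split; rewrite ?ek ?em //.
  by move: ek em; move: (_ %/ _)%Z (_ %/ _)%Z => p q <- <-; rewrite -muln2 PoszM; ring.
case=> u v /= _; split=> //; first by rewrite -muln2 PoszM; ring.
by congr (_, _); lia.
Qed.

End Theta.

(** * Theta series of level 13: addition and duplication formulas *)

Section Level13.
Variable R : fieldType.

Definition odd1 (k : int) : R := if (k %% 2)%Z == 1 then 1 else 0.
Definition even1 (k : int) : R := if (k %% 2)%Z == 0 then 1 else 0.
Definition oddchi (k : int) : R :=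
  if (k %% 4)%Z == 1 then 1 else if (k %% 4)%Z == 3 then -1 else 0.
Definition evenchi (k : int) : R :=
  if (k %% 4)%Z == 0 then 1 else if (k %% 4)%Z == 2 then -1 else 0.

(** The class is $2a$ rather than $a$ so that the odd $k$ in it are the $26j + 2a - 13$, which makes
    $a$ itself the exponent of $q$ in the product expansion. *)
Definition cong13 (a k : int) : bool := ((k - 2 * a) %% 13)%Z == 0.
Definition at13 (f : int -> R) a k := if cong13 a k then f k else 0.
Definition theta_class c (f : int -> R) a := theta c (at13 f a).

Definition per4 (f : int -> R) := forall k, f k = f (k %% 4)%Z.

Lemma odd1_per4 : per4 odd1.
Proof. by move=> k; rewrite /odd1; congr (if _ == _ then _ else _); lia. Qed.
Lemma even1_per4 : per4 even1.
Proof. by move=> k; rewrite /even1; congr (if _ == _ then _ else _); lia. Qed.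
Lemma oddchi_per4 : per4 oddchi.
Proof. by move=> k; rewrite /oddchi modz_mod. Qed.
Lemma evenchi_per4 : per4 evenchi.
Proof. by move=> k; rewrite /evenchi modz_mod. Qed.

Lemma per4D f u v : per4 f -> f (u + v) = f ((u %% 4)%Z + (v %% 4)%Z).
Proof. by move=> pf; rewrite pf [RHS]pf modzDm. Qed.

Lemma per4B f u v : per4 f -> f (u - v) = f ((u %% 4)%Z - (v %% 4)%Z).
Proof. by move=> pf; rewrite pf [RHS]pf; congr f; lia. Qed.

Lemma mod4_case (k : int) : [\/ (k %% 4)%Z = 0, (k %% 4)%Z = 1, (k %% 4)%Z = 2 | (k %% 4)%Z = 3].
Proof.
have : ((k %% 4)%Z == 0) || ((k %% 4)%Z == 1) || ((k %% 4)%Z == 2) || ((k %% 4)%Z == 3) by lia.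
by case/orP=> [/orP[/orP[]|]|] /eqP->; [constructor 1|constructor 2|constructor 3|constructor 4].
Qed.

Definition theta_pair13 c a b (h : int -> int -> R) :=
  theta_pair c c (fun x => if cong13 a x.1 && cong13 b x.2 then h x.1 x.2 else 0).

Lemma eq_theta_pair13 c a b h h' : (forall u v, h u v = h' u v) -> theta_pair13 c a b h = theta_pair13 c a b h'.
Proof. by move=> e; apply: eq_theta_pair => k m; rewrite /= e. Qed.

Lemma theta_pair13D c a b h h' : theta_pair13 c a b h + theta_pair13 c a b h' =
  theta_pair13 c a b (fun u v => h u v + h' u v).
Proof. by rewrite /theta_pair13 theta_pairD; apply: eq_theta_pair => k m /=; case: ifP; rewrite ?addr0. Qed.

Lemma theta_pair13N c a b h : - theta_pair13 c a b h = theta_pair13 c a b (fun u v => - h u v).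
Proof. by rewrite /theta_pair13 theta_pairN; apply: eq_theta_pair => k m /=; case: ifP; rewrite ?oppr0. Qed.

Lemma theta_class_mul c f g a b : (0 < c)%N ->
  theta_class c f a * theta_class c g b = theta_pair13 c a b (fun u v => f u * g v).
Proof.
move=> c0; rewrite /theta_class theta_mul //; apply: eq_theta_pair => k m /=; rewrite /at13.
by case: (cong13 a k); case: (cong13 b m); rewrite ?mul0r ?mulr0.
Qed.

(** Since 2 is invertible mod 13, $(u, v)$ lies in the classes $(a, b)$ exactly when $(u+v, u-v)$
    lies in $(a+b, a-b)$. *)
Lemma theta_class_rotate c f g a b : (0 < c)%N ->
  (forall k m, f k * g m != 0 -> ((k - m) %% 2 = 0)%Z) ->
  theta_class c f (a + b) * theta_class c g (a - b) = theta_pair13 c.*2 a b (fun u v => f (u + v) * g (u - v)).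
Proof.
move=> c0 par; rewrite /theta_class theta_mul // theta_pair_rotate //; last first.
  move=> k m /=; rewrite /at13.
  by case: (cong13 _ k); case: (cong13 _ m); rewrite ?mul0r ?mulr0 ?eqxx //; apply: par.
apply: eq_theta_pair => u v /=; rewrite /at13.
have -> : cong13 a u && cong13 b v = cong13 (a + b) (u + v) && cong13 (a - b) (u - v).
  by rewrite /cong13; lia.
by case: (cong13 _ (u + v)); case: (cong13 _ (u - v)); rewrite ?mul0r ?mulr0.
Qed.

(* Summands antisymmetric in v cancel, since the class of 0 mod 13 is symmetric. *)
Lemma theta_pair13_odd c a h : (0 < c)%N -> (2%:R != 0 :> R) ->
  (forall u v, h u (- v) = - h u v) -> theta_pair13 c a 0 h = 0.
Proof.
move=> c0 ne2 hN.
have e : theta_pair13 c a 0 h = - theta_pair13 c a 0 h.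
  rewrite theta_pair13N; apply: (@theta_pair_bij _ _ _ _ _ _ _ (fun x => (x.1, - x.2))
    (fun x => (x.1, - x.2))) => //; case=> u v _ /=;
    rewrite opprK sqrrN ?hN ?opprK; split=> //;
    have -> : cong13 0 (- v) = cong13 0 v by rewrite /cong13; lia.
  - by case: ifP; rewrite ?opprK.
  - by [].
apply: fpsP => n; move/(congr1 (fun f => cf f n)): e; rewrite cfN cf0 => e.
have : 2%:R * cf (theta_pair13 c a 0 h) n = 0 by rewrite -[2%:R]/(1 + 1) mulrDl mul1r {2}e subrr.
by move/eqP; rewrite mulf_eq0 (negbTE ne2) => /eqP.
Qed.

(* With q = z^104, Jacobi's triple product turns [theta1 a] into the product of the
   (1 - q^(13 n)) (1 - q^(13 n - 13 + a)) (1 - q^(13 n - a)), n > 0, up to sign and a power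
   of z; [theta2_2] and [theta3_2] are [theta2] and [theta3] with z^2 in place of z. *)
Definition theta1 := theta_class 1 oddchi.
Definition theta3_2 := theta_class 2 even1.
Definition theta2_2 := theta_class 2 odd1.
Definition theta2 := theta_class 1 odd1.
Definition theta3 := theta_class 1 even1.
Definition theta4 := theta_class 1 evenchi.

Ltac mod4_cases u v :=
  case: (mod4_case u) => ->; case: (mod4_case v) => ->;
  rewrite /odd1 /even1 /oddchi /evenchi /=;
  rewrite ?(mulr0, mul0r, mulr1, mul1r, mulrNN, mulrN, mulNr, oppr0, opprK,
    addr0, add0r, subr0, sub0r, subrr, addNr) //.
Ltac per4 u v := rewrite
  1?(per4B u v odd1_per4) 1?(per4B u v even1_per4)
  1?(per4B u v oddchi_per4) 1?(per4B u v evenchi_per4)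
  1?(per4D u v odd1_per4) 1?(per4D u v even1_per4)
  1?(per4D u v oddchi_per4) 1?(per4D u v evenchi_per4).

Lemma odd1_supp k : odd1 k != 0 -> (k %% 2 = 1)%Z.
Proof. by rewrite /odd1; case: ifP => [/eqP//|_]; rewrite eqxx. Qed.
Lemma even1_supp k : even1 k != 0 -> (k %% 2 = 0)%Z.
Proof. by rewrite /even1; case: ifP => [/eqP//|_]; rewrite eqxx. Qed.
Lemma oddchi_supp k : oddchi k != 0 -> (k %% 2 = 1)%Z.
Proof.
by rewrite /oddchi; case: ifP => [/eqP ? _|_]; [lia|case: ifP => [/eqP ? _|_]; [lia|rewrite eqxx]].
Qed.
Lemma evenchi_supp k : evenchi k != 0 -> (k %% 2 = 0)%Z.
Proof.
by rewrite /evenchi; case: ifP => [/eqP ? _|_]; [lia|case: ifP => [/eqP ? _|_]; [lia|rewrite eqxx]].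
Qed.

Ltac parity l1 l2 :=
  move=> k m; rewrite mulf_eq0 negb_or => /andP[/l1 ? /l2 ?]; lia.

(** Exactly one of $u, v$ is odd, which gives the two terms; the sign is that of $(u+v)(u-v) = u^2 -
    v^2 \equiv \pm 1$ mod 4. *)
Lemma theta1_mul a b : theta1 (a + b) * theta1 (a - b) = theta2_2 a * theta3_2 b - theta3_2 a * theta2_2 b.
Proof.
rewrite theta_class_rotate //; last by parity oddchi_supp oddchi_supp.
rewrite !theta_class_mul // theta_pair13N theta_pair13D; apply: eq_theta_pair13 => u v; per4 u v.
rewrite [odd1 u]odd1_per4 [even1 v]even1_per4 [even1 u]even1_per4 [odd1 v]odd1_per4.
by mod4_cases u v.
Qed.

Lemma evenchiN k : evenchi (- k) = evenchi k.
Proof.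
by rewrite -[- k]add0r (per4B 0 k evenchi_per4) [RHS]evenchi_per4; case: (mod4_case k) => ->.
Qed.

(** The pairs with $u$ odd and $v$ even give the right-hand side. Those with $u$ even and $v$ odd
    contribute a function odd in $v$, which cancels because $v$ runs over the symmetric class 0. *)
Lemma theta1_theta2 a : 2%:R != 0 :> R -> theta1 a * theta2 a = theta_class 2 oddchi a * theta_class 2 evenchi 0.
Proof.
move=> ne2; rewrite -{1}[a]addr0 -{2}[a]subr0 theta_class_rotate //; last by parity oddchi_supp odd1_supp.
apply/eqP; rewrite -subr_eq0 theta_class_mul // theta_pair13N theta_pair13D theta_pair13_odd // => u v.
rewrite opprK evenchiN; per4 u v.
rewrite [oddchi u]oddchi_per4 [evenchi v]evenchi_per4; mod4_cases u v.
Qed.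

Lemma theta3_theta4 a : 2%:R != 0 :> R -> theta3 a * theta4 a = theta_class 2 evenchi a * theta_class 2 evenchi 0.
Proof.
move=> ne2; rewrite -{1}[a]addr0 -{2}[a]subr0 theta_class_rotate //; last by parity even1_supp evenchi_supp.
apply/eqP; rewrite -subr_eq0 theta_class_mul // theta_pair13N theta_pair13D theta_pair13_odd // => u v.
rewrite opprK evenchiN; per4 u v.
rewrite [evenchi u]evenchi_per4 [evenchi v]evenchi_per4; mod4_cases u v.
Qed.

Lemma theta2_sq a : theta2 a ^+ 2 = theta2_2 a * theta3_2 0 + theta3_2 a * theta2_2 0.
Proof.
rewrite expr2 -{1}[a]addr0 -{2}[a]subr0 theta_class_rotate //; last by parity odd1_supp odd1_supp.
rewrite !theta_class_mul // theta_pair13D; apply: eq_theta_pair13 => u v; per4 u v.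
rewrite [odd1 u]odd1_per4 [even1 v]even1_per4 [even1 u]even1_per4 [odd1 v]odd1_per4.
by mod4_cases u v.
Qed.

Lemma theta3_sq a : theta3 a ^+ 2 = theta3_2 a * theta3_2 0 + theta2_2 a * theta2_2 0.
Proof.
rewrite expr2 -{1}[a]addr0 -{2}[a]subr0 theta_class_rotate //; last by parity even1_supp even1_supp.
rewrite !theta_class_mul // theta_pair13D; apply: eq_theta_pair13 => u v; per4 u v.
rewrite [odd1 u]odd1_per4 [even1 v]even1_per4 [even1 u]even1_per4 [odd1 v]odd1_per4.
by mod4_cases u v.
Qed.

Lemma theta4_sq a : theta4 a ^+ 2 = theta3_2 a * theta3_2 0 - theta2_2 a * theta2_2 0.
Proof.
rewrite expr2 -{1}[a]addr0 -{2}[a]subr0 theta_class_rotate //; last by parity evenchi_supp evenchi_supp.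
rewrite !theta_class_mul // theta_pair13N theta_pair13D; apply: eq_theta_pair13 => u v; per4 u v.
rewrite [odd1 u]odd1_per4 [even1 v]even1_per4 [even1 u]even1_per4 [odd1 v]odd1_per4.
by mod4_cases u v.
Qed.

(* Half of [theta2 0], summed over one sign only so as to survive in characteristic 2. *)
Definition Psi := theta 1 (fun k => if (0 < k) then at13 odd1 0 k else 0).

Lemma theta2_0 : theta2 0 = 2%:R * Psi.
Proof.
have eN : Psi = theta 1 (fun k => if k < 0 then at13 odd1 0 k else 0).
  have oddN k : at13 odd1 0 (- k) = at13 odd1 0 k.
    rewrite /at13 /odd1 (_ : cong13 0 (- k) = cong13 0 k); last by rewrite /cong13; lia.
    by rewrite (_ : ((- k) %% 2 = k %% 2)%Z) //; lia.
  by apply: (theta_bij (h := -%R) (g := -%R)) => // k _; rewrite sqrrN opprK oddN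
    ?oppr_lt0 ?oppr_gt0.
rewrite -[2%:R]/(1 + 1) mulrDl mul1r {2}eN.
apply: fpsP => n; rewrite cfD /= -big_split /=; apply: eq_bigr => k _.
case: ifP => _; rewrite ?addr0 //.
have [] := ltgtP k 0; rewrite ?addr0 ?add0r // => -> .
by rewrite /at13 /odd1 /=.
Qed.

(** Unlike the formulas through [theta2], this duplication is a bijection of index pairs without
    cancellation, so it holds in characteristic 2 as well. *)
Lemma theta1_double a : theta1 (a + a) * Psi = theta_class 2 oddchi a * theta_class 2 evenchi a.
Proof.
rewrite /theta1 /Psi /theta_class !theta_mul //.
pose k2 x : int := (((x.1 + x.2) %/ 2)%Z); pose m2 x : int := (((x.1 - x.2) %/ 2)%Z).
apply: (@theta_pair_bij _ _ _ _ _ _ _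
  (* For $u, v$ odd exactly one of $(u \pm v)/2$ is odd; it goes first. Conversely the difference of
     an odd and an even number is never 0, so its absolute value is an admissible $v > 0$, and the
     order of the two halves records the lost sign. *)
  (fun x : int * int => if (k2 x %% 2)%Z == 1 then (k2 x, m2 x) else (m2 x, k2 x))
  (fun x : int * int => (x.1 + x.2, `|x.1 - x.2|))) => // -[u v] /=; rewrite mulf_eq0 negb_or.
- case/andP; rewrite /at13; case: ifP => [cu|]; last by rewrite eqxx.
  move=> /oddchi_supp ou; case: ifP => [v0|]; last by rewrite eqxx.
  case: ifP => [cv|]; last by rewrite eqxx.
  move=> /odd1_supp ov.
  have eu : u = k2 (u, v) + m2 (u, v) by rewrite /k2 /m2 /=; lia.
  have ev : v = k2 (u, v) - m2 (u, v) by rewrite /k2 /m2 /=; lia.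
  move: (k2 _) (m2 _) eu ev => k m eu ev; subst u v.
  have c1 : cong13 a k by move: cu cv; rewrite /cong13; lia.
  have c2 : cong13 a m by move: cu cv; rewrite /cong13; lia.
  have -> : odd1 (k - m) = 1 by rewrite /odd1 ov.
  case: ifP => [/eqP ok|/eqP ek] /=; rewrite c1 c2 mulr1; split.
  + by ring.
  + have : (m %% 2 = 0)%Z by lia.
    rewrite [oddchi k]oddchi_per4 [evenchi m]evenchi_per4 (per4D _ _ oddchi_per4).
    by case: (mod4_case k) => e1; case: (mod4_case m) => e2;
      rewrite e1 e2 /oddchi /evenchi /= ?(mulr0, mul0r, mulr1, mul1r, mulrNN, mulrN, mulNr) //; lia.
  + by congr (_, _); lia.
  + by ring.
  + have : (m %% 2 = 1)%Z by lia.
    rewrite [oddchi m]oddchi_per4 [evenchi k]evenchi_per4 (per4D _ _ oddchi_per4).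
    by case: (mod4_case k) => e1; case: (mod4_case m) => e2;
      rewrite e1 e2 /oddchi /evenchi /= ?(mulr0, mul0r, mulr1, mul1r, mulrNN, mulrN, mulNr) //; lia.
  + by congr (_, _); lia.
- case/andP; rewrite /at13; case: ifP => [cu|]; last by rewrite eqxx.
  move=> /oddchi_supp ou; case: ifP => [cv|]; last by rewrite eqxx.
  move=> /evenchi_supp ov.
  have [->] : cong13 (a + a) (u + v) by move: cu cv; rewrite /cong13; lia.
  have [->] : cong13 0 `|u - v| by move: cu cv; rewrite /cong13; lia.
  have -> : 0 < `|u - v| by lia.
  have -> : odd1 `|u - v| = 1 by rewrite /odd1 (_ : (_ %% 2)%Z = 1) //; lia.
  rewrite mulr1; split.
  + rewrite real_normK ?num_real //; ring.
  + rewrite [oddchi u]oddchi_per4 [evenchi v]evenchi_per4 (per4D _ _ oddchi_per4).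
    by case: (mod4_case u) => e1; case: (mod4_case v) => e2;
      rewrite e1 e2 /oddchi /evenchi /= ?(mulr0, mul0r, mulr1, mul1r, mulrNN, mulrN, mulNr) //; lia.
  + rewrite /k2 /m2 /=; case: ifP => [/eqP|/eqP] o; congr (_, _); lia.
Qed.

End Level13.

(** * Frobenius on power series *)

Section Frobenius.
Variables (R : fieldType) (l : nat).
Hypothesis charRl : l \in [pchar R].

Let l_gt0 : (0 < l)%N. Proof. exact: prime_gt0 (pcharf_prime charRl). Qed.

Lemma pchar_fps : l \in [pchar (fps R)].
Proof.
rewrite inE (pcharf_prime charRl) /=; apply/eqP/fpsP => n.
have -> : (l%:R : fps R) = Fps (fun n => if n == 0%N then l%:R else 0).
  apply: fpsP => m; elim: (l) => [|k IH]; first by rewrite /=; case: ifP.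
  by rewrite mulrS cfD IH cf1 /=; case: eqP; rewrite ?mulrS ?addr0.
by rewrite /= (pcharf0 charRl) if_same.
Qed.

Lemma poly_frob (q : {poly R}) n :
  (q ^+ l)`_n = if (l %| n)%N then q`_(n %/ l) ^+ l else 0.
Proof.
have charP : l \in [pchar {poly R}] by rewrite pchar_poly.
rewrite -{1}[q]coefK poly_def -(pFrobenius_autE charP) rmorph_sum coef_sum /=.
under eq_bigr => i _ do rewrite pFrobenius_autE exprZn -exprM coefZ coefXn.
case: ifP => [/dvdnP[m ->]|ndvd]; last first.
  rewrite big1 // => i _; case: eqP => [e|]; rewrite ?mulr0 //.
  by move: ndvd; rewrite e dvdn_mull.
rewrite mulnK //; have [lt_m|ge_m] := ltnP m (size q); last first.
  rewrite nth_default // expr0n /= eqn0Ngt l_gt0 big1 // => i _.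
  rewrite eqn_pmul2r // gtn_eqF ?mulr0 //; exact: leq_trans (ltn_ord i) ge_m.
rewrite (bigD1 (Ordinal lt_m)) //= eqxx mulr1 big1 ?addr0 // => i ne_i.
rewrite eqn_pmul2r //; case: eqP => [e|]; rewrite ?mulr0 //.
by case/eqP: ne_i; apply: val_inj.
Qed.

Lemma cf_expr_poly (f : fps R) (q : {poly R}) k n :
  (forall i, (i <= n)%N -> q`_i = cf f i) ->
  forall i, (i <= n)%N -> (q ^+ k)`_i = cf (f ^+ k) i.
Proof.
move=> e; elim: k => [|k IH] i le_in; first by rewrite !expr0 coef1 cf1.
rewrite !exprS; symmetry; apply: fps_mul_poly => j le_ji.
  by apply: e; apply: leq_trans le_in.
by apply: IH; apply: leq_trans le_in.
Qed.

Lemma cf_frob (f : fps R) n :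
  cf (f ^+ l) n = if (l %| n)%N then cf f (n %/ l) ^+ l else 0.
Proof.
rewrite -(@cf_expr_poly f (trunc f n) l n) // => [|i le_i]; last exact: coef_trunc.
by rewrite poly_frob coef_trunc // leq_div.
Qed.

Lemma theta_frob c w : (0 < c)%N -> (forall k, w k ^+ l = w k) ->
  theta c w ^+ l = theta (c * l) w :> fps R.
Proof.
move=> c0 wl; apply: fpsP => n; rewrite cf_frob.
case: ifP => [/dvdnP[m ->]|ndvd]; last first.
  symmetry; rewrite /= big1 // => k _; case: eqP => // e; case/negP: ndvd.
  apply/dvdnP; exists (absz (c%:Z * k ^+ 2)).
  have := mulr_ge0 (_ : 0 <= c%:Z) (sqr_ge0 k); rewrite PoszM in e; lia.
rewrite mulnK // (@cf_theta_range _ c w m (m * l)) ?leq_pmulr //.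
rewrite -(pFrobenius_autE charRl) rmorph_sum /=; apply: eq_bigr => k _.
rewrite pFrobenius_autE !PoszM mulrAC.
have -> : (c%:Z * k ^+ 2 * l%:Z == m%:Z * l%:Z) = (c%:Z * k ^+ 2 == m%:Z).
  by rewrite (inj_eq (mulIf _)) //; lia.
by case: eqP; rewrite ?wl // expr0n eqn0Ngt l_gt0.
Qed.

End Frobenius.

(** * The theta formulas in characteristic 2 *)

Section Char2.
Variable R : fieldType.
Hypothesis char2 : 2 \in [pchar R].

Let opp1 : - 1 = 1 :> R.
Proof. exact: (oppr_pchar2 char2). Qed.

Lemma oddchi2 k : oddchi R k = odd1 R k.
Proof.
by rewrite [LHS]oddchi_per4 [RHS]odd1_per4; case: (mod4_case k) => ->; rewrite /oddchi /odd1 /= ?opp1.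
Qed.
Lemma evenchi2 k : evenchi R k = even1 R k.
Proof.
by rewrite [LHS]evenchi_per4 [RHS]even1_per4; case: (mod4_case k) => ->; rewrite /evenchi /even1 /= ?opp1.
Qed.

Lemma char2_idem (P : bool) k : (if P then odd1 R k else 0) ^+ 2 = (if P then odd1 R k else 0).
Proof. by case: P; rewrite ?expr0n // /odd1; case: ifP => _; rewrite ?expr1n ?expr0n. Qed.

Lemma theta1_sq_char2 a : theta1 R a ^+ 2 = theta2_2 R a.
Proof.
rewrite /theta1 /theta2_2 /theta_class (theta_frob char2) // => [|k].
  by apply: eq_theta => k; rewrite /at13 oddchi2.
by rewrite /at13 oddchi2 char2_idem.
Qed.

Lemma theta1_mul_char2 a b : theta1 R (a + b) * theta1 R (a - b) =
  theta3_2 R a * theta1 R b ^+ 2 + theta3_2 R b * theta1 R a ^+ 2.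
Proof.
rewrite theta1_mul !theta1_sq_char2 (oppr_pchar2 (pchar_fps char2)) addrC.
by congr (_ + _); rewrite mulrC.
Qed.

Lemma theta1_double_char2 a : theta1 R (a + a) * Psi R = theta3_2 R a * theta1 R a ^+ 2.
Proof.
rewrite theta1_double theta1_sq_char2 mulrC; congr (_ * _); apply: eq_theta => k;
  by rewrite /at13 ?oddchi2 ?evenchi2.
Qed.

(** An even $k$ in the class of $2a$ is $2j$ with $j$ in the class of $a$, and $2k^2 = 8j^2$. The
    even and the odd $j$ give the two powers by Frobenius. *)
Lemma theta3_2_double_char2 a : theta3_2 R (a + a) = theta3_2 R a ^+ 4 + theta1 R a ^+ 8.
Proof.
rewrite (_ : 4 = 2 * 2)%N // (_ : 8 = 2 * (2 * 2))%N // !exprM theta1_sq_char2.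
have idem f : f = even1 R \/ f = odd1 R -> forall k, at13 f a k ^+ 2 = at13 f a k.
  by move=> [->|->] k; rewrite /at13 /even1 /odd1; case: (cong13 a k);
    rewrite ?expr0n //; case: ifP => _; rewrite ?expr1n ?expr0n.
rewrite /theta3_2 /theta2_2 /theta_class !(theta_frob char2) //; try by apply: idem; auto.
have -> : theta 8 (at13 (even1 R) a) + theta 8 (at13 (odd1 R) a)
    = theta 8 (fun k => if cong13 a k then 1 else 0).
  apply: fpsP => n; rewrite cfD /= -big_split; apply: eq_bigr => k _ /=.
  case: ifP => _; rewrite ?addr0 // /at13; case: ifP => _; rewrite ?addr0 //.
  by rewrite /even1 /odd1; case: ifP => ?; case: ifP => ?; rewrite ?addr0 ?add0r //; lia.
apply: (@theta_bij _ _ _ _ _ (fun k => (k %/ 2)%Z) (fun k => k * 2)) => // k.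
  rewrite /at13; case: ifP => [ck|]; last by rewrite eqxx.
  move=> /even1_supp ek; have ej : k = (k %/ 2)%Z * 2 by lia.
  move: (k %/ 2)%Z ej ek ck => j -> ek ck; split=> //; first by ring.
  by rewrite ifT /even1 ?ek //; move: ck; rewrite /cong13; lia.
case: ifP => [ck _|]; last by rewrite eqxx.
split; first by ring.
  rewrite /at13 ifT; last by move: ck; rewrite /cong13; lia.
  by rewrite /even1 ifT //; lia.
by lia.
Qed.

End Char2.

(** * Euler products *)

Section Congruence.
Variable R : fieldType.
Implicit Types f g h : fps R.

Definition eqm N f g := forall n, (n < N)%N -> cf f n = cf g n.

Lemma eqm_sym N f g : eqm N f g -> eqm N g f. Proof. by move=> e n /e. Qed.
Lemma eqm_trans N f g h : eqm N f g -> eqm N g h -> eqm N f h.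
Proof. by move=> e1 e2 n lt_n; rewrite e1 ?e2. Qed.
Lemma eqm_leq N N' f g : (N' <= N)%N -> eqm N f g -> eqm N' f g.
Proof. by move=> le_N e n lt_n; apply: e; apply: leq_trans le_N. Qed.

Lemma eqmM N f f' g g' : eqm N f f' -> eqm N g g' -> eqm N (f * g) (f' * g').
Proof.
move=> ef eg n lt_n; rewrite !cfM; apply: eq_bigr => i _.
rewrite ef ?eg //; first by apply: leq_ltn_trans (leq_subr _ _) lt_n.
by apply: leq_ltn_trans lt_n; rewrite -ltnS.
Qed.

Lemma eqm_prod N I (s : seq I) (P : pred I) (F G : I -> fps R) :
  (forall i, P i -> eqm N (F i) (G i)) ->
  eqm N (\prod_(i <- s | P i) F i) (\prod_(i <- s | P i) G i).
Proof. by move=> e; elim/big_rec2: _ => // i f g Pi; apply: eqmM; apply: e. Qed.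

Lemma eqmX N f g k : eqm N f g -> eqm N (f ^+ k) (g ^+ k).
Proof. by move=> e; elim: k => // k IH; rewrite !exprS; apply: eqmM. Qed.

Lemma eqm_eq f g : (forall N, eqm N f g) -> f = g.
Proof. by move=> e; apply: fpsP => n; apply: (e n.+1). Qed.

Lemma eqm_cancel N f g h : cf h 0 != 0 -> eqm N (f * h) (g * h) -> eqm N f g.
Proof.
rewrite -fps_unitE => Uh e.
by rewrite -[f](mulrK Uh) -[g](mulrK Uh); apply: eqmM.
Qed.

Lemma eqm1B N k c : (N <= k)%N -> eqm N (1 - c * fpsX k) 1.
Proof.
move=> le_Nk n lt_n; rewrite cfB mulrC cf_fpsXM leqNgt (leq_trans lt_n) ?subr0 //.
Qed.

Lemma eqm1B' N k : (N <= k)%N -> eqm N (1 - fpsX k) 1.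
Proof. by rewrite -[fpsX k]mul1r; apply: eqm1B. Qed.

Definition qfact k m : fps R := \prod_(i < m) (1 - fpsX (k * i.+1)).

(* The infinite product of the 1 - X^(k i), i > 0: factors with i > n do not affect the
   coefficient of index n. *)
Definition eta k : fps R := Fps (fun n => cf (qfact k n) n).

Lemma qfact_eqm k m m' N : (N <= k * m.+1)%N -> (m <= m')%N -> eqm N (qfact k m') (qfact k m).
Proof.
move=> le_N; elim: m' => [|m' IH]; first by rewrite leqn0 => /eqP->.
rewrite leq_eqVlt => /predU1P[->//|]; rewrite ltnS => le_m.
rewrite {1}/qfact big_ord_recr -/(qfact k m') /= -[qfact k m]mulr1.
apply: eqmM (IH le_m) _; apply: eqm1B'; apply: leq_trans le_N _.
by rewrite leq_mul2l ltnS le_m orbT.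
Qed.

Lemma eta_eqm k m N : (0 < k)%N -> (N <= k * m.+1)%N -> eqm N (eta k) (qfact k m).
Proof.
move=> k0 le_N n lt_n /=; have [le_mn|lt_nm] := leqP m n.
  exact: (qfact_eqm le_N le_mn lt_n).
by symmetry; apply: (@qfact_eqm k n m n.+1) => //; [nia|exact: ltnW].
Qed.

Lemma cf_qfact0 k m : (0 < k)%N -> cf (qfact k m) 0 = 1.
Proof.
move=> k0; rewrite /qfact; elim/big_rec: _ => // i f _ ef.
by rewrite cfM0 ef mulr1 cfB cf1 /= eq_sym muln_eq0 eqn0Ngt k0 subr0.
Qed.

Lemma cf_eta0 k : cf (eta k) 0 = 1.
Proof. by rewrite /= /qfact big_ord0 cf1. Qed.

Lemma eta_neq0 k : eta k != 0.
Proof. by apply/fps_neq0P; exists 0%N; rewrite cf_eta0 oner_eq0. Qed.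

Lemma qfactS k m : qfact k m.+1 = qfact k m * (1 - fpsX (k * m.+1)).
Proof. by rewrite /qfact big_ord_recr. Qed.

End Congruence.

(** * Gaussian binomials and the q-binomial theorem *)

Section QBinomial.
Variables (R : comNzRingType) (q : R).

Fixpoint qbin n k : R :=
  match n, k with
  | _, 0 => 1
  | 0, _.+1 => 0
  | n'.+1, k'.+1 => qbin n' k + q ^+ (n' - k') * qbin n' k'
  end.

Arguments qbin : simpl never.

Lemma qbin0 n : qbin n 0 = 1. Proof. by case: n. Qed.

Lemma qbinS n k : qbin n.+1 k.+1 = qbin n k.+1 + q ^+ (n - k) * qbin n k.
Proof. by []. Qed.

Lemma qbin_small n k : (n < k)%N -> qbin n k = 0.
Proof.
elim: n k => [|n IH] [|k] //; rewrite ltnS => lt_nk.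
by rewrite qbinS !IH ?mulr0 ?addr0 // ltnW.
Qed.

Lemma qbinomial_theorem (u w : R) n :
  \prod_(i < n) (u + w * q ^+ i) =
  \sum_(k < n.+1) q ^+ 'C(k, 2) * qbin n k * w ^+ k * u ^+ (n - k).
Proof.
elim: n => [|n IH]; first by rewrite big_ord0 big_ord1 /= !expr0 !mul1r.
rewrite big_ord_recr /= IH [RHS]big_ord_recl /= mulrDr !mulr_suml.
rewrite big_ord_recl /= !qbin0 !subn0 bin0n !expr0 !mul1r -exprSr -addrA; congr (_ + _).
have -> : \sum_(i < n.+1) q ^+ 'C(bump 0 i, 2) * qbin n.+1 (bump 0 i) * w ^+ bump 0 i
    * u ^+ (n.+1 - bump 0 i) =
    \sum_(i < n.+1) q ^+ 'C(i.+1, 2) * qbin n i.+1 * w ^+ i.+1 * u ^+ (n - i)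
    + \sum_(i < n.+1) q ^+ 'C(i, 2) * qbin n i * w ^+ i * u ^+ (n - i) * (w * q ^+ n).
  rewrite -big_split /=; apply: eq_bigr => i _; rewrite /bump /= add1n subSS qbinS.
  rewrite (_ : q ^+ n = q ^+ i * q ^+ (n - i)); last first.
    by rewrite -exprD subnKC // -ltnS.
  by rewrite binS bin1 exprD exprS; ring.
congr (_ + _); rewrite [RHS]big_ord_recr /= qbin_small // mulr0 !mul0r addr0.
apply: eq_bigr => i _; rewrite /bump /= add1n -!mulrA -exprSr; congr (_ * (_ * (_ * _ ^+ _))).
by have := ltn_ord i; lia.
Qed.

End QBinomial.

(** * Jacobi's triple product, in finite form and modulo powers of X *)

Section TripleProduct.
Variable R : fieldType.

Lemma qbin_qfact (M n k : nat) : (k <= n)%N ->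
  qbin (fpsX M : fps R) n k * qfact R M k * qfact R M (n - k) = qfact R M n.
Proof.
elim: n k => [|n IH] [|k] //; rewrite ?qbin0 ?subn0 ?mul1r.
- by rewrite /qfact big_ord0 mul1r.
- by rewrite /qfact big_ord0 mul1r.
rewrite ltnS subSS qbinS leq_eqVlt => /predU1P[->|lt_kn].
  rewrite qbin_small // add0r subnn expr0 mul1r !qfactS mulrA mulrAC; congr (_ * _).
  by have := IH n (leqnn n); rewrite subnn.
have e1 := IH _ lt_kn; have e2 := IH _ (ltnW lt_kn).
have es : (n - k = (n - k.+1).+1)%N by lia.
rewrite fpsXX !mulrDl -mulrA.
have -> : qbin (fpsX M) n k.+1 * (qfact R M k.+1 * qfact R M (n - k))
  = qfact R M n * (1 - fpsX (M * (n - k))).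
  by rewrite -e1 {1}es (qfactS R M (n - k.+1)) -es; ring.
have -> : fpsX (M * (n - k)) * qbin (fpsX M) n k * qfact R M k.+1 * qfact R M (n - k)
  = qfact R M n * fpsX (M * (n - k)) * (1 - fpsX (M * k.+1)).
  by rewrite -e2 qfactS; ring.
rewrite qfactS (_ : (M * n.+1 = M * (n - k) + M * k.+1)%N) ?fpsXD; first by ring.
by rewrite -mulnDr; congr muln; lia.
Qed.

(** With $m = \min(k, 2N-k)$, all the q-factorials of orders $k$, $2N-k$, $N$ and $2N$ agree with
    the one of order $m$ below degree $M(m+1)$. *)
Lemma qbin_eqm (M N k : nat) : (0 < M)%N -> (k <= N.*2)%N ->
  eqm (M * (N - `|k%:Z - N%:Z|).+1) (qfact R M N * qbin (fpsX M) N.*2 k) 1.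
Proof.
move=> M0 le_k; set m := (N - _)%N.
have le_mk : (m <= k)%N by rewrite /m; lia.
have le_mk' : (m <= N.*2 - k)%N by rewrite /m; lia.
have le_mN : (m <= N)%N by rewrite /m; lia.
have le_m2N : (m <= N.*2)%N by rewrite /m; lia.
have qf s : (m <= s)%N -> eqm (M * m.+1) (qfact R M s) (qfact R M m).
  by apply: qfact_eqm.
apply: (@eqm_cancel _ _ _ _ (qfact R M k * qfact R M (N.*2 - k))).
  by rewrite cfM0 !cf_qfact0 // mulr1 oner_eq0.
rewrite -mulrA [qbin _ _ _ * _]mulrA qbin_qfact // mul1r.
apply: (@eqm_trans _ _ _ (qfact R M m * qfact R M m)); first by apply: eqmM; apply: qf.
by apply/eqm_sym/eqmM; apply: qf.
Qed.

Variables (A B : nat) (c : fps R).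
Hypotheses (A_gt0 : (0 < A)%N) (B_gt0 : (0 < B)%N) (c2 : c ^+ 2 = 1).
Let M := (A + B)%N.

Definition jexp (j : int) : nat :=
  divn (absz (M%:Z * j ^+ 2 + (A%:Z - B%:Z) * j)) 2.

Lemma consecutive_prod (j : int) : exists s : nat, j * (j + 1) = s%:Z * 2.
Proof.
have ge0 : 0 <= j * (j + 1) by nia.
have : (j == (j %/ 2)%Z * 2) || (j == (j %/ 2)%Z * 2 + 1) by lia.
case/orP=> /eqP; move: (_ %/ _)%Z => k ej.
  exists (absz (k * (j + 1))); have : j * (j + 1) = k * (j + 1) * 2 by rewrite {1}ej mulrAC.
  by lia.
exists (absz (j * (k + 1))).
have : j * (j + 1) = j * (k + 1) * 2 by rewrite {2}ej; ring.
by lia.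
Qed.

Lemma jexpE j : (jexp j)%:Z * 2 = M%:Z * j ^+ 2 + (A%:Z - B%:Z) * j.
Proof.
have [s es] := consecutive_prod j; have [s' es'] := consecutive_prod (j - 1).
have e : M%:Z * j ^+ 2 + (A%:Z - B%:Z) * j = (A * s + B * s')%N%:Z * 2.
  rewrite PoszD !PoszM /M PoszD.
  have -> : (A%:Z * s%:Z + B%:Z * s'%:Z) * 2 = A%:Z * (s%:Z * 2) + B%:Z * (s'%:Z * 2) by ring.
  by rewrite -es -es'; ring.
by rewrite /jexp e; lia.
Qed.

Lemma exprNc_odd m n : odd m = odd n -> (- c) ^+ m = (- c) ^+ n.
Proof.
have e k : (- c) ^+ k = (- c) ^+ odd k.
  by rewrite -[in LHS](odd_double_half k) exprD -muln2 mulnC exprM sqrrN c2 expr1n mulr1.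
by move=> emn; rewrite e emn -e.
Qed.

Lemma prod_fpsX N : \prod_(i < N) fpsX (M * i) = fpsX (M * 'C(N, 2)) :> fps R.
Proof.
elim: N => [|N IH]; first by rewrite big_ord0 muln0 fpsX0.
by rewrite big_ord_recr /= IH -fpsXD -mulnDr binS bin1.
Qed.

Lemma jacobi_finite N :
  \prod_(i < N) ((1 - c * fpsX (M * i + A)) * (1 - c * fpsX (M * i + B))) =
  \sum_(j <- zrange N) (- c) ^+ `|j| * fpsX (jexp j)
     * qbin (fpsX M) N.*2 (absz (j + N%:Z)).
Proof.
have j0 : jexp 0 = 0%N by have := jexpE 0; rewrite expr0n; lia.
have [->|N_gt0] := posnP N.
  by rewrite big_ord0 /zrange /= big_seq1 subrr j0 fpsX0 !mul1r.
(* With this exponent the $2N$ factors $X^a - cX^{Mi}$ of the q-binomial theorem split in two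
   halves: for $i < N$, extracting $-cX^{Mi}$ (recall $c^2 = 1$) leaves the factors with $B$ in
   reverse order; the others are $X^a$ times the factors with $A$. *)
pose a := (M * N - A)%N.
have [AM N1M] : (A <= M)%N /\ (M <= M * N)%N by rewrite leq_addr leq_pmulr.
have Na : (a + A = M * N)%N by rewrite subnK // (leq_trans AM).
have := qbinomial_theorem (fpsX M) (fpsX a) (- c) N.*2.
have -> : \prod_(i < N.*2) (fpsX a + - c * fpsX M ^+ i) =
    \prod_(i < N) ((1 - c * fpsX (M * i + A)) * (1 - c * fpsX (M * i + B)))
    * ((- c) ^+ N * fpsX (M * 'C(N, 2) + a * N)) :> fps R.
  rewrite -addnn big_split_ord /=.
  have -> : \prod_(i < N) (fpsX a + - c * fpsX M ^+ i) = (- c) ^+ N * fpsX (M * 'C(N, 2))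
     * \prod_(i < N) (1 - c * fpsX (M * i + B)) :> fps R.
    have -> : (- c) ^+ N = \prod_(i < N) (- c) by rewrite prodr_const card_ord.
    rewrite -prod_fpsX -big_split /=.
    rewrite [X in _ = _ * X](reindex_inj rev_ord_inj) -big_split /=.
    apply: eq_bigr => i _; rewrite fpsXX.
    have -> : a = (M * i + (M * (N - i.+1) + B))%N.
      have := ltn_ord i; rewrite /M in Na *; nia.
    rewrite fpsXD; set u := fpsX (M * i); set w := fpsX (_ + _).
    have -> : u * w = c ^+ 2 * (u * w) by rewrite c2 mul1r.
    by ring.
  have -> : \prod_(i < N) (fpsX a + - c * fpsX M ^+ (N + i)) = fpsX (a * N)
     * \prod_(i < N) (1 - c * fpsX (M * i + A)) :> fps R.
    have -> : fpsX (a * N) = \prod_(i < N) fpsX a :> fps R.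
      by rewrite prodr_const card_ord fpsXX.
    rewrite -big_split /=.
    apply: eq_bigr => i _; rewrite fpsXX mulnDr -Na -addnA fpsXD [(A + _)%N]addnC.
    by ring.
  by rewrite big_split fpsXD /=; ring.
have zr : \sum_(j <- zrange N) (- c) ^+ `|j| * fpsX (jexp j)
     * qbin (fpsX M) N.*2 (absz (j + N%:Z)) = \sum_(k < N.*2.+1)
     (- c) ^+ `|k%:Z - N%:Z| * fpsX (jexp (k%:Z - N%:Z)) * qbin (fpsX M) N.*2 k :> fps R.
  rewrite big_map -[iota 0 _]/(index_iota 0 N.*2.+1) big_mkord; apply: eq_bigr => k _.
  by rewrite subrK.
rewrite zr => e.
apply: (@mulIf _ ((- c) ^+ N * fpsX (M * 'C(N, 2) + a * N))).
  rewrite mulf_neq0 ?fpsX_neq0 // expf_neq0 // oppr_eq0.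
  by apply: contraTneq isT => c0; move/eqP: c2; rewrite c0 expr0n eq_sym oner_eq0.
rewrite e mulr_suml; apply: eq_bigr => k _.
rewrite !fpsXX.
have -> : (- c) ^+ k = (- c) ^+ `|k%:Z - N%:Z| * (- c) ^+ N.
  by rewrite -exprD; apply: exprNc_odd; have := ltn_ord k; lia.
have ek : (M * 'C(k, 2) + a * (N.*2 - k) = jexp (k%:Z - N%:Z) + (M * 'C(N, 2) + a * N))%N.
  have h := jexpE (k%:Z - N%:Z).
  have b2 n : 'C(n, 2)%:Z * 2 = n%:Z * (n%:Z - 1).
    by rewrite bin2 -divn2; have := consecutive_prod (n%:Z - 1); rewrite subrK => -[s]; nia.
  have hk := b2 k; have hN := b2 N.
  have a_eq : a%:Z = M%:Z * N%:Z - A%:Z by rewrite -PoszM -Na PoszD addrK.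
  have k2 : (N.*2 - k)%N%:Z = N%:Z * 2 - k%:Z by have := ltn_ord k; lia.
  apply/eqP; rewrite -eqz_nat; apply/eqP; apply: (@mulIf _ (2 : int)) => //.
  rewrite !PoszD !PoszM k2 !mulrDl h a_eq.
  rewrite -[_ * _ * 2](mulrA) hk -[M%:Z * 'C(N, 2)%:Z * 2]mulrA hN /M PoszD.
  by ring.
have -> : fpsX (M * 'C(k, 2)) * qbin (fpsX M) N.*2 k * ((- c) ^+ `|k%:Z - N%:Z| * (- c) ^+ N)
   * fpsX (a * (N.*2 - k)) = (- c) ^+ `|k%:Z - N%:Z| * (- c) ^+ N * qbin (fpsX M) N.*2 k
   * fpsX (M * 'C(k, 2) + a * (N.*2 - k)) :> fps R by rewrite fpsXD; ring.
by rewrite ek fpsXD; ring.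
Qed.

(** Since $|A - B| \le M$, twice the exponent is at least $M|j|(|j|-1)$, and $(|j|-1)(|j|-2) \ge
    0$. *)
Lemma jexp_ge j : (M * `|j| <= jexp j + M)%N.
Proof.
have e := jexpE j.
have le1 : (M * `|j|)%N%:Z * (`|j|%N%:Z - 1) <= (jexp j)%:Z * 2.
  rewrite e /M PoszM PoszD; case: j {e} => d; rewrite ?NegzE ?abszN absz_nat -subr_ge0.
    rewrite (_ : _ - _ = A%:Z * d%:Z * 2); first by rewrite !mulr_ge0.
    by ring.
  rewrite (_ : _ - _ = B%:Z * d.+1%:Z * 2); first by rewrite !mulr_ge0.
  by ring.
have : 0 <= (M : int) * ((`|j|%N%:Z - 1) * (`|j|%N%:Z - 2)).
  by apply: mulr_ge0 => //; case: `|j|%N => [|[|d]] //; apply: mulr_ge0; lia.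
rewrite PoszM in le1; nia.
Qed.

(** The term of index $j$ is exact up to degree [jexp j] $+ M(N - |j| + 1)$, which is at least $MN$
    by [jexp_ge]. *)
Lemma jacobi_eqm N :
  eqm (M * N) (qfact R M N *
    \prod_(i < N) ((1 - c * fpsX (M * i + A)) * (1 - c * fpsX (M * i + B))))
  (\sum_(j <- zrange N) (- c) ^+ `|j| * fpsX (jexp j)).
Proof.
rewrite jacobi_finite mulr_sumr => n lt_n; rewrite !cf_sum.
apply: eq_big_seq => j; rewrite mem_zrange => le_j.
rewrite [qfact _ _ _ * _]mulrCA; apply: (@eqm_leq _ (jexp j + M * (N - `|j|).+1)) (lt_n).
  have := jexp_ge j; rewrite -[in (M * N)%N](subnK le_j) mulnS mulnDr; lia.
rewrite -[X in eqm _ _ X]mulr1 => m lt_m; rewrite -!mulrA; move: m lt_m.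
apply: eqmM => // m lt_m; rewrite !cf_fpsXM; case: ifP => // le_m.
have := @qbin_eqm M N (absz (j + N%:Z)); rewrite (_ : (absz (j + N%:Z))%:Z - N%:Z = j); last by lia.
by move=> h; apply: h; [rewrite addn_gt0 A_gt0|lia|rewrite ltn_subLR].
Qed.

End TripleProduct.

(** * Product expansions of the theta series *)

Section ThetaProducts.
Variable R : fieldType.

Lemma cf_signM m (f : fps R) n : cf ((-1) ^+ m * f) n = (-1) ^+ m * cf f n.
Proof.
by rewrite -(signr_odd _ m) -[in RHS](signr_odd _ m); case: odd;
  rewrite ?expr1 ?expr0 ?mulN1r ?mul1r.
Qed.

(* [g] enumerates the support of the weight [w], the j-th element contributing to
   the coefficient of index [jexp A B j + e0]. *)
Lemma theta_jacobi (A B : nat) (c : fps R) (cc e0 m : nat) (w : int -> R)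
    (s : int -> R) (g h : int -> int) :
  (0 < A)%N -> (0 < B)%N -> c ^+ 2 = 1 -> (0 < cc)%N ->
  (forall j f n, cf ((- c) ^+ `|j| * f) n = s j * cf f n) ->
  (forall j, [/\ cc%:Z * g j ^+ 2 = (jexp A B j + e0)%N%:Z,
                 w (g j) = (-1) ^+ m * s j & h (g j) = j]) ->
  (forall k, w k != 0 -> g (h k) = k) ->
  forall N, eqm ((A + B) * N) (theta cc w)
    ((-1) ^+ m * fpsX e0 * (qfact R (A + B) N *
    \prod_(i < N) ((1 - c * fpsX ((A + B) * i + A)) * (1 - c * fpsX ((A + B) * i + B))))).
Proof.
move=> A0 B0 c2 cc0 sP gP hP N n lt_n.
rewrite -mulrA cf_signM cf_fpsXM.
transitivity (\sum_(j <- zrange N) if (e0 + jexp A B j == n)%N then (-1) ^+ m * s j else 0).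
  apply: (eq_sum_bij (h := h) (g := g)); rewrite ?zrange_uniq //.
    move=> k _; case: ifP => [/eqP ek wk|]; last by rewrite eqxx.
    have [e ew eh] := gP (h k); rewrite (hP _ wk) in e ew.
    have ej : (e0 + jexp A B (h k) = n)%N by rewrite addnC; lia.
    rewrite ej eqxx -ew hP //; split=> //.
    by rewrite mem_zrange; have := jexp_ge A0 B0 (h k); nia.
  move=> j _; case: ifP => [/eqP ej wj|]; last by rewrite eqxx.
  have [e ew eh] := gP j.
  rewrite e -ew addnC ej eqxx eh; split=> //.
  by rewrite mem_zrange (@sqz_le cc) // e addnC ej.
case: leqP => [le_e|lt_e]; last first.
  rewrite mulr0 big1 // => j _; rewrite gtn_eqF //.
  by apply: leq_trans lt_e _; apply: leq_addr.
rewrite (jacobi_eqm A0 B0 c2); last by apply: leq_ltn_trans (leq_subr _ _) lt_n.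
rewrite cf_sum mulr_sumr; apply: eq_bigr => j _; rewrite sP /=.
rewrite -(eqn_add2l e0 _ (jexp _ _ _)) subnKC // [(n == _)]eq_sym.
by case: eqP; rewrite ?mulr1 ?mulr0.
Qed.

Lemma qfact_mul k d N : qfact R k (N * d) =
  \prod_(i < N) \prod_(j < d) (1 - fpsX (k * (d * i + j.+1))).
Proof.
elim: N => [|N IH]; first by rewrite mul0n /qfact !big_ord0.
rewrite mulSnr /qfact big_split_ord /= -/(qfact R k _) IH big_ord_recr /=; congr (_ * _).
by apply: eq_bigr => j _; rewrite [(d * _)%N]mulnC addnS.
Qed.

Lemma phi_qfact Q N : qfact R (Q + Q) N *
    \prod_(i < N) ((1 - fpsX ((Q + Q) * i + Q)) * (1 - fpsX ((Q + Q) * i + Q)))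
  * qfact R (Q + Q) N = qfact R Q (N * 2) ^+ 2.
Proof.
rewrite qfact_mul expr2 /qfact mulrAC -!big_split /=; apply: eq_bigr => i _.
rewrite !big_ord_recl !big_ord0 !mulr1 /= /bump /=.
rewrite (_ : Q * (2 * i + 1) = (Q + Q) * i + Q)%N; last by lia.
rewrite (_ : Q * (2 * i + (1 + 0).+1) = (Q + Q) * i.+1)%N; last by lia.
by ring.
Qed.

(** Uses $(1-u)(1+u) = 1-u^2$. The squares produce the factors with exponent $Mi + 2Q$ for $i < 2N$,
    where only $i < N$ are wanted, hence a congruence and not an equality. *)
Lemma psi_qfact Q N : eqm ((Q + 3 * Q) * N) (qfact R (Q + 3 * Q) N *
    \prod_(i < N) ((1 + fpsX ((Q + 3 * Q) * i + Q)) * (1 + fpsX ((Q + 3 * Q) * i + 3 * Q)))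
  * qfact R Q (N * 4)) (qfact R (Q + Q) (N * 2) ^+ 2).
Proof.
pose M := (Q + 3 * Q)%N.
have e4 : qfact R Q (N * 4) = \prod_(i < N) ((1 - fpsX (M * i + Q)) *
   (1 - fpsX (M * i + (Q + Q))) * (1 - fpsX (M * i + 3 * Q)) * (1 - fpsX (M * i.+1))).
  rewrite qfact_mul; apply: eq_bigr => i _.
  rewrite !big_ord_recl !big_ord0 !mulr1 /= /bump /= !mulrA.
  by congr ((1 - fpsX _) * (1 - fpsX _) * (1 - fpsX _) * (1 - fpsX _)); rewrite /M; lia.
have e2 : qfact R (Q + Q) (N * 2) = \prod_(i < N) ((1 - fpsX (M * i + (Q + Q))) *
   (1 - fpsX (M * i.+1))).
  rewrite qfact_mul; apply: eq_bigr => i _.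
  rewrite !big_ord_recl !big_ord0 !mulr1 /= /bump /=.
  by congr ((1 - fpsX _) * (1 - fpsX _)); rewrite /M; lia.
pose tail k := \prod_(i < k) (1 - fpsX (M * i + (Q + Q))) : fps R.
have tE : tail (N + N)%N = \prod_(i < N) ((1 - fpsX (M * i + Q + (M * i + Q)))
    * (1 - fpsX (M * i + 3 * Q + (M * i + 3 * Q)))).
  rewrite /tail; elim: (N) => [|k IH]; first by rewrite !big_ord0.
  rewrite addSn addnS !big_ord_recr /= IH -mulrA; congr (_ * _).
  by congr ((1 - fpsX _) * (1 - fpsX _)); rewrite /M; lia.
have te : eqm (M * N) (tail (N + N)%N) (tail N).
  rewrite /tail big_split_ord /= -[X in eqm _ _ X]mulr1; apply: eqmM => //.
  have e1 : \prod_(i < N) (1 : fps R) = 1 by rewrite big1.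
  rewrite -[X in eqm _ _ X]e1.
  by apply: eqm_prod => i _; apply: eqm1B'; rewrite mulnDr; lia.
have -> : qfact R (Q + Q) (N * 2) ^+ 2 = tail N *
    (\prod_(i < N) ((1 - fpsX (M * i + (Q + Q))) * (1 - fpsX (M * i.+1)) ^+ 2)).
  by rewrite e2 expr2 /tail -!big_split /=; apply: eq_bigr => i _; ring.
rewrite (_ : _ * _ * _ = tail (N + N)%N *
    (\prod_(i < N) ((1 - fpsX (M * i + (Q + Q))) * (1 - fpsX (M * i.+1)) ^+ 2))).
  exact: eqmM.
rewrite tE e4 /qfact -!big_split /=; apply: eq_bigr => i _.
rewrite (fpsXD _ (M * i + Q)) (fpsXD _ (M * i + 3 * Q)) -/M.
move: (fpsX (M * i + Q)) (fpsX (M * i + 3 * Q)) (fpsX (M * i + (Q + Q))) (fpsX (M * i.+1)).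
by move=> u1 u3 u2 u4; ring.
Qed.

(* [Q] stands for 1352 = 13 * 104, kept symbolic to avoid unary arithmetic on numerals. *)
Lemma phi_eta Q : Q = 1352%N -> theta_class 2 (evenchi R) 0 * eta R (Q + Q) = eta R Q ^+ 2.
Proof.
move=> eQ; have Q0 : (0 < Q)%N by rewrite eQ.
apply: eqm_eq => N; have le_N : (N <= (Q + Q) * N)%N by rewrite leq_pmull // addn_gt0 Q0.
apply: (eqm_leq le_N).
have h : eqm ((Q + Q) * N) (theta_class 2 (evenchi R) 0) (qfact R (Q + Q) N *
    \prod_(i < N) ((1 - fpsX ((Q + Q) * i + Q)) * (1 - fpsX ((Q + Q) * i + Q)))).
  rewrite -[X in eqm _ _ X]mul1r -[X in X * _](mul1r 1).
  under eq_bigr => i _ do rewrite -[fpsX (_ + _)]mul1r.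
  apply: (@theta_jacobi Q Q 1 2 0 0 _ (fun j => (-1) ^+ `|j|)
    (fun j => 26 * j) (fun k => (k %/ 26)%Z)); rewrite ?expr1n //.
  - by move=> j f n; rewrite cf_signM.
  - move=> j; split.
    + have := jexpE Q0 Q0 j; move: (jexp Q Q j) => e; rewrite addn0 subrr mul0r addr0 exprMn eQ; lia.
    + rewrite mul1r /at13 (_ : cong13 0 _ = true); last by rewrite /cong13; lia.
      rewrite /evenchi -signr_odd.
      have [e|o] : ((26 * j) %% 4 = 0)%Z /\ odd `|j| = false \/ ((26 * j) %% 4 = 2)%Z /\ odd `|j|
        by lia.
        by rewrite e.1 e.2.
      by rewrite o.1 o.2.
    + by lia.
  - move=> k; rewrite /at13; case: ifP => [ck /evenchi_supp ek|]; last by rewrite eqxx.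
    by move: ck; rewrite /cong13; lia.
apply: (@eqm_trans _ _ _ (qfact R Q (N * 2) ^+ 2)); last first.
  by apply/eqm_sym/eqmX/eta_eqm => //; nia.
rewrite -phi_qfact; apply: eqmM => //; apply: eta_eqm; first by rewrite addn_gt0 Q0.
by rewrite leq_mul2l leqnSn orbT.
Qed.

(** Gauss's product for the sum over triangular numbers $T$: here $(13(2n+1))^2 = 1352\,T_n +
    169$. *)
Lemma psi_eta Q : Q = 1352%N -> Psi R * eta R Q = fpsX 169 * eta R (Q + Q) ^+ 2.
Proof.
move=> eQ; have Q0 : (0 < Q)%N by rewrite eQ.
have Q30 : (0 < 3 * Q)%N by rewrite muln_gt0.
apply: eqm_eq => N; have le_N : (N <= (Q + 3 * Q) * N)%N by rewrite leq_pmull // addn_gt0 Q0.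
apply: (eqm_leq le_N).
have h : eqm ((Q + 3 * Q) * N) (Psi R) (fpsX 169 * (qfact R (Q + 3 * Q) N *
    \prod_(i < N) ((1 + fpsX ((Q + 3 * Q) * i + Q)) * (1 + fpsX ((Q + 3 * Q) * i + 3 * Q))))).
  rewrite -[fpsX 169]mul1r.
  have -> : \prod_(i < N) ((1 + fpsX ((Q + 3 * Q) * i + Q)) * (1 + fpsX ((Q + 3 * Q) * i + 3 * Q))) =
      \prod_(i < N) ((1 - -1 * fpsX ((Q + 3 * Q) * i + Q)) * (1 - -1 * fpsX ((Q + 3 * Q) * i + 3 * Q))) :> fps R.
    by apply: eq_bigr => i _; rewrite !mulN1r !opprK.
  (* The positive odd numbers are the $|4j - 1|$, each for one integer $j$; [h] recovers $j$ from $k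
     = 13|4j-1|$, whose quotient by 13 is 3 mod 4 exactly when $j > 0$. *)
  pose h (k : int) := if (((k %/ 13)%Z %% 4)%Z == 3)
      then (((k %/ 13)%Z + 1) %/ 4)%Z else ((1 - (k %/ 13)%Z) %/ 4)%Z.
  refine (@theta_jacobi Q (3 * Q) (-1) 1 169 0 _ (fun=> 1)
    (fun j => `|13 * (4 * j - 1)|) h _ _ _ _ _ _ _ N); rewrite ?sqrrN ?expr1n // /h.
  - by move=> j f n; rewrite opprK expr1n !mul1r.
  - move=> j; split.
    + have := jexpE Q0 Q30 j; move: (jexp Q (3 * Q) j) => e.
      rewrite real_normK ?num_real // mul1r PoszD eQ expr2 [(_ * _) ^+ 2]expr2; lia.
    + rewrite expr0 mul1r ifT; last by lia.
      rewrite /at13 ifT; last by rewrite /cong13; lia.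
      by rewrite /odd1 ifT //; lia.
    + by case: ifP; lia.
  - move=> k; case: ifP => [k0|]; last by rewrite eqxx.
    rewrite /at13; case: ifP => [ck /odd1_supp ek|]; last by rewrite eqxx.
    by move: ck; rewrite /cong13; case: ifP; lia.
apply: (@eqm_trans _ _ _ (fpsX 169 * qfact R (Q + Q) (N * 2) ^+ 2)); last first.
  by apply: eqmM => //; apply/eqm_sym/eqmX/eta_eqm; nia.
apply: (@eqm_trans _ _ _ (fpsX 169 * (qfact R (Q + 3 * Q) N *
    \prod_(i < N) ((1 + fpsX ((Q + 3 * Q) * i + Q)) * (1 + fpsX ((Q + 3 * Q) * i + 3 * Q)))) *
    qfact R Q (N * 4))).
  by apply: eqmM => //; apply: eta_eqm => //; nia.
by rewrite -mulrA; apply: eqmM => //; apply: psi_qfact.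
Qed.

(** The support consists of the $k = 26j + 2a - 13$, with $j = 0$ giving the isolated power. The
    number 104 stays symbolic for the same reason as [Q] above. *)
Lemma theta1_jacobi c a N : c = 104%N -> (0 < a < 13)%N -> eqm (c * 13 * N) (theta1 R a%:Z)
  ((-1) ^+ a.+1 * fpsX (absz (2 * a%:Z - 13)%R ^ 2) * (qfact R (c * 13) N *
    \prod_(i < N) ((1 - fpsX (c * 13 * i + c * a)) * (1 - fpsX (c * 13 * i + c * (13 - a)))))).
Proof.
move=> ec /andP[a0 a13].
have A0 : (0 < c * a)%N by rewrite muln_gt0 ec.
have B0 : (0 < c * (13 - a))%N by rewrite muln_gt0 ec subn_gt0.
have eM : (c * 13 = c * a + c * (13 - a))%N by rewrite -mulnDr subnKC // ltnW.
rewrite eM.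
under eq_bigr => i _ do rewrite -[fpsX (_ + c * a)]mul1r -[fpsX (_ + c * (13 - a))]mul1r.
apply: (@theta_jacobi _ _ 1 1 _ a.+1 _ (fun j => (-1) ^+ `|j|)
    (fun j => 26 * j + (2 * a%:Z - 13)) (fun k => ((k - (2 * a%:Z - 13)) %/ 26)%Z));
  rewrite ?expr1n //.
- by move=> j f n; rewrite cf_signM.
- move=> j; split.
  + have := jexpE A0 B0 j; move: (jexp _ _ j) => e.
    rewrite mul1r -eM PoszD -abszX gez0_abs ?sqr_ge0 // !PoszM (_ : (13 - a)%N%:Z = 13 - a%:Z);
      last by lia.
    rewrite ec => h; apply: (@mulIf _ (2 : int)) => //; rewrite [RHS]mulrDl h; ring.
  + rewrite /at13 (_ : cong13 _ _ = true); last by rewrite /cong13; lia.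
    rewrite /oddchi -exprD -signr_odd oddD.
    have [e|o] : ((26 * j + (2 * a%:Z - 13)) %% 4 = 1)%Z /\ odd a.+1 (+) odd `|j| = false \/
       ((26 * j + (2 * a%:Z - 13)) %% 4 = 3)%Z /\ odd a.+1 (+) odd `|j| by lia.
      by rewrite e.1 e.2.
    by rewrite o.1 o.2.
  + by lia.
- move=> k; rewrite /at13; case: ifP => [ck /oddchi_supp ek|]; last by rewrite eqxx.
  by move: ck; rewrite /cong13; lia.
Qed.

(** The six classes cover every nonzero residue mod 13 up to sign, so together they give each factor
    of [eta c] with index prime to 13. The exponent is $286 = 121+81+49+25+9+1$, and three of the
    six signs are negative. *)
Lemma theta1_prod_eq c : c = 104%N ->
  theta1 R 1 * theta1 R 2 * theta1 R 3 * theta1 R 4 * theta1 R 5 * theta1 R 6 =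
  - (fpsX 286 * (eta R c * eta R (c * 13) ^+ 5)).
Proof.
move=> ec; have c0 : (0 < c)%N by rewrite ec.
have c130 : (0 < c * 13)%N by rewrite muln_gt0 c0.
apply: eqm_eq => N; have le_N : (N <= c * 13 * N)%N by rewrite leq_pmull.
apply: (eqm_leq le_N).
have h a a13 := @theta1_jacobi c a N ec a13.
apply: (eqm_trans (eqmM (eqmM (eqmM (eqmM (eqmM (h 1%N isT) (h 2%N isT)) (h 3%N isT))
  (h 4%N isT)) (h 5%N isT)) (h 6%N isT))).
rewrite -[X in eqm _ _ X]mulN1r.
apply: (@eqm_trans _ _ _ (-1 * (fpsX 286 * (qfact R c (N * 13) * qfact R (c * 13) N ^+ 5)))); last first.
  apply: eqmM => //; apply: eqmM => //; apply: eqmM; last apply: eqmX; apply: eqm_sym.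
    by apply: eta_eqm; rewrite // -mulnA leq_mul2l; apply/orP; right; lia.
  by apply: eta_eqm; rewrite // leq_mul2l leqnSn orbT.
have -> : qfact R c (N * 13) = qfact R (c * 13) N * \prod_(i < N)
   ((1 - fpsX (c * 13 * i + c * 1)) * (1 - fpsX (c * 13 * i + c * (13 - 1)))
   * ((1 - fpsX (c * 13 * i + c * 2)) * (1 - fpsX (c * 13 * i + c * (13 - 2))))
   * ((1 - fpsX (c * 13 * i + c * 3)) * (1 - fpsX (c * 13 * i + c * (13 - 3))))
   * ((1 - fpsX (c * 13 * i + c * 4)) * (1 - fpsX (c * 13 * i + c * (13 - 4))))
   * ((1 - fpsX (c * 13 * i + c * 5)) * (1 - fpsX (c * 13 * i + c * (13 - 5))))
   * ((1 - fpsX (c * 13 * i + c * 6)) * (1 - fpsX (c * 13 * i + c * (13 - 6))))).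
  rewrite qfact_mul [qfact R (c * 13) N]/qfact -big_split /=; apply: eq_bigr => i _.
  rewrite !big_ord_recl big_ord0 mulr1 /= /bump /=.
  have e k : (c * (13 * i + k) = c * 13 * i + c * k)%N by rewrite mulnDr mulnA.
  have e13 : (c * 13 * i.+1 = c * 13 * i + c * 13)%N by rewrite mulnS addnC.
  rewrite e13 !e.
  pose u k : fps R := 1 - fpsX (c * 13 * i + c * k).
  rewrite -![1 - fpsX _]/(u _) /=.
  move: (u 1%N) (u 2) (u 3) (u 4) (u 5) (u 6) (u 7) (u 8) (u 9) (u 10) (u 11) (u 12) (u 13).
  by move=> *; ring.
rewrite !big_split /=.
have -> : fpsX 286 = fpsX 121 * fpsX 81 * fpsX 49 * fpsX 25 * fpsX 9 * fpsX 1 :> fps R.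
  by rewrite -!fpsXD.
have e11 : (absz (2 * Posz 1 - 13)%R ^ 2)%N = 121%N by [].
have e9 : (absz (2 * Posz 2 - 13)%R ^ 2)%N = 81%N by [].
have e7 : (absz (2 * Posz 3 - 13)%R ^ 2)%N = 49%N by [].
have e5 : (absz (2 * Posz 4 - 13)%R ^ 2)%N = 25%N by [].
have e3 : (absz (2 * Posz 5 - 13)%R ^ 2)%N = 9%N by [].
have e1 : (absz (2 * Posz 6 - 13)%R ^ 2)%N = 1%N by [].
rewrite e11 e9 e7 e5 e3 e1.
match goal with |- eqm _ ?f ?g => have -> : f = g by ring end.
by [].
Qed.

End ThetaProducts.

(** * Identities on the modular curve X_1(13) *)

Section ModularCurve.
Variables (K : comNzRingType) (x y : K).
Hypothesis curve : y * (y + 1) = x * (x + 1) * (1 - x * y).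
(** For the Tate normal form $Y^2 + (1-c)XY - bY = X^3 - bX^2$ with $(0,0)$ of order 13, these are
    the usual parameters: $r = b/c$ and $v/(y+1) = c^2/(b-c)$. *)
Let r := 1 - x * y.
Let v := y + 1 - x * y.

(* The certificates below give the cofactors [c] of the curve equation and [d] of the
   characteristic. *)
Let mod_curve c d n (A B : K) : n = 0 ->
  A - B = c * (y * (y + 1) - x * (x + 1) * (1 - x * y)) + n * d -> A = B.
Proof.
by move=> ->; rewrite curve subrr mul0r mulr0 addr0 => /eqP; rewrite subr_eq0 => /eqP.
Qed.

(** Divided by the monomials, the right-hand side is $\rho + 1 + \rho^{-1}$ with $\rho = yv/(x^2r)$;
    the left-hand side will be the value of $t^{-1}$ found from the duplication formulas. *)
Lemma X13_char2_h : 2 = 0 :> K ->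
  x ^+ 6 * r ^+ 6 * (r * (y + 1) ^+ 3 + (y + 1 + v * x * y) ^+ 3) =
  ((x ^+ 2 * r) ^+ 2 + y * v * (x ^+ 2 * r) + (y * v) ^+ 2) * y ^+ 9 * v * (y + 1) ^+ 3.
Proof.
move=> two0; apply: (mod_curve (c :=
    (x ^+ 7) * y ^+ 3 + (x ^+ 6 + x ^+ 7 + x ^+ 8) * y ^+ 4 + (x ^+ 5 + x ^+ 6 + x ^+
    8 + x ^+ 9) * y ^+ 5 + (x ^+ 4 + x ^+ 5 + x ^+ 6 + x ^+ 7) * y ^+ 6 + (x ^+ 3 + x
    ^+ 4 + x ^+ 6 + x ^+ 8 + x ^+ 9) * y ^+ 7 + (x ^+ 2 + x ^+ 3 + x ^+ 4 + x ^+ 5 + x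
    ^+ 6 + x ^+ 7 + x ^+ 8 + x ^+ 10 + x ^+ 11 + x ^+ 12) * y ^+ 8 + (x + x ^+ 2 + x
    ^+ 3 + x ^+ 6 + x ^+ 7 + x ^+ 9 + x ^+ 10 + x ^+ 12 + x ^+ 13) * y ^+ 9 + (1 + x
    ^+ 2 + x ^+ 5 + x ^+ 6 + x ^+ 7 + x ^+ 9 + x ^+ 10 + x ^+ 11) * y ^+ 10 + (1 + x +
    x ^+ 3 + x ^+ 5 + x ^+ 9 + x ^+ 10 + x ^+ 12 + x ^+ 13 + x ^+ 15) * y ^+ 11 + (x
    ^+ 6 + x ^+ 11 + x ^+ 12) * y ^+ 12 + (x + x ^+ 4 + x ^+ 6 + x ^+ 9) * y ^+ 13 +
    (1 + x ^+ 3 + x ^+ 5 + x ^+ 6) * y ^+ 14 + (1 + x + x ^+ 2 + x ^+ 3) * y ^+ 15) (d :=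
    (x ^+ 6) + (3 * x ^+ 6 - 5 * x ^+ 7) * y + (3 * x ^+ 6 - 15 * x ^+ 7 + 9 * x ^+ 8)
    * y ^+ 2 + (x ^+ 6 - 15 * x ^+ 7 + 29 * x ^+ 8 - 7 * x ^+ 9) * y ^+ 3 + (- 5 * x
    ^+ 7 + 31 * x ^+ 8 - 28 * x ^+ 9 + 10 * x ^+ 10) * y ^+ 4 + (10 * x ^+ 8 - 35 * x
    ^+ 9 + 33 * x ^+ 10 - 27 * x ^+ 11) * y ^+ 5 + (- x ^+ 8 - 14 * x ^+ 9 + 37 * x ^+
    10 - 61 * x ^+ 11 + 35 * x ^+ 12) * y ^+ 6 + (- x ^+ 6 - x ^+ 7 - x ^+ 8 - x ^+ 9
    + 15 * x ^+ 10 - 46 * x ^+ 11 + 66 * x ^+ 12 - 11 * x ^+ 13) * y ^+ 7 + (- x ^+ 6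
    - 14 * x ^+ 11 + 38 * x ^+ 12 - 20 * x ^+ 13 - 22 * x ^+ 14) * y ^+ 8 + (- x ^+ 4
    - x ^+ 5 - 2 * x ^+ 6 - x ^+ 7 - x ^+ 8 - x ^+ 9 - x ^+ 10 + 7 * x ^+ 12 - 8 * x
    ^+ 13 - 24 * x ^+ 14 + 30 * x ^+ 15) * y ^+ 9 + (- x ^+ 2 - x ^+ 3 - 3 * x ^+ 4 -
    x ^+ 6 - x ^+ 9 - x ^+ 10 - x ^+ 12 - x ^+ 13 - 11 * x ^+ 14 + 26 * x ^+ 15 - 17 *
    x ^+ 16) * y ^+ 10 + (- 1 - 3 * x ^+ 2 + x ^+ 3 - 3 * x ^+ 4 + 5 * x ^+ 5 - 2 * x
    ^+ 6 - x ^+ 7 - x ^+ 8 - 2 * x ^+ 9 - x ^+ 10 - x ^+ 12 - x ^+ 13 - x ^+ 14 + 8 *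
    x ^+ 15 - 10 * x ^+ 16 + 5 * x ^+ 17) * y ^+ 11 + (- 4 + x - 6 * x ^+ 2 + 5 * x ^+
    3 - 4 * x ^+ 4 + 6 * x ^+ 5 - 6 * x ^+ 6 - x ^+ 9 - x ^+ 10 - x ^+ 11 - x ^+ 12 -
    x ^+ 15 - 2 * x ^+ 16 + x ^+ 17 - x ^+ 18) * y ^+ 12 + (- 8 + 7 * x - 6 * x ^+ 2 +
    11 * x ^+ 3 - 6 * x ^+ 4 + 5 * x ^+ 5 - 6 * x ^+ 6 + 2 * x ^+ 7 - x ^+ 9 - x ^+ 12
    - x ^+ 13 - x ^+ 14 - x ^+ 15) * y ^+ 13 + (- 10 + 15 * x - 8 * x ^+ 2 + 9 * x ^+
    3 - 8 * x ^+ 4 + 3 * x ^+ 5 - 4 * x ^+ 6 + 2 * x ^+ 7 - x ^+ 9 - x ^+ 11 - x ^+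
    12) * y ^+ 14 + (- 8 + 15 * x - 9 * x ^+ 2 + 5 * x ^+ 3 - 4 * x ^+ 4 + x ^+ 5 - 2
    * x ^+ 6 - x ^+ 8 - x ^+ 9) * y ^+ 15 + (- 4 + 7 * x - 7 * x ^+ 2 - 2 * x ^+ 4 - x
    ^+ 5 - x ^+ 6) * y ^+ 16 + (- 1 + x - 2 * x ^+ 2) * y ^+ 17) two0).
by rewrite /r /v; ring.
Qed.

(** A square root of the relation wanted in [theta13_char2]: for $h = \rho + 1 + \rho^{-1}$ the
    product $(h^3+1)^2(h+1)$ is, up to powers of $\rho$, the square of
    $(\rho+1)^3(\rho^4+\rho^3+\rho^2+\rho+1)$. *)
Lemma X13_char2_b : 2 = 0 :> K ->
  r ^+ 4 * x ^+ 7 * v ^+ 2 * (y + 1 + v * x * y) ^+ 3 =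
  (y * v + x ^+ 2 * r) ^+ 3 * ((y * v) ^+ 4 + (y * v) ^+ 3 * (x ^+ 2 * r)
    + (y * v) ^+ 2 * (x ^+ 2 * r) ^+ 2 + y * v * (x ^+ 2 * r) ^+ 3 + (x ^+ 2 * r) ^+ 4)
  * (y + 1) ^+ 2.
Proof.
move=> two0; apply: (mod_curve (c :=
    (x ^+ 6 + x ^+ 7 + x ^+ 8 + x ^+ 9 + x ^+ 10 + x ^+ 11 + x ^+ 12) + (x ^+ 5 + x ^+
    6 + x ^+ 8 + x ^+ 10) * y + (x ^+ 4 + x ^+ 5 + x ^+ 6 + x ^+ 8 + x ^+ 9 + x ^+ 10
    + x ^+ 11 + x ^+ 13 + x ^+ 14) * y ^+ 2 + (x ^+ 3 + x ^+ 4 + x ^+ 9 + x ^+ 10 + x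
    ^+ 11) * y ^+ 3 + (x ^+ 2 + x ^+ 3 + x ^+ 4 + x ^+ 7 + x ^+ 11 + x ^+ 15 + x ^+
    16) * y ^+ 4 + (x + x ^+ 2 + x ^+ 3 + x ^+ 4 + x ^+ 5 + x ^+ 7 + x ^+ 9 + x ^+ 11
    + x ^+ 12 + x ^+ 14) * y ^+ 5 + (1 + x + x ^+ 3 + x ^+ 4 + x ^+ 5 + x ^+ 6 + x ^+
    7 + x ^+ 8 + x ^+ 12 + x ^+ 13 + x ^+ 14 + x ^+ 15 + x ^+ 17 + x ^+ 18) * y ^+ 6 +
    (x ^+ 4 + x ^+ 5 + x ^+ 6 + x ^+ 9 + x ^+ 12 + x ^+ 13 + x ^+ 14 + x ^+ 15) * y ^+
    7 + (x ^+ 2 + x ^+ 4 + x ^+ 5 + x ^+ 6 + x ^+ 9 + x ^+ 11 + x ^+ 14 + x ^+ 16 + x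
    ^+ 17 + x ^+ 18) * y ^+ 8 + (x ^+ 4 + x ^+ 5 + x ^+ 6 + x ^+ 8 + x ^+ 9 + x ^+ 11
    + x ^+ 14 + x ^+ 15) * y ^+ 9 + (x ^+ 2 + x ^+ 4 + x ^+ 5 + x ^+ 9 + x ^+ 10 + x
    ^+ 11 + x ^+ 13 + x ^+ 14) * y ^+ 10 + (x ^+ 3 + x ^+ 5 + x ^+ 6 + x ^+ 10 + x ^+
    11 + x ^+ 12 + x ^+ 13 + x ^+ 16) * y ^+ 11 + (x ^+ 3 + x ^+ 5 + x ^+ 6 + x ^+ 8 +
    x ^+ 10 + x ^+ 11 + x ^+ 12 + x ^+ 13) * y ^+ 12 + (x + x ^+ 2 + x ^+ 3 + x ^+ 5 +
    x ^+ 7 + x ^+ 10) * y ^+ 13 + (1 + x + x ^+ 2 + x ^+ 3 + x ^+ 4 + x ^+ 5 + x ^+ 6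
    + x ^+ 7) * y ^+ 14) (d :=
    (x ^+ 7 + x ^+ 8 + x ^+ 9 + x ^+ 10 + x ^+ 11 + x ^+ 12 + x ^+ 13) + (3 * x ^+ 7 -
    2 * x ^+ 8 - x ^+ 9 - x ^+ 10 - x ^+ 11 - 3 * x ^+ 12 - x ^+ 13 - 2 * x ^+ 14 + 3
    * x ^+ 15) * y + (5 * x ^+ 7 - 8 * x ^+ 8 - 2 * x ^+ 9 - 4 * x ^+ 10 - 6 * x ^+ 12
    + 14 * x ^+ 13 + 8 * x ^+ 15 - 10 * x ^+ 16) * y ^+ 2 + (- x ^+ 6 + 4 * x ^+ 7 -
    17 * x ^+ 8 - 9 * x ^+ 9 - 5 * x ^+ 10 + 24 * x ^+ 11 - 6 * x ^+ 12 + 39 * x ^+ 13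
    - 43 * x ^+ 14 + 3 * x ^+ 15 - 22 * x ^+ 16 + 17 * x ^+ 17) * y ^+ 3 + (- 5 * x ^+
    6 + 2 * x ^+ 7 - 29 * x ^+ 8 + 11 * x ^+ 9 + 17 * x ^+ 10 + 82 * x ^+ 11 - 76 * x
    ^+ 12 + 37 * x ^+ 13 - 115 * x ^+ 14 + 70 * x ^+ 15 - 10 * x ^+ 16 + 36 * x ^+ 17
    - 17 * x ^+ 18) * y ^+ 4 + (- 4 * x ^+ 4 - 24 * x ^+ 6 + 28 * x ^+ 7 - 43 * x ^+ 8
    + 111 * x ^+ 9 - 40 * x ^+ 10 + 106 * x ^+ 11 - 268 * x ^+ 12 + 135 * x ^+ 13 -
    102 * x ^+ 14 + 180 * x ^+ 15 - 70 * x ^+ 16 + 17 * x ^+ 17 - 36 * x ^+ 18 + 10 *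
    x ^+ 19) * y ^+ 5 + (- 2 * x ^+ 2 - x ^+ 3 - 26 * x ^+ 4 + 24 * x ^+ 5 - 60 * x ^+
    6 + 151 * x ^+ 7 - 124 * x ^+ 8 + 224 * x ^+ 9 - 310 * x ^+ 10 + 202 * x ^+ 11 -
    381 * x ^+ 12 + 417 * x ^+ 13 - 153 * x ^+ 14 + 150 * x ^+ 15 - 170 * x ^+ 16 + 42
    * x ^+ 17 - 17 * x ^+ 18 + 22 * x ^+ 19 - 3 * x ^+ 20) * y ^+ 6 + (- 1 - x - 17 *
    x ^+ 2 + 12 * x ^+ 3 - 75 * x ^+ 4 + 153 * x ^+ 5 - 154 * x ^+ 6 + 339 * x ^+ 7 -
    429 * x ^+ 8 + 345 * x ^+ 9 - 551 * x ^+ 10 + 540 * x ^+ 11 - 403 * x ^+ 12 + 524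
    * x ^+ 13 - 361 * x ^+ 14 + 113 * x ^+ 15 - 130 * x ^+ 16 + 95 * x ^+ 17 - 15 * x
    ^+ 18 + 10 * x ^+ 19 - 8 * x ^+ 20) * y ^+ 7 + (- 5 + 3 * x - 56 * x ^+ 2 + 100 *
    x ^+ 3 - 165 * x ^+ 4 + 409 * x ^+ 5 - 470 * x ^+ 6 + 522 * x ^+ 7 - 809 * x ^+ 8
    + 691 * x ^+ 9 - 582 * x ^+ 10 + 746 * x ^+ 11 - 553 * x ^+ 12 + 375 * x ^+ 13 -
    361 * x ^+ 14 + 165 * x ^+ 15 - 55 * x ^+ 16 + 65 * x ^+ 17 - 30 * x ^+ 18 + 3 * x
    ^+ 19 - 3 * x ^+ 20 + x ^+ 21) * y ^+ 8 + (- 18 + 28 * x - 123 * x ^+ 2 + 308 * x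
    ^+ 3 - 388 * x ^+ 4 + 664 * x ^+ 5 - 973 * x ^+ 6 + 855 * x ^+ 7 - 939 * x ^+ 8 +
    1035 * x ^+ 9 - 687 * x ^+ 10 + 581 * x ^+ 11 - 577 * x ^+ 12 + 304 * x ^+ 13 -
    155 * x ^+ 14 + 102 * x ^+ 15 - 26 * x ^+ 16 + 15 * x ^+ 17 - 19 * x ^+ 18 + 3 * x
    ^+ 19 - x ^+ 20) * y ^+ 9 + (- 42 + 98 * x - 214 * x ^+ 2 + 550 * x ^+ 3 - 776 * x
    ^+ 4 + 887 * x ^+ 5 - 1247 * x ^+ 6 + 1260 * x ^+ 7 - 953 * x ^+ 8 + 936 * x ^+ 9
    - 764 * x ^+ 10 + 415 * x ^+ 11 - 333 * x ^+ 12 + 242 * x ^+ 13 - 67 * x ^+ 14 - 2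
    * x ^+ 15 + 13 * x ^+ 16 - 11 * x ^+ 17 - 3 * x ^+ 18 + 2 * x ^+ 19) * y ^+ 10 +
    (- 63 + 196 * x - 333 * x ^+ 2 + 665 * x ^+ 3 - 1063 * x ^+ 4 + 1101 * x ^+ 5 -
    1143 * x ^+ 6 + 1244 * x ^+ 7 - 943 * x ^+ 8 + 623 * x ^+ 9 - 521 * x ^+ 10 + 315
    * x ^+ 11 - 140 * x ^+ 12 + 99 * x ^+ 13 - 46 * x ^+ 14 - 10 * x ^+ 15 + 21 * x ^+
    16 - 15 * x ^+ 17 + 5 * x ^+ 18) * y ^+ 11 + (- 63 + 245 * x - 424 * x ^+ 2 + 626
    * x ^+ 3 - 961 * x ^+ 4 + 1076 * x ^+ 5 - 899 * x ^+ 6 + 804 * x ^+ 7 - 674 * x ^+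
    8 + 390 * x ^+ 9 - 219 * x ^+ 10 + 147 * x ^+ 11 - 64 * x ^+ 12 + 19 * x ^+ 13 -
    12 * x ^+ 14 + x ^+ 15 + 4 * x ^+ 16 - 5 * x ^+ 17 + 2 * x ^+ 18 - x ^+ 19) * y ^+
    12 + (- 42 + 196 * x - 383 * x ^+ 2 + 490 * x ^+ 3 - 606 * x ^+ 4 + 698 * x ^+ 5 -
    584 * x ^+ 6 + 391 * x ^+ 7 - 286 * x ^+ 8 + 181 * x ^+ 9 - 77 * x ^+ 10 + 30 * x
    ^+ 11 - 17 * x ^+ 12 + 2 * x ^+ 13 - x ^+ 14 - x ^+ 15 - x ^+ 16) * y ^+ 13 + (-
    18 + 98 * x - 222 * x ^+ 2 + 290 * x ^+ 3 - 289 * x ^+ 4 + 282 * x ^+ 5 - 244 * x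
    ^+ 6 + 150 * x ^+ 7 - 73 * x ^+ 8 + 39 * x ^+ 9 - 19 * x ^+ 10 + 3 * x ^+ 11 - x
    ^+ 12 - x ^+ 13) * y ^+ 14 + (- 5 + 27 * x - 75 * x ^+ 2 + 105 * x ^+ 3 - 101 * x
    ^+ 4 + 70 * x ^+ 5 - 52 * x ^+ 6 + 29 * x ^+ 7 - 13 * x ^+ 8 + x ^+ 9 - x ^+ 10) *
    y ^+ 15 + (- 1 + 3 * x - 11 * x ^+ 2 + 17 * x ^+ 3 - 18 * x ^+ 4 + 10 * x ^+ 5 - 4
    * x ^+ 6) * y ^+ 16) two0).
by rewrite /r /v; ring.
Qed.

Definition X13_cube_root : K :=
  (- x + x ^+ 2 + x ^+ 3 - x ^+ 4 - x ^+ 5 + x ^+ 6)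
  + (- x - x ^+ 2 + x ^+ 4 + x ^+ 5 + x ^+ 6 - x ^+ 7) * y.

(** With $\rho = yv/(x^2r)$ the first factor is, up to a monomial, $-(\rho - \rho^{-1} + 1)$, that
    is $-(t^{-1} + 1)$. *)
Lemma X13_char3_cube : 3 = 0 :> K ->
  ((x ^+ 2 * r) ^+ 2 - y * v * (x ^+ 2 * r) - (y * v) ^+ 2) * r * v ^+ 2 * x * (y + 1) =
  X13_cube_root ^+ 3.
Proof.
move=> three0; apply: (mod_curve (c :=
    (- x ^+ 2 + x ^+ 3 + x ^+ 4 + x ^+ 8 - x ^+ 9 + x ^+ 10 + x ^+ 11 - x ^+ 12 + x ^+
    13 + x ^+ 14 - x ^+ 15 + x ^+ 16) + (- x + x ^+ 5 + x ^+ 7 + x ^+ 8 + x ^+ 9 - x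
    ^+ 11 + x ^+ 12 - x ^+ 14 + x ^+ 15 - x ^+ 16 + x ^+ 17) * y + (- x - x ^+ 2 - x
    ^+ 3 - x ^+ 4 - x ^+ 5 - x ^+ 6 + x ^+ 7 - x ^+ 10 - x ^+ 11 + x ^+ 12 - x ^+ 13 -
    x ^+ 14 + x ^+ 16 - x ^+ 17 + x ^+ 18) * y ^+ 2 + (x ^+ 3 + x ^+ 5 + x ^+ 6 - x ^+
    7 - x ^+ 8 + x ^+ 9 - x ^+ 11 + x ^+ 12 - x ^+ 14 - x ^+ 15) * y ^+ 3 + (- x - x
    ^+ 3 + x ^+ 6 - x ^+ 8 + x ^+ 9 + x ^+ 12) * y ^+ 4 + (- x - x ^+ 2 + x ^+ 6 + x
    ^+ 7 + x ^+ 8 - x ^+ 9) * y ^+ 5 + (x ^+ 2 - x ^+ 3 - x ^+ 5 + x ^+ 6) * y ^+ 6) (d :=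
    (- x ^+ 4 + x ^+ 5 + 3 * x ^+ 6 - x ^+ 7 - 5 * x ^+ 8 + 4 * x ^+ 9 + 5 * x ^+ 10 -
    5 * x ^+ 11 - 3 * x ^+ 12 + 5 * x ^+ 13 + x ^+ 14 - 2 * x ^+ 15 + x ^+ 17) + (- x
    ^+ 4 - 2 * x ^+ 5 + 6 * x ^+ 7 - 3 * x ^+ 8 - 4 * x ^+ 9 - x ^+ 10 + 3 * x ^+ 11 +
    5 * x ^+ 12 - 9 * x ^+ 14 + 5 * x ^+ 16 - 3 * x ^+ 18 + x ^+ 19) * y + (- x ^+ 3 +
    2 * x ^+ 4 - 2 * x ^+ 5 - 9 * x ^+ 6 + 2 * x ^+ 7 + 3 * x ^+ 8 + 6 * x ^+ 9 - x ^+
    10 - 9 * x ^+ 11 - 7 * x ^+ 12 + 5 * x ^+ 13 + 5 * x ^+ 14 + 2 * x ^+ 15 - 3 * x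
    ^+ 16 - 4 * x ^+ 17 + 3 * x ^+ 19 - x ^+ 20) * y ^+ 2 + (- x + 2 * x ^+ 2 - x ^+ 3
    + 8 * x ^+ 4 - x ^+ 5 - 3 * x ^+ 6 + 5 * x ^+ 7 - 7 * x ^+ 8 - 2 * x ^+ 9 + 4 * x
    ^+ 10 + 7 * x ^+ 11 + 2 * x ^+ 12 - x ^+ 13 - 4 * x ^+ 14 - 3 * x ^+ 15 + x ^+ 16
    + 2 * x ^+ 17 - x ^+ 20) * y ^+ 3 + (- 3 * x + 7 * x ^+ 2 - 5 * x ^+ 3 + 7 * x ^+
    4 - 10 * x ^+ 5 + 2 * x ^+ 6 + 5 * x ^+ 7 - 6 * x ^+ 8 + x ^+ 9 + x ^+ 10 + x ^+
    11 - x ^+ 12 + x ^+ 13 + x ^+ 14 + x ^+ 17) * y ^+ 4 + (- 3 * x + 11 * x ^+ 2 - 12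
    * x ^+ 3 + 7 * x ^+ 4 - 9 * x ^+ 5 + 7 * x ^+ 6 - 2 * x ^+ 8 + 2 * x ^+ 9 - x ^+
    12) * y ^+ 5 + (- x + 9 * x ^+ 2 - 13 * x ^+ 3 + 10 * x ^+ 4 - 5 * x ^+ 5 + 4 * x
    ^+ 6 - 3 * x ^+ 7 - x ^+ 10) * y ^+ 6 + (3 * x ^+ 2 - 7 * x ^+ 3 + 7 * x ^+ 4 - 3
    * x ^+ 5 + x ^+ 6 - x ^+ 7) * y ^+ 7 + (- x ^+ 3 + 2 * x ^+ 4 - x ^+ 5) * y ^+ 8) three0).
by rewrite /r /v /X13_cube_root; ring.
Qed.

(** In terms of the Tate normal form, [b], [n], [b2] are $(y+1)b$, $(y+1)(1-c)$ and $(y+1)^2b_2$,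
    where $b_2 = (1-c)^2 - 4b$ is reduced modulo 3. The bracket on the left is, up to a factor, the
    discriminant of the 2-torsion cubic. *)
Lemma X13_char3_h (b b2 n : K) : 3 = 0 :> K ->
  b = - (v * x * y * r) -> n = y + 1 + v * x * y -> b2 = n ^+ 2 - b * (y + 1) ->
  x ^+ 4 * r ^+ 5 * (b2 ^+ 2 * n ^+ 2 - n ^+ 3 * b * (y + 1) ^+ 2 - b2 ^+ 3) =
  ((y * v) ^+ 2 - (x ^+ 2 * r) ^+ 2) * y ^+ 11 * (y + 1) ^+ 4 * v ^+ 3.
Proof.
move=> three0 -> -> ->; apply: (mod_curve (c :=
    (- x ^+ 7) * y ^+ 5 + (- x ^+ 6 - x ^+ 7) * y ^+ 6 + (- x ^+ 5 - x ^+ 6 - x ^+ 7 -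
    x ^+ 9) * y ^+ 7 + (- x ^+ 4 - x ^+ 5 + x ^+ 6 - x ^+ 7 - x ^+ 9) * y ^+ 8 + (- x
    ^+ 3 - x ^+ 4 - x ^+ 6 - x ^+ 7 - x ^+ 8 + x ^+ 9 - x ^+ 10 + x ^+ 11) * y ^+ 9 +
    (- x ^+ 2 - x ^+ 3 - x ^+ 4 - x ^+ 5 + x ^+ 6 - x ^+ 7 - x ^+ 10 + x ^+ 11 - x ^+
    12) * y ^+ 10 + (- x - x ^+ 2 + x ^+ 5 + x ^+ 6 + x ^+ 7 - x ^+ 10 + x ^+ 11 - x
    ^+ 12) * y ^+ 11 + (- 1 - x - x ^+ 2 + x ^+ 4 + x ^+ 5 - x ^+ 7 - x ^+ 9 + x ^+ 10
    - x ^+ 11 - x ^+ 12 - x ^+ 13 + x ^+ 14) * y ^+ 12 + (1 - x - x ^+ 2 + x ^+ 5 + x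
    ^+ 6 + x ^+ 8 + x ^+ 9 - x ^+ 11 + x ^+ 14 - x ^+ 15) * y ^+ 13 + (- 1 + x ^+ 4 -
    x ^+ 5 - x ^+ 6 + x ^+ 7 - x ^+ 9 + x ^+ 10 - x ^+ 11 - x ^+ 12 - x ^+ 13 - x ^+
    14 - x ^+ 15 + x ^+ 16) * y ^+ 14 + (1 + x + x ^+ 2 + x ^+ 3 + x ^+ 5 + x ^+ 6 - x
    ^+ 7 + x ^+ 8 + x ^+ 9 - x ^+ 10 - x ^+ 12 - x ^+ 14 + x ^+ 15 + x ^+ 17) * y ^+
    15 + (- 1 + x + x ^+ 2 - x ^+ 3 + x ^+ 4 + x ^+ 5 + x ^+ 7 + x ^+ 10 + x ^+ 12 + x
    ^+ 13 - x ^+ 14 + x ^+ 15 - x ^+ 16 + x ^+ 17) * y ^+ 16 + (1 + x ^+ 3 + x ^+ 4 +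
    x ^+ 5 - x ^+ 6 + x ^+ 9 - x ^+ 10 - x ^+ 11 - x ^+ 13 - x ^+ 14) * y ^+ 17 + (- 1
    - x - x ^+ 2 + x ^+ 4 + x ^+ 6 + x ^+ 11) * y ^+ 18 + (1 - x + x ^+ 2 + x ^+ 3 + x
    ^+ 6 + x ^+ 7 - x ^+ 8) * y ^+ 19 + (- 1 - x - x ^+ 2 + x ^+ 3 + x ^+ 4 + x ^+ 5)
    * y ^+ 20) (d :=
    (- x ^+ 6) * y ^+ 2 + (- 6 * x ^+ 6 + 6 * x ^+ 7) * y ^+ 3 + (- 15 * x ^+ 6 + 34 *
    x ^+ 7 - 9 * x ^+ 8) * y ^+ 4 + (- 20 * x ^+ 6 + 80 * x ^+ 7 - 47 * x ^+ 8 - 23 *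
    x ^+ 9) * y ^+ 5 + (- 15 * x ^+ 6 + 100 * x ^+ 7 - 100 * x ^+ 8 - 124 * x ^+ 9 +
    114 * x ^+ 10) * y ^+ 6 + (- 6 * x ^+ 6 + 70 * x ^+ 7 - 111 * x ^+ 8 - 281 * x ^+
    9 + 568 * x ^+ 10 - 202 * x ^+ 11) * y ^+ 7 + (- x ^+ 6 + 27 * x ^+ 7 - 67 * x ^+
    8 - 338 * x ^+ 9 + 1168 * x ^+ 10 - 950 * x ^+ 11 + 176 * x ^+ 12) * y ^+ 8 + (5 *
    x ^+ 7 - 22 * x ^+ 8 - 228 * x ^+ 9 + 1263 * x ^+ 10 - 1825 * x ^+ 11 + 800 * x ^+
    12 - 41 * x ^+ 13) * y ^+ 9 + (x ^+ 7 - 2 * x ^+ 8 - 81 * x ^+ 9 + 756 * x ^+ 10 -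
    1824 * x ^+ 11 + 1466 * x ^+ 12 - 230 * x ^+ 13 - 65 * x ^+ 14) * y ^+ 10 + (x ^+
    4 + x ^+ 5 + x ^+ 6 + 2 * x ^+ 7 + x ^+ 8 - 12 * x ^+ 9 + 237 * x ^+ 10 - 994 * x
    ^+ 11 + 1375 * x ^+ 12 - 473 * x ^+ 13 - 179 * x ^+ 14 + 63 * x ^+ 15) * y ^+ 11 +
    (3 * x ^+ 4 - x ^+ 5 - x ^+ 8 - x ^+ 9 + 30 * x ^+ 10 - 278 * x ^+ 11 + 688 * x ^+
    12 - 466 * x ^+ 13 - 165 * x ^+ 14 + 187 * x ^+ 15 - 12 * x ^+ 16) * y ^+ 12 + (x
    + x ^+ 2 + 7 * x ^+ 4 - 11 * x ^+ 5 + 3 * x ^+ 6 + x ^+ 9 + x ^+ 10 - 30 * x ^+ 11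
    + 171 * x ^+ 12 - 229 * x ^+ 13 - 46 * x ^+ 14 + 198 * x ^+ 15 - 44 * x ^+ 16 - 14
    * x ^+ 17) * y ^+ 13 + (- 3 + 2 * x + 12 * x ^+ 4 - 29 * x ^+ 5 + 19 * x ^+ 6 - 4
    * x ^+ 7 - x ^+ 8 - x ^+ 10 + 16 * x ^+ 12 - 52 * x ^+ 13 + 7 * x ^+ 14 + 87 * x
    ^+ 15 - 49 * x ^+ 16 - 22 * x ^+ 17 + 11 * x ^+ 18) * y ^+ 14 + (- 12 + 14 * x - 2
    * x ^+ 2 + x ^+ 3 + 12 * x ^+ 4 - 43 * x ^+ 5 + 47 * x ^+ 6 - 17 * x ^+ 7 + 2 * x
    ^+ 8 + x ^+ 11 - 4 * x ^+ 13 + 5 * x ^+ 14 + 16 * x ^+ 15 - 18 * x ^+ 16 - 10 * x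
    ^+ 17 + 17 * x ^+ 18 - 3 * x ^+ 19) * y ^+ 15 + (- 28 + 46 * x - 24 * x ^+ 2 + 3 *
    x ^+ 3 + 6 * x ^+ 4 - 39 * x ^+ 5 + 62 * x ^+ 6 - 37 * x ^+ 7 + 7 * x ^+ 8 + x ^+
    12 + x ^+ 13 + 2 * x ^+ 14 + x ^+ 15 - 2 * x ^+ 16 - 3 * x ^+ 17 + 7 * x ^+ 18 - 4
    * x ^+ 19) * y ^+ 16 + (- 42 + 93 * x - 70 * x ^+ 2 + 20 * x ^+ 3 - 20 * x ^+ 5 +
    47 * x ^+ 6 - 42 * x ^+ 7 + 13 * x ^+ 8 - 2 * x ^+ 9 - x ^+ 12 - x ^+ 13 - 2 * x
    ^+ 15 - x ^+ 17 + x ^+ 18 - x ^+ 19) * y ^+ 17 + (- 42 + 116 * x - 118 * x ^+ 2 +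
    49 * x ^+ 3 - 9 * x ^+ 4 - 6 * x ^+ 5 + 20 * x ^+ 6 - 26 * x ^+ 7 + 13 * x ^+ 8 -
    2 * x ^+ 9 + x ^+ 13 + x ^+ 14 + x ^+ 16) * y ^+ 18 + (- 28 + 94 * x - 116 * x ^+
    2 + 67 * x ^+ 3 - 16 * x ^+ 4 + x ^+ 5 + 4 * x ^+ 6 - 8 * x ^+ 7 + 6 * x ^+ 8 - 2
    * x ^+ 9) * y ^+ 19 + (- 12 + 47 * x - 71 * x ^+ 2 + 49 * x ^+ 3 - 17 * x ^+ 4 + 2
    * x ^+ 5 - x ^+ 7 + x ^+ 8 - x ^+ 9) * y ^+ 20 + (- 3 + 14 * x - 23 * x ^+ 2 + 20
    * x ^+ 3 - 8 * x ^+ 4 + x ^+ 5 - x ^+ 6 - x ^+ 7) * y ^+ 21 + (2 * x - 3 * x ^+ 2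
    + 3 * x ^+ 3 - 2 * x ^+ 4) * y ^+ 22) three0).
by rewrite /r /v; ring.
Qed.

(** The 2-torsion cubic, with abscissas divided by the $b$ of the Tate form, evaluated at $1/r =
    c/b$, the abscissa of three times the 13-torsion point. *)
Lemma X13_char3_value (b b2 n : K) : 3 = 0 :> K ->
  b = - (v * x * y * r) -> n = y + 1 + v * x * y -> b2 = n ^+ 2 - b * (y + 1) ->
  (b * (y + 1) + b2 * r + n * r ^+ 2 * (y + 1) + r ^+ 3 * (y + 1) ^+ 2) * v =
  - (x ^+ 3 * y ^+ 3 * b).
Proof.
move=> three0 -> -> ->; apply: (mod_curve (c := 0) (d :=
    (1) + (3 - 2 * x) * y + (3 - 5 * x) * y ^+ 2 + (1 - 4 * x + 2 * x ^+ 3) * y ^+ 3 +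
    (- x + 3 * x ^+ 3 - x ^+ 4) * y ^+ 4 + (x ^+ 3 - x ^+ 4) * y ^+ 5) three0).
by rewrite /r /v; ring.
Qed.

End ModularCurve.

(** * Theta quotients as functions on X_1(13) *)

Section ThetaAlgebra.
Variables (K : fieldType) (E1 E2 E3 E4 E5 E6 : K).
Hypotheses (E1_neq0 : E1 != 0) (E2_neq0 : E2 != 0) (E3_neq0 : E3 != 0)
  (E4_neq0 : E4 != 0) (E5_neq0 : E5 != 0) (E6_neq0 : E6 != 0).
Hypothesis W32 : E5 * E1 ^+ 3 = E4 * E2 ^+ 3 - E1 * E3 ^+ 3.
Hypothesis W42 : E6 * E2 * E1 ^+ 2 = E5 * E3 * E2 ^+ 2 - E3 * E1 * E4 ^+ 2.
Hypothesis W52 : - (E6 * E3 * E1 ^+ 2) = E6 * E4 * E2 ^+ 2 - E3 * E1 * E5 ^+ 2.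
Hypothesis W3426 : E4 * E6 * E1 * E5 + E4 * E6 * E2 * E3 = E1 * E5 * E2 * E3.

Let nz := (E1_neq0, E2_neq0, E3_neq0, E4_neq0, E5_neq0, E6_neq0).
(** [E1], ..., [E6] behave like the values of the sigma function at the multiples of a 13-torsion
    point. For an elliptic divisibility sequence $W_n$ in Tate normal form, $W_3^3W_1/(W_2^3W_4) =
    b/c$, which is the formula for [r]. All the quotients below are monomials because of the four
    relations. *)
Let x := E5 * E1 / (E2 * E3).
Let y := E3 * E1 ^+ 2 / (E4 * E2 ^+ 2).
Let r := E3 ^+ 3 * E1 / (E2 ^+ 3 * E4).
Let v := E5 * E4 * E1 ^+ 2 * E3 / (E6 * E2 ^+ 4).
Let y1 := E5 ^+ 2 * E1 * E3 / (E4 * E6 * E2 ^+ 2).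

Let rE : 1 - x * y = r.
Proof.
apply/eqP; rewrite -subr_eq0; apply/eqP.
have -> : 1 - x * y - r =
    (E4 * E2 ^+ 3 - E1 * E3 ^+ 3 - E5 * E1 ^+ 3) / (E2 ^+ 3 * E4).
  by rewrite /x /y /r; field; rewrite !nz.
by rewrite -W32 subrr mul0r.
Qed.

Let y1E : y + 1 = y1.
Proof.
apply/eqP; rewrite -subr_eq0; apply/eqP.
have -> : y + 1 - y1 = (E6 * E4 * E2 ^+ 2 - E3 * E1 * E5 ^+ 2 + E6 * E3 * E1 ^+ 2)
    / (E4 * E2 ^+ 2 * E6).
  by rewrite /y /y1; field; rewrite !nz.
by rewrite -W52 addNr mul0r.
Qed.

Let vE : y + 1 - x * y = v.
Proof.
rewrite y1E; apply/eqP; rewrite -subr_eq0; apply/eqP.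
have -> : y1 - x * y - v = E5 * E1
    * (E5 * E3 * E2 ^+ 2 - E3 * E1 * E4 ^+ 2 - E6 * E2 * E1 ^+ 2) / (E4 * E2 ^+ 4 * E6).
  by rewrite /y1 /x /y /v; field; rewrite !nz.
by rewrite -W42 subrr mulr0 mul0r.
Qed.

Let x1E : x + 1 = E1 * E5 / (E4 * E6).
Proof.
apply/eqP; rewrite -subr_eq0; apply/eqP.
have -> : x + 1 - E1 * E5 / (E4 * E6) = (E4 * E6 * E1 * E5 + E4 * E6 * E2 * E3
    - E1 * E5 * E2 * E3) / (E2 * E3 * E4 * E6).
  by rewrite /x; field; rewrite !nz.
by rewrite W3426 subrr mul0r.
Qed.

Let curve : y * (y + 1) = x * (x + 1) * (1 - x * y).
Proof. by rewrite rE y1E x1E /x /y /r /y1; field; rewrite !nz. Qed.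

Let x_neq0 : x != 0. Proof. by rewrite /x !(mulf_neq0, invr_neq0) ?nz. Qed.
Let y_neq0 : y != 0. Proof. by rewrite /y !(mulf_neq0, invr_neq0, expf_neq0) ?nz. Qed.
Let r_neq0 : r != 0. Proof. by rewrite /r !(mulf_neq0, invr_neq0, expf_neq0) ?nz. Qed.
Let v_neq0 : v != 0. Proof. by rewrite /v !(mulf_neq0, invr_neq0, expf_neq0) ?nz. Qed.
Let y1_neq0 : y1 != 0. Proof. by rewrite /y1 !(mulf_neq0, invr_neq0, expf_neq0) ?nz. Qed.

Let P := E1 * E2 * E3 * E4 * E5 * E6.

(** The duplication formulas eliminate [p1] and [p2], the addition formula then determines [Y] on
    the curve, and the last relation fixes the scale. $P^2/Y^4$ is the function that becomes
    $t^{-1}$. *)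
Lemma theta13_char2 (Y p1 p2 : K) : 2 = 0 :> K -> Y != 0 ->
  E2 * Y = p1 * E1 ^+ 2 -> E4 * Y = p2 * E2 ^+ 2 ->
  E3 * E1 = p2 * E1 ^+ 2 + p1 * E2 ^+ 2 -> p2 = p1 ^+ 4 + E1 ^+ 8 ->
  P = Y ^+ 6 * ((P ^+ 2 / Y ^+ 4) ^+ 3 + 1) ^+ 2 * (P ^+ 2 / Y ^+ 4 + 1).
Proof.
move=> two0 Y_neq0 e1 e2 e3 e4.
have opp2 (a : K) : - a = a.
  by apply/eqP; rewrite -subr_eq0 -opprD -mulr2n -mulr_natr two0 mulr0 oppr0.
(* $(y+1+vxy)/(y+1)$ is the coefficient $1-c$ of the Tate form, the Hasse invariant in
   characteristic 2. *)
have n_eq : (y + 1 + v * x * y) * Y = y1 * E1 ^+ 3 * E3 / E2 ^+ 3.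
  have p1E : p1 = E2 * Y / E1 ^+ 2 by rewrite e1; field; rewrite nz.
  have p2E : p2 = E4 * Y / E2 ^+ 2 by rewrite e2; field; rewrite nz.
  have -> : y1 * E1 ^+ 3 * E3 / E2 ^+ 3 = y1 * E1 ^+ 2 * (E3 * E1) / E2 ^+ 3.
    by rewrite !mulrA; congr (_ / _); ring.
  rewrite e3 p1E p2E y1E /y1 /v /x /y; field; rewrite !nz //.
set n := y + 1 + v * x * y in n_eq *.
have n_neq0 : n != 0.
  apply/eqP => n0; move: n_eq; rewrite n0 mul0r => /esym/eqP; apply/negP.
  by rewrite !(mulf_neq0, invr_neq0, expf_neq0) ?nz.
have YE : Y = y1 * E1 ^+ 3 * E3 / E2 ^+ 3 / n by rewrite -n_eq mulrAC divff ?mul1r.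
(* [e4] is the only inhomogeneous relation. Written as 1 equal to an expression of degree $-8$ in
   the theta values, it compensates the degree 8 of $P^2/Y^4$ and makes it a function on the
   curve. *)
have e8 : 1 = E2 ^+ 2 / E1 ^+ 8 * (Y * E4 / E2 ^+ 4 + Y ^+ 4 * E2 ^+ 2 / E1 ^+ 8).
  have p1E : p1 = E2 * Y / E1 ^+ 2 by rewrite e1; field; rewrite nz.
  have p2E : p2 = E4 * Y / E2 ^+ 2 by rewrite e2; field; rewrite nz.
  have e8 : E1 ^+ 8 = p2 + p1 ^+ 4 by rewrite e4 addrAC -mulr2n -mulr_natr two0 mulr0 add0r.
  rewrite -[1](@divff _ (E1 ^+ 8)) ?expf_neq0 // {1}e8 p1E p2E; field.
  by rewrite !nz.
have rnE : 1 + n ^+ 3 / (r * y1 ^+ 3) = (r * y1 ^+ 3 + n ^+ 3) / (r * y1 ^+ 3).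
  by field; rewrite r_neq0 y1_neq0.
have hE : P ^+ 2 / Y ^+ 4 = ((x ^+ 2 * r) ^+ 2 + y * v * (x ^+ 2 * r) + (y * v) ^+ 2)
    / (y * v * (x ^+ 2 * r)).
  have -> : P ^+ 2 / Y ^+ 4 = x ^+ 4 * r ^+ 6 / (y ^+ 10 * v ^+ 2) * (1 + n ^+ 3 / (r * y1 ^+ 3)).
    rewrite -[LHS]mulr1 {1}e8.
    have -> : n ^+ 3 / (r * y1 ^+ 3) = E4 * E1 ^+ 8 / (E2 ^+ 6 * Y ^+ 3).
      rewrite YE /r /y1; field; rewrite n_neq0 !nz //.
    by rewrite /P /x /y /r /v; field; rewrite Y_neq0 !nz.
  rewrite rnE; have := X13_char2_h curve two0; rewrite rE vE -/n y1E => e.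
  apply/eqP; rewrite -subr_eq0; apply/eqP.
  have -> : x ^+ 4 * r ^+ 6 / (y ^+ 10 * v ^+ 2) * ((r * y1 ^+ 3 + n ^+ 3) / (r * y1 ^+ 3))
     - ((x ^+ 2 * r) ^+ 2 + y * v * (x ^+ 2 * r) + (y * v) ^+ 2) / (y * v * (x ^+ 2 * r))
     = (x ^+ 6 * r ^+ 6 * (r * y1 ^+ 3 + n ^+ 3)
       - ((x ^+ 2 * r) ^+ 2 + y * v * (x ^+ 2 * r) + (y * v) ^+ 2) * y ^+ 9 * v * y1 ^+ 3)
       / (x ^+ 2 * r * y ^+ 10 * v ^+ 2 * y1 ^+ 3).
    by field; rewrite x_neq0 y_neq0 r_neq0 v_neq0 y1_neq0.
  by rewrite e subrr mul0r.
have := X13_char2_b curve two0; rewrite rE vE -/n y1E.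
rewrite hE; set R1 := y * v; set R0 := x ^+ 2 * r => eb.
have R0_neq0 : R0 != 0 by rewrite mulf_neq0 ?expf_neq0.
have R1_neq0 : R1 != 0 by rewrite mulf_neq0.
set q := R1 ^+ 4 + _ + _ + _ + _ in eb.
have -> : (R0 ^+ 2 + R1 * R0 + R1 ^+ 2) / (R1 * R0) + 1 = (R1 + R0) ^+ 2 / (R1 * R0).
  by field; rewrite R0_neq0.
have -> : ((R0 ^+ 2 + R1 * R0 + R1 ^+ 2) / (R1 * R0)) ^+ 3 + 1
    = (R1 + R0) ^+ 2 * q / (R1 * R0) ^+ 3.
  apply/eqP; rewrite -subr_eq0; apply/eqP; rewrite /q.
  rewrite [LHS](_ : _ = 2 * (2 * R1 ^+ 3 * R0 ^+ 3 + R1 ^+ 4 * R0 ^+ 2 + R1 ^+ 2 * R0 ^+ 4)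
    / (R1 * R0) ^+ 3); first by rewrite two0 !mul0r.
  by field; rewrite R0_neq0.
have -> : Y ^+ 6 * ((R1 + R0) ^+ 2 * q / (R1 * R0) ^+ 3) ^+ 2 * ((R1 + R0) ^+ 2 / (R1 * R0))
    = Y ^+ 6 * ((R1 + R0) ^+ 3 * q * y1 ^+ 2) ^+ 2 / ((R1 * R0) ^+ 7 * y1 ^+ 4).
  by field; rewrite R0_neq0 R1_neq0 y1_neq0.
rewrite -eb /R1 /R0 YE /P /r /v /y1 /x /y; field.
by rewrite n_neq0 !nz.
Qed.

(** The three formulas with [X] are the squared duplication formulas at the multiples 1, 2, 3 of the
    torsion point; the last three compare the 2-torsion abscissas. $P^2/X^2$ is the function that
    becomes $t^{-1}$. *)
Lemma theta13_char3 (X A2 A3 A4 C2 C3 C4 : K) : 3 = 0 :> K -> X != 0 ->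
  C2 * C3 * C4 = X ->
  X * E2 ^+ 2 = E1 ^+ 2 * (A2 * A3 * A4) ->
  X * E4 ^+ 2 * E1 ^+ 6 = E2 ^+ 2 * ((E2 ^+ 2 * A2 - C2 * (E3 * E1))
    * (E2 ^+ 2 * A3 - C3 * (E3 * E1)) * (E2 ^+ 2 * A4 - C4 * (E3 * E1))) ->
  X * E6 ^+ 2 * E1 ^+ 6 = E3 ^+ 2 * ((E3 ^+ 2 * A2 - C2 * (E4 * E2))
    * (E3 ^+ 2 * A3 - C3 * (E4 * E2)) * (E3 ^+ 2 * A4 - C4 * (E4 * E2))) ->
  A2 * C3 - A3 * C2 = C4 * E1 ^+ 2 -> A2 * C4 - A4 * C2 = C3 * E1 ^+ 2 ->
  A3 * C4 - A4 * C3 = C2 * E1 ^+ 2 ->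
  exists k, P / X + X / P = X * k ^+ 3.
Proof.
move=> three0 X_neq0 CX HX1 HX2 HX3 d23 d24 d34.
have [[C2_neq0 C3_neq0] C4_neq0] : (C2 != 0 /\ C3 != 0) /\ C4 != 0.
  by move: X_neq0; rewrite -CX !mulf_eq0 !negb_or => /andP[/andP[-> ->] ->].
pose w := E3 * E1 / E2 ^+ 2.
have w_neq0 : w != 0 by rewrite /w !(mulf_neq0, invr_neq0, expf_neq0) ?nz.
have nzC := (C2_neq0, C3_neq0, C4_neq0, w_neq0, X_neq0).
(* The abscissas of the 2-torsion points, in the coordinate that is 0 at the 13-torsion point, 1 at
   its double and $1/r$ at its triple. [s3E], [g1] and [g2] compute the monic cubic with these roots
   there. *)
pose a2 := A2 / C2 / w; pose a3 := A3 / C3 / w; pose a4 := A4 / C4 / w.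
pose s1 := a2 + a3 + a4; pose s2 := a2 * a3 + a2 * a4 + a3 * a4; pose s3 := a2 * a3 * a4.
pose n := y1 + v * x * y; pose B := - (v * x * y * r); pose b2 := n ^+ 2 - B * y1.
have B_neq0 : B != 0.
  by rewrite oppr_eq0; apply: mulf_neq0 (mulf_neq0 (mulf_neq0 v_neq0 x_neq0) y_neq0) r_neq0.
have s3E : s3 = - (y1 / B).
  have -> : s3 = A2 * A3 * A4 / X / w ^+ 3.
    by rewrite -CX /s3 /a2 /a3 /a4; field; rewrite ?nzC ?nz.
  have -> : A2 * A3 * A4 = X * E2 ^+ 2 / E1 ^+ 2 by rewrite HX1; field; rewrite nz.
  by rewrite /w /B /y1 /v /x /y /r; field; rewrite ?nzC ?nz ?oppr_eq0 ?mulf_neq0 ?expf_neq0 ?nz.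
have g1 : 1 - s1 + s2 - s3 = (v * x * y) ^+ 2 / (y1 * B).
  have -> : 1 - s1 + s2 - s3 = - (((E2 ^+ 2 * A2 - C2 * (E3 * E1))
    * (E2 ^+ 2 * A3 - C3 * (E3 * E1)) * (E2 ^+ 2 * A4 - C4 * (E3 * E1)))
      / X / (E2 ^+ 6 * w ^+ 3)).
    by rewrite -CX /s1 /s2 /s3 /a2 /a3 /a4 /w; field; rewrite ?nzC ?nz.
  move: HX2; set Q := (_ - _) * _ * _ => HX2.
  have -> : Q = X * E4 ^+ 2 * E1 ^+ 6 / E2 ^+ 2 by rewrite HX2; field; rewrite nz.
  by rewrite /w /B /y1 /v /x /y /r; field; rewrite ?nzC ?nz ?oppr_eq0 ?mulf_neq0 ?expf_neq0 ?nz.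
have g2 : 1 / r ^+ 3 - s1 / r ^+ 2 + s2 / r - s3 = - (x ^+ 3 * y ^+ 3 / (y1 * r ^+ 3 * v)).
  have -> : 1 / r ^+ 3 - s1 / r ^+ 2 + s2 / r - s3 = - (((E3 ^+ 2 * A2 - C2 * (E4 * E2))
    * (E3 ^+ 2 * A3 - C3 * (E4 * E2)) * (E3 ^+ 2 * A4 - C4 * (E4 * E2)))
      / X / (E3 ^+ 6 * w ^+ 3)).
    by rewrite -CX /s1 /s2 /s3 /a2 /a3 /a4 /w /r; field; rewrite ?nzC ?nz.
  move: HX3; set Q := (_ - _) * _ * _ => HX3.
  have -> : Q = X * E6 ^+ 2 * E1 ^+ 6 / E3 ^+ 2 by rewrite HX3; field; rewrite nz.
  by rewrite /w /y1 /v /x /y /r; field; rewrite ?nzC ?nz.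
have xy_neq0 : 1 - r != 0 by rewrite -rE opprB addrC subrK mulf_neq0.
(* [b2] is forced by [g1] and [g2] *)
have d12 : s1 + b2 / (B * y1) = s2 - n / B.
  apply/eqP; rewrite -subr_eq0; apply/eqP.
  have -> : s1 + b2 / (B * y1) - (s2 - n / B)
     = (n ^+ 2 + n * y1 + y1 ^+ 2) / (y1 * B) - (1 - s1 + s2 - s3).
    by rewrite s3E /b2; field; rewrite B_neq0 y1_neq0.
  rewrite g1 -mulrBl /n.
  rewrite (_ : _ - _ = 3 * (y1 ^+ 2 + y1 * (v * x * y))); last by ring.
  by rewrite three0 !mul0r.
(* The value at $1/r$ gives $d/r^2 = d/r$ for the common difference $d$ in [d12], and $1 - r = xy$
   is not 0. *)
have d0 : s2 - n / B = 0.
  have e : (s1 + b2 / (B * y1)) / r ^+ 2 = (s2 - n / B) / r.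
    have := X13_char3_value curve (b := B) (n := n) (b2 := b2) three0.
    rewrite rE vE y1E => /(_ erefl erefl erefl) e.
    apply/eqP; rewrite -subr_eq0; apply/eqP.
    have -> : (s1 + b2 / (B * y1)) / r ^+ 2 - (s2 - n / B) / r
      = (B * y1 + b2 * r + n * r ^+ 2 * y1 + r ^+ 3 * y1 ^+ 2) * v / (B * y1 * r ^+ 3 * v)
        - (1 / r ^+ 3 - s1 / r ^+ 2 + s2 / r - s3).
      by rewrite s3E; field; rewrite B_neq0 y1_neq0 r_neq0 v_neq0.
    by rewrite e g2; field; rewrite B_neq0 y1_neq0 r_neq0 v_neq0.
  apply/eqP; move: e; rewrite d12; set d := s2 - n / B => e.
  have : d * (1 - r) = 0.
    rewrite (_ : _ * _ = (d / r ^+ 2 - d / r) * r ^+ 2); last by field; rewrite r_neq0.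
    by rewrite e subrr mul0r.
  by move/eqP; rewrite mulf_eq0 (negbTE xy_neq0) orbF.
have s2E : s2 = n / B by apply/eqP; rewrite -subr_eq0 d0.
have s1E : s1 = - (b2 / (B * y1)).
  by apply/eqP; rewrite -subr_eq0 opprK d12 d0.
(* Modulo 3 the discriminant of a cubic is $s_1^2s_2^2 - s_2^3 - s_1^3s_3$; the differences of the
   roots are monomials in the theta values. *)
have discE : P ^+ 2 / X ^+ 2 = P ^+ 2 * w ^+ 6 / E1 ^+ 12
    * (s1 ^+ 2 * s2 ^+ 2 - s2 ^+ 3 - s1 ^+ 3 * s3).
  have -> : s1 ^+ 2 * s2 ^+ 2 - s2 ^+ 3 - s1 ^+ 3 * s3
      = ((a2 - a3) * (a2 - a4) * (a3 - a4)) ^+ 2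
       + 3 * (s2 ^+ 3 + s1 ^+ 3 * s3 - 6 * s1 * s2 * s3 + 9 * s3 ^+ 2).
    by rewrite /s1 /s2 /s3; ring.
  rewrite three0 mul0r addr0.
  have -> : a2 - a3 = C4 * E1 ^+ 2 / (C2 * C3 * w).
    by rewrite -d23 /a2 /a3; field; rewrite ?nzC ?nz.
  have -> : a2 - a4 = C3 * E1 ^+ 2 / (C2 * C4 * w).
    by rewrite -d24 /a2 /a4; field; rewrite ?nzC ?nz.
  have -> : a3 - a4 = C2 * E1 ^+ 2 / (C3 * C4 * w).
    by rewrite -d34 /a3 /a4; field; rewrite ?nzC ?nz.
  by rewrite -CX; field; rewrite ?nzC ?nz.
pose R0 := x ^+ 2 * r; pose R1 := y * v.
have R0_neq0 : R0 != 0 by rewrite mulf_neq0 ?expf_neq0.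
have R1_neq0 : R1 != 0 by rewrite mulf_neq0.
(* Here [R1 / R0] equals [E1 * E3 * E4 / (E2 * E5 * E6)]. *)
have hE : P ^+ 2 / X ^+ 2 = (R1 ^+ 2 - R0 ^+ 2) / (R1 * R0).
  rewrite discE s1E s2E s3E.
  have -> : P ^+ 2 * w ^+ 6 / E1 ^+ 12 = x ^+ 6 * r ^+ 8 / (y ^+ 8 * y1 ^+ 2).
    by rewrite /P /w /x /r /y /y1; field; rewrite !nz.
  have := X13_char3_h curve (b := B) (n := n) (b2 := b2) three0.
  rewrite rE vE y1E -/R0 -/R1 => /(_ erefl erefl erefl) e.
  rewrite (_ : (R1 ^+ 2 - R0 ^+ 2) = x ^+ 4 * r ^+ 5
    * (b2 ^+ 2 * n ^+ 2 - n ^+ 3 * B * y1 ^+ 2 - b2 ^+ 3) / (y ^+ 11 * y1 ^+ 4 * v ^+ 3));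
    last by rewrite e; field; rewrite y_neq0 y1_neq0 v_neq0.
  rewrite /R0 /R1 /B; field.
  by rewrite x_neq0 y_neq0 y1_neq0 v_neq0 r_neq0.
pose k := - (X13_cube_root x y / (x * v) / (E1 ^+ 2 * E3 ^+ 3 * E5 / (E2 ^+ 3 * E4))).
exists k.
have P_neq0 : P != 0 by rewrite /P !mulf_neq0 ?nz.
have -> : P / X + X / P = X * ((P ^+ 2 / X ^+ 2 + 1) / P) by field; rewrite P_neq0 X_neq0.
congr (_ * _); rewrite hE.
have := X13_char3_cube curve three0; rewrite rE vE y1E -/R0 -/R1 => e.
rewrite /k exprNn !exprMn -e.
rewrite /P /R0 /R1 /x /y /v /r /y1; field.
by rewrite !nz.
Qed.

End ThetaAlgebra.

(** * Regular partitions *)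

Section RegularPartitions.
Local Open Scope nat_scope.

Lemma mem_seqs_of_len k m s :
  (s \in seqs_of_len k m) = (size s == k) && all (fun i => 0 < i <= m) s.
Proof.
elim: k s => [|k IH] s /=; first by case: s.
apply/allpairsP/idP => [[[i t] /= [Hi Ht ->]]|] /=.
  by move: Ht Hi; rewrite IH mem_iota eqSS add1n ltnS => /andP[-> ->] ->.
case: s => //= i t; rewrite eqSS => /andP[es /andP[Hi Ht]].
by exists (i, t); rewrite /= mem_iota add1n ltnS IH es.
Qed.

Lemma seqs_of_len_uniq k m : uniq (seqs_of_len k m).
Proof.
elim: k => //= k IH; apply: allpairs_uniq; rewrite ?iota_uniq //.
by move=> [? ?] [? ?] _ _ [-> ->].
Qed.

Lemma partitions_uniq n : uniq (partitions n).
Proof.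
apply: filter_uniq.
have -> : flatten [seq seqs_of_len k n | k <- iota 0 n.+1] =
    [seq s | k <- iota 0 n.+1, s <- seqs_of_len k n].
  by congr flatten; apply: eq_map => k; rewrite map_id.
apply: allpairs_uniq_dep => [|k _|]; [exact: iota_uniq|exact: seqs_of_len_uniq|].
move=> _ _ /allpairsPdep[k [s [_ + ->]]] /allpairsPdep[k' [s' [_ + ->]]] /= es.
by rewrite -es !mem_seqs_of_len => /andP[/eqP <- _] /andP[/eqP <- _].
Qed.

Lemma sumn_ge_size s : all (fun i => 0 < i) s -> size s <= sumn s.
Proof. by elim: s => //= i s IH /andP[i0 /IH]; lia. Qed.

Lemma leq_sumn s i : i \in s -> i <= sumn s.
Proof. by elim: s => //= j s IH; rewrite inE => /predU1P[->|/IH]; lia. Qed.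

Lemma mem_partitions n s : (s \in partitions n) = is_partition n s.
Proof.
rewrite mem_filter andb_idr // => /and3P[_ s0 /eqP sn].
apply/flattenP; exists (seqs_of_len (size s) n).
  by apply/mapP; exists (size s); rewrite // mem_iota /= ltnS -sn sumn_ge_size.
rewrite mem_seqs_of_len eqxx; apply/allP => i si.
by rewrite (allP s0) //= -sn leq_sumn.
Qed.

Variable l : nat.

Definition regular_upto m n : nat :=
  count (all (fun i => (i <= m) && ~~ (l %| i))) (partitions n).

Lemma regular_upto_total m n : n <= m -> regular_upto m n = b l n.
Proof.
move=> le_nm; apply: eq_in_count => s; rewrite mem_partitions => /and3P[_ _ /eqP sn].
apply: eq_in_all => i si; rewrite (leq_trans _ le_nm) //.
by rewrite -sn leq_sumn.
Qed.

Lemma regular_upto0 n : regular_upto 0 n = (n == 0).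
Proof.
rewrite /regular_upto; case: n => [|n] /=; first by [].
apply/eqP; rewrite -leqn0 leqNgt -has_count; apply/hasPn => s.
rewrite mem_partitions => /and3P[_ s0 sn]; apply/negP.
case: s s0 sn => //= i s /andP[i0 _] _ /andP[]; lia.
Qed.

Lemma regular_upto_dvd m n : l %| m.+1 -> regular_upto m.+1 n = regular_upto m n.
Proof.
move=> dvd; apply: eq_count => s; apply: eq_all => i.
rewrite [i <= m.+1]leq_eqVlt ltnS.
by case: eqP => [->|//]; rewrite dvd !andbF.
Qed.

(** The partitions having a part $m+1$ have it as their first part; removing it once is a bijection
    onto the partitions counted by the second term. *)
Lemma regular_uptoS m n : ~~ (l %| m.+1) ->
  regular_upto m.+1 n = regular_upto m n + (if m < n then regular_upto m.+1 (n - m.+1) else 0).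
Proof.
move=> ndvd; rewrite /regular_upto.
pose Q k := all (fun i => (i <= k) && ~~ (l %| i)).
have QS s : Q m s = Q m.+1 s && (m.+1 \notin s).
  elim: s => //= i s ->; rewrite inE negb_or [i <= m.+1]leq_eqVlt ltnS [m.+1 == i]eq_sym.
  case: eqP => [->|_] /=; first by rewrite ltnn !andbF.
  by rewrite !andbA; congr (_ && _); rewrite -!andbA; congr (_ && _).
have cQ L : count (Q m.+1) L = count (Q m) L + count (fun s => Q m.+1 s && (m.+1 \in s)) L.
  by elim: L => //= s L ->; rewrite QS; case: (Q m.+1 s) (m.+1 \in s) => [] [] /=; lia.
rewrite -/(Q _) cQ; congr (_ + _).
have uniq_parts k := partitions_uniq k.
case: ltnP => [lt_mn|le_nm]; last first.
  apply/eqP; rewrite -leqn0 leqNgt -has_count; apply/hasPn => s.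
  rewrite mem_partitions => /and3P[_ _ /eqP sn]; apply/negP => /andP[_ /leq_sumn].
  by rewrite sn; lia.
rewrite -!size_filter -[RHS](size_map (cons m.+1)); apply/perm_size/uniq_perm.
- exact: filter_uniq.
- by rewrite map_inj_uniq; [exact: filter_uniq | move=> ? ? []].
move=> s; rewrite mem_filter mem_partitions; apply/idP/mapP => [|[t]].
  case: s => [|h t] /=; first by [].
  case/andP=> /andP[/andP[/andP[le_h dh] Qt] mem_m] /and3P[Ht /andP[h0 t0] /eqP sn].
  have min_t := order_path_min (rev_trans leq_trans) Ht.
  have eh : h = m.+1.
    apply/eqP; rewrite eqn_leq le_h /=; move: mem_m; rewrite inE => /predU1P[<-|mt]; first exact: leqnn.
    exact: (allP min_t).
  exists t; last by rewrite eh.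
  rewrite mem_filter Qt mem_partitions andTb; apply/and3P; split => //; first exact: path_sorted Ht.
  by apply/eqP; rewrite -sn eh addKn.
rewrite mem_filter mem_partitions => /andP[Qt /and3P[st t0 /eqP sn]] ->.
rewrite /= inE eqxx leqnn ndvd Qt !andTb /=; apply/and3P; split=> //=; last by rewrite sn subnKC.
have le_t : all (geq m.+1) t by apply: sub_all Qt => i /andP[].
by case: t st le_t {Qt t0 sn} => //= i t -> /andP[-> _].
Qed.

End RegularPartitions.

(** * The generating function as a quotient of Euler products *)

Section GeneratingFunction.
Variables (R : fieldType) (l : nat).

Definition regular_gf m : fps R := Fps (fun n => (regular_upto l m n)%:R).

Lemma regular_gfS m : regular_gf m.+1 * (if (l %| m.+1)%N then 1 else 1 - fpsX m.+1) = regular_gf m.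
Proof.
case: ifP => [dvd|/negbT ndvd].
  by rewrite mulr1; apply: fpsP => n; rewrite /= regular_upto_dvd.
apply: fpsP => n; rewrite mulrBr mulr1 mulrC cfB cf_fpsXM /= regular_uptoS //.
by case: ifP => _; rewrite ?addn0 ?subr0 // natrD addrK.
Qed.

Lemma regular_gf_prod m :
  regular_gf m * \prod_(i < m) (if (l %| i.+1)%N then 1 else 1 - fpsX i.+1) = 1.
Proof.
elim: m => [|m IH].
  by rewrite big_ord0 mulr1; apply: fpsP => n; rewrite /= regular_upto0.
by rewrite big_ord_recr /= [X in _ * X]mulrC mulrA regular_gfS.
Qed.

Lemma regular_gf_eta : (0 < l)%N -> Fps (fun n => (b l n)%:R) * eta R 1 = eta R l.
Proof.
move=> l0; apply: eqm_eq => N.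
have le_N : (N <= N * l)%N by rewrite leq_pmulr.
(* Cutting at a multiple of [l] makes the separation of the factors with index divisible by [l]
   exact. *)
have qE : qfact R 1 (N * l) = (\prod_(i < N * l) (if (l %| i.+1)%N then 1 else 1 - fpsX i.+1))
    * qfact R l N.
  elim: (N) => [|k IH]; first by rewrite mul0n /qfact !big_ord0 mulr1.
  rewrite qfactS mulSnr /qfact !big_split_ord /= -/(qfact R 1 (k * l)) IH.
  rewrite -mulrA -[RHS]mulrA; congr (_ * _); rewrite mulrCA; congr (_ * _).
  case: (l) l0 => // l' _; rewrite !big_ord_recr /=.
  have -> : (k * l'.+1 + l').+1 = (l'.+1 * k.+1)%N by lia.
  rewrite mul1n dvdn_mulr // mulr1; congr (_ * _); apply: eq_bigr => i _.
  rewrite -addnS dvdn_addr ?dvdn_mull // gtnNdvd ?mul1n // ltnS; exact: ltn_ord.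
apply: (@eqm_trans _ _ _ (regular_gf (N * l) * qfact R 1 (N * l))).
  apply: eqmM; last by apply: eta_eqm; rewrite // mul1n (leq_trans le_N).
  by move=> n lt_n /=; rewrite regular_upto_total //; lia.
rewrite qE mulrA regular_gf_prod mul1r; apply: eqm_sym; apply: eta_eqm => //.
by rewrite mulnC; nia.
Qed.

End GeneratingFunction.

Lemma frac_numden (D : idomainType) (k : {fraction D}) :
  exists n d : D, d != 0 /\ k * FracField.tofrac d = FracField.tofrac n.
Proof.
elim/quotP: k => x _; exists (\n_x), (\d_x); split; first exact: denom_ratioP.
unlock FracField.tofrac; rewrite -[LHS]FracField.pi_mul.
apply/eqmodP; rewrite /= FracField.equivfE /FracField.mulf !numden_Ratio ?oner_eq0 ?mulr1 ?denom_ratioP //.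
by rewrite mulrC.
Qed.

(** * Dilations and dissections of power series *)

Section Dilation.
Variable R : fieldType.
Implicit Types f g : fps R.

Definition dilate d f : fps R := Fps (fun n => if (d %| n)%N then cf f (n %/ d) else 0).

Lemma dilateM d f g : (0 < d)%N -> dilate d (f * g) = dilate d f * dilate d g.
Proof.
move=> d0; apply: fpsP => n; symmetry.
have e h i : (i <= n)%N -> (trunc h n \Po 'X^d)`_i = cf (dilate d h) i.
  move=> le_i; rewrite coef_comp_poly_Xn //=; case: ifP => // _.
  by rewrite coef_trunc // (leq_trans (leq_div _ _)).
rewrite [LHS](fps_mul_poly (e f) (e g)) -comp_polyM coef_comp_poly_Xn //=.
by case: ifP => // _; rewrite trunc_mul // leq_div.
Qed.

Lemma dilateD d f g : dilate d (f + g) = dilate d f + dilate d g.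
Proof. by apply: fpsP => n; rewrite cfD /=; case: ifP; rewrite ?addr0. Qed.

Lemma dilateN d f : dilate d (- f) = - dilate d f.
Proof. by apply: fpsP => n; rewrite cfN /=; case: ifP; rewrite ?oppr0. Qed.

Lemma dilate_fpsX d k : (0 < d)%N -> dilate d (fpsX k) = fpsX (d * k).
Proof.
move=> d0; apply: fpsP => n /=; case: ifP => [/dvdnP[m ->]|ndvd].
  by rewrite mulnK // mulnC eqn_pmul2l.
by case: eqP => // e; rewrite e dvdn_mulr in ndvd.
Qed.

Lemma dilate1 d : (0 < d)%N -> dilate d 1 = 1.
Proof. by move=> d0; rewrite -[1]fpsX0 dilate_fpsX // muln0. Qed.

Lemma dilateX d f k : (0 < d)%N -> dilate d (f ^+ k) = dilate d f ^+ k.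
Proof. by move=> d0; elim: k => [|k IH]; rewrite ?expr0 ?dilate1 // !exprS dilateM // IH. Qed.

Lemma dilate_inj d : (0 < d)%N -> injective (dilate d).
Proof.
move=> d0 f g e; apply: fpsP => n; have := congr1 (fun h => cf h (n * d)%N) e.
by rewrite /= dvdn_mull // mulnK.
Qed.

Lemma dilate_prod d I (s : seq I) (F : I -> fps R) : (0 < d)%N ->
  dilate d (\prod_(i <- s) F i) = \prod_(i <- s) dilate d (F i).
Proof. by move=> d0; elim/big_rec2: _ => [|i f g _ <-]; rewrite ?dilate1 ?dilateM. Qed.

Lemma dilate_qfact d k m : (0 < d)%N -> dilate d (qfact R k m) = qfact R (d * k) m.
Proof.
move=> d0; rewrite /qfact dilate_prod //; apply: eq_bigr => i _.
by rewrite dilateD dilateN dilate1 // dilate_fpsX // mulnA.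
Qed.

Lemma dilate_eta d k : (0 < d)%N -> (0 < k)%N -> dilate d (eta R k) = eta R (d * k).
Proof.
move=> d0 k0; apply: fpsP => n; case: (boolP (d %| n)%N) => [/dvdnP[m ->]|ndvd].
  rewrite (@eta_eqm R (d * k) m (m * d).+1) ?muln_gt0 ?d0 //; last by nia.
  by rewrite -dilate_qfact //= dvdn_mull // mulnK.
by rewrite [RHS]/= -dilate_qfact //= (negbTE ndvd).
Qed.

Section PrimeField.
Variable l : nat.
Hypotheses (charRl : l \in [pchar R]) (frobR : forall a : R, a ^+ l = a).

Let l_gt0 : (0 < l)%N. Proof. exact: prime_gt0 (pcharf_prime charRl). Qed.

Lemma expr_dilate f : f ^+ l = dilate l f.
Proof. by apply: fpsP => n; rewrite cf_frob //=; case: ifP; rewrite ?frobR. Qed.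

Lemma eta_expr k : (0 < k)%N -> eta R k ^+ l = eta R (l * k).
Proof. by move=> k0; rewrite expr_dilate dilate_eta. Qed.

Definition dissect i f : fps R := Fps (fun n => cf f (n * l + i)%N).

Lemma dissectD i f g : dissect i (f + g) = dissect i f + dissect i g.
Proof. by apply: fpsP. Qed.

Lemma dissect_fpsX i k : (i < l)%N -> (k < l)%N -> dissect i (fpsX k) = (i == k)%:R.
Proof.
move=> lt_i lt_k; apply: fpsP => n; rewrite /= (_ : (n * l + i == k)%N = (n == 0%N) && (i == k)).
  by case: (i == k); rewrite ?cf1 ?cf0 ?andbT ?andbF.
case: n => [|n]; rewrite ?mul0n //= mulSn gtn_eqF // -addnA.
by apply: leq_trans lt_k _; apply: leq_addr.
Qed.

(** Over the prime field $g^l$ is $g$ with $X^l$ for $X$, so multiplying by it preserves residues of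
    indices mod $l$. *)
Lemma dissect_exprM i f g : (i < l)%N -> dissect i (f * g ^+ l) = dissect i f * g.
Proof.
move=> lt_i; rewrite mulrC [RHS]mulrC expr_dilate; apply: fpsP => n; rewrite /dissect [LHS]/= [RHS]/=.
rewrite -(big_mkord xpredT (fun c => cf (dilate l g) c * cf f (n * l + i - c)%N)).
rewrite -(big_mkord xpredT (fun c => cf g c * cf f ((n - c) * l + i)%N)).
apply: (eq_sum_bij (h := fun c => (c %/ l)%N) (g := fun c => (c * l)%N));
  rewrite ?iota_uniq // => c; rewrite !mem_index_iota /= !ltnS => le_c.
  case: ifP => [/dvdnP[m em]|]; last by rewrite mul0r eqxx.
  move: le_c; rewrite em mulnK // => le_m _; have le_mn : (m <= n)%N by nia.
  rewrite le_mn; split=> //; congr (_ * cf f _).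
  by rewrite mulnBl -addnBAC // leq_mul2r le_mn orbT.
move=> _; rewrite mulnK // dvdn_mull //; split=> //; first by nia.
by congr (_ * cf f _); rewrite mulnBl -addnBAC // leq_mul2r le_c orbT.
Qed.

Lemma dissect0_expr f : (forall i, (0 < i < l)%N -> dissect i f = 0) -> f = dissect 0 f ^+ l.
Proof.
move=> f0; apply: fpsP => n; rewrite expr_dilate [RHS]/=.
case: ifP => [dv|/negbT ndvd]; first by rewrite addn0 divnK.
have i_lt : (0 < n %% l < l)%N by rewrite lt0n -/(dvdn l n) ndvd ltn_mod.
have := congr1 (fun h => cf h (n %/ l)) (f0 _ i_lt).
by rewrite /= -divn_eq.
Qed.

(* An element of the field of fractions that is an [l]-th power is the [l]-th power
   of a series if it is a series. *)
Lemma frac_expr f (k : {fraction (fps R)}) : FracField.tofrac f = k ^+ l ->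
  exists g, f = g ^+ l.
Proof.
have [n [d [d0 kd]]] := frac_numden k => fk; exists (dissect 0 f).
have e : f * d ^+ l = n ^+ l.
  by apply/eqP; rewrite -tofrac_eq tofracM !tofracXn fk -kd exprMn.
apply: dissect0_expr => i /andP[i0 il]; apply: (mulIf d0); rewrite -dissect_exprM // e mul0r.
by rewrite -[n ^+ l]mul1r dissect_exprM // -(fpsX0 R) dissect_fpsX // gtn_eqF // mul0r.
Qed.

End PrimeField.
End Dilation.

(** * Weierstrass relations between the theta series *)

Section ThetaRelations.
Variable R : fieldType.
Local Notation E := (theta1 R).
Local Notation p := (theta3_2 R).
Local Notation r := (theta2_2 R).

Lemma theta1_opp a : E (- a) = - E a.
Proof.
apply: fpsP => n; rewrite cfN /=.
have -> : - (\sum_(k <- zrange n) if 1%:Z * k ^+ 2 == n%:Z then at13 (oddchi R) a k else 0) =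
  \sum_(k <- zrange n) if 1%:Z * k ^+ 2 == n%:Z then - at13 (oddchi R) a k else 0.
  by rewrite -sumrN; apply: eq_bigr => k _; case: ifP; rewrite ?oppr0.
have e k : at13 (oddchi R) (- a) (- k) = - at13 (oddchi R) a k.
  rewrite /at13 (_ : cong13 (- a) (- k) = cong13 a k); last by rewrite /cong13; lia.
  case: ifP => _; rewrite ?oppr0 //.
  rewrite -[- k]add0r (per4B 0 k (oddchi_per4 R)) [in RHS]oddchi_per4.
  by case: (mod4_case k) => ->; rewrite /oddchi /= ?oppr0 ?opprK.
apply: (@eq_sum_bij _ _ _ _ _ _ _ -%R -%R); rewrite ?zrange_uniq // => k;
  rewrite !mem_zrange abszN opprK sqrrN => ->.
  by case: ifP => _ _; split=> //; rewrite -{2}[k]opprK e ?opprK.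
by case: ifP => _ _; split=> //; rewrite e.
Qed.

Lemma theta1_add13 a : E (a + 13) = E a.
Proof.
apply: eq_theta => k; rewrite /at13.
by rewrite (_ : cong13 (a + 13) k = cong13 a k) //; rewrite /cong13; lia.
Qed.

Lemma theta1_sub13 a : E (13 - a) = - E a.
Proof. by rewrite addrC theta1_add13 theta1_opp. Qed.

Lemma theta1_0 : E 0 = 0.
Proof.
by have := theta1_mul R 0 0; rewrite addr0 ?subr0 [r 0 * _]mulrC subrr => /eqP;
  rewrite mulf_eq0 orbb => /eqP.
Qed.

Definition theta1_pair a b := E (a + b) * E (a - b).

(** By [theta1_mul] each pair is a 2 by 2 minor of the matrix with rows [theta2_2] and [theta3_2],
    so this is the Plücker relation. *)
Lemma theta1_plucker a b c d : theta1_pair a b * theta1_pair c d -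
  theta1_pair a c * theta1_pair b d + theta1_pair a d * theta1_pair b c = 0.
Proof. by rewrite /theta1_pair !theta1_mul; ring. Qed.

Lemma theta1_7 : E 7 = - E 6. Proof. exact: (theta1_sub13 6). Qed.
Lemma theta1_8 : E 8 = - E 5. Proof. exact: (theta1_sub13 5). Qed.
Lemma theta1_9 : E 9 = - E 4. Proof. exact: (theta1_sub13 4). Qed.
Lemma theta1_10 : E 10 = - E 3. Proof. exact: (theta1_sub13 3). Qed.

Lemma theta1_W32 : E 5 * E 1 ^+ 3 = E 4 * E 2 ^+ 3 - E 1 * E 3 ^+ 3.
Proof.
have := theta1_plucker 3 2 1 0; rewrite /theta1_pair ?addr0 ?subr0 => e.
apply/eqP; rewrite -subr_eq0; apply/eqP; rewrite -[RHS]e.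
by rewrite -[E (3 + 2)]/(E 5) -[E (3 - 2)]/(E 1) -[E (3 + 1)]/(E 4) -[E (3 - 1)]/(E 2)
   -[E (2 + 1)]/(E 3) -[E (2 - 1)]/(E 1); ring.
Qed.

Lemma theta1_W42 : E 6 * E 2 * E 1 ^+ 2 = E 5 * E 3 * E 2 ^+ 2 - E 3 * E 1 * E 4 ^+ 2.
Proof.
have := theta1_plucker 4 2 1 0; rewrite /theta1_pair ?addr0 ?subr0 => e.
apply/eqP; rewrite -subr_eq0; apply/eqP; rewrite -[RHS]e.
by rewrite -[E (4 + 2)]/(E 6) -[E (4 - 2)]/(E 2) -[E (4 + 1)]/(E 5) -[E (4 - 1)]/(E 3)
   -[E (2 + 1)]/(E 3) -[E (2 - 1)]/(E 1); ring.
Qed.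

Lemma theta1_W52 : - (E 6 * E 3 * E 1 ^+ 2) = E 6 * E 4 * E 2 ^+ 2 - E 3 * E 1 * E 5 ^+ 2.
Proof.
have := theta1_plucker 5 2 1 0; rewrite /theta1_pair ?addr0 ?subr0 => e.
apply/eqP; rewrite -subr_eq0; apply/eqP; rewrite -[RHS]e.
by rewrite -[E (5 + 2)]/(E 7) -[E (5 - 2)]/(E 3) -[E (5 + 1)]/(E 6) -[E (5 - 1)]/(E 4)
   -[E (2 + 1)]/(E 3) -[E (2 - 1)]/(E 1) theta1_7; ring.
Qed.

Lemma theta1_W3426 : E 4 * E 6 * E 1 * E 5 + E 4 * E 6 * E 2 * E 3 = E 1 * E 5 * E 2 * E 3.
Proof.
have := theta1_plucker 3 4 2 6; rewrite /theta1_pair => e.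
apply/eqP; rewrite -subr_eq0; apply/eqP; rewrite -[RHS]e.
rewrite -[E (3 + 4)]/(E 7) -[E (3 - 4)]/(E (- 1)) -[E (2 + 6)]/(E 8) -[E (2 - 6)]/(E (- 4))
   -[E (3 + 2)]/(E 5) -[E (3 - 2)]/(E 1) -[E (4 + 6)]/(E 10) -[E (4 - 6)]/(E (- 2))
   -[E (3 + 6)]/(E 9) -[E (3 - 6)]/(E (- 3)) -[E (4 + 2)]/(E 6) -[E (4 - 2)]/(E 2).
by rewrite !theta1_opp theta1_7 theta1_8 theta1_9 theta1_10; ring.
Qed.

Local Notation e1 := (eta R 104).
Local Notation e13 := (eta R 1352).

Lemma theta1_prod : E 1 * E 2 * E 3 * E 4 * E 5 * E 6 = - (fpsX 286 * (e1 * e13 ^+ 5)).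
Proof. by rewrite (theta1_prod_eq R (erefl 104%N)). Qed.

Lemma theta1_neq0 : [/\ E 1 != 0, E 2 != 0, E 3 != 0, E 4 != 0 & E 5 != 0] /\ E 6 != 0.
Proof.
have : E 1 * E 2 * E 3 * E 4 * E 5 * E 6 != 0.
  by rewrite theta1_prod oppr_eq0 !mulf_neq0 ?fpsX_neq0 ?expf_neq0 ?eta_neq0.
by rewrite !mulf_eq0 !negb_or => /andP[/andP[/andP[/andP[/andP[-> ->] ->] ->] ->] ->].
Qed.

End ThetaRelations.

(** * The relation between the two eta products modulo 2 *)

Lemma pchar_natr0 (R : nzSemiRingType) l : l \in [pchar R] -> l%:R = 0 :> R.
Proof. by move=> /pcharf0. Qed.

Lemma eta_relation_char2_field (K : fieldType) (x y z a b t P Y : K) :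
  x != 0 -> y != 0 -> z != 0 -> a != 0 -> b != 0 ->
  z ^+ 4 = x ^+ 2 * y -> z ^+ 6 = x * y ^+ 7 -> t * a ^+ 2 = y * b ^+ 2 ->
  P = x * (a * b ^+ 5) -> Y = z * b ^+ 3 ->
  P = Y ^+ 6 * ((P ^+ 2 / Y ^+ 4) ^+ 3 + 1) ^+ 2 * (P ^+ 2 / Y ^+ 4 + 1) ->
  b = a ^+ 13 * (1 + t ^+ 3) ^+ 2 * (1 + t).
Proof.
move=> x0 y0 z0 a0 b0 z4 z6 et -> ->.
have yE : y = t * a ^+ 2 / b ^+ 2 by rewrite et mulfK // expf_neq0.
have t0 : t != 0 by apply: contraNneq y0 => t0; rewrite yE t0 !mul0r.
have hE : (x * (a * b ^+ 5)) ^+ 2 / (z * b ^+ 3) ^+ 4 = t^-1.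
  rewrite [(z * b ^+ 3) ^+ 4]exprMn z4 yE; field.
  by rewrite t0 a0 b0 x0.
rewrite hE [(z * b ^+ 3) ^+ 6]exprMn z6 yE => e.
have xab0 : x * a * b ^+ 4 != 0 by rewrite !mulf_neq0 ?expf_neq0.
apply: (mulfI xab0); transitivity (x * (a * b ^+ 5)); first by ring.
rewrite e; field.
by rewrite t0 b0.
Qed.

Section Char2Relation.
Variable R : fieldType.
Hypotheses (charR : 2 \in [pchar R]) (frobR : forall a : R, a ^+ 2 = a).
Local Notation F := (@FracField.tofrac (fps R)).
Local Notation E a := (F (theta1 R a)).
Local Notation e1 := (eta R 104).
Local Notation e13 := (eta R 1352).

(** In [psi_eta] the factor with doubled index is a square modulo 2; the result is Jacobi's series
    for the cube of the Euler product, reduced modulo 2. *)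
Lemma Psi_char2 : Psi R = fpsX 169 * e13 ^+ 3.
Proof.
have := psi_eta R (erefl 1352%N).
rewrite (_ : eta R (1352 + 1352) = e13 ^+ 2); last first.
  by rewrite (eta_expr charR frobR) // mul2n addnn.
rewrite -exprM -[(2 * 2)%N]/(3.+1) exprSr mulrA.
by apply: mulIf; apply: eta_neq0.
Qed.

Lemma eta_relation_char2 (t : fps R) : t * e1 ^+ 2 = fpsX 104 * e13 ^+ 2 ->
  e13 = e1 ^+ 13 * (1 + t ^+ 3) ^+ 2 * (1 + t).
Proof.
move=> et.
have two0 : 2 = 0 :> {fraction (fps R)}.
  by rewrite -[2](rmorph_nat F) (pchar_natr0 (pchar_fps charR)) rmorph0.
have nz (f : fps R) : f != 0 -> F f != 0 by rewrite tofrac_eq0.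
have [[n1 n2 n3 n4 n5] n6] := theta1_neq0 R.
have Psi0 : Psi R != 0 by rewrite Psi_char2 mulf_neq0 ?fpsX_neq0 ?expf_neq0 ?eta_neq0.
have := @theta13_char2 _ (E 1) (E 2) (E 3) (E 4) (E 5) (E 6) (nz _ n1) (nz _ n2) (nz _ n3)
  (nz _ n4) (nz _ n5) (nz _ n6).
have W (a b : fps R) : a = b -> F a = F b by move->.
have := W _ _ (theta1_W32 R); rewrite !(rmorphM, rmorphB, rmorphXn) /= => w1 /(_ w1) {w1}.
have := W _ _ (theta1_W42 R); rewrite !(rmorphM, rmorphB, rmorphXn) /= => w1 /(_ w1) {w1}.
have := W _ _ (theta1_W52 R); rewrite !(rmorphM, rmorphB, rmorphN, rmorphXn) /= => w1 /(_ w1) {w1}.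
have := W _ _ (theta1_W3426 R); rewrite !(rmorphM, rmorphD, rmorphXn) /= => w1 /(_ w1) {w1}.
move=> /(_ (F (Psi R)) (F (theta3_2 R 1)) (F (theta3_2 R 2)) two0 (nz _ Psi0)).
have := W _ _ (theta1_double_char2 charR 1); rewrite !(rmorphM, rmorphXn) /= => w1 /(_ w1) {w1}.
have := W _ _ (theta1_double_char2 charR 2); rewrite !(rmorphM, rmorphXn) /= => w1 /(_ w1) {w1}.
have := W _ _ (theta1_mul_char2 charR 2 1); rewrite !(rmorphM, rmorphD, rmorphXn) /= => w1 /(_ w1) {w1}.
have := W _ _ (theta3_2_double_char2 charR 1); rewrite !(rmorphM, rmorphD, rmorphXn) /= => w1 /(_ w1) {w1}.
set P := E 1 * _ * _ * _ * _ * _ => e.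
have PE : P = F (fpsX 286) * (F e1 * F e13 ^+ 5).
  have -> : P = F (fpsX 286 * (e1 * e13 ^+ 5)).
    by rewrite -(oppr_pchar2 (pchar_fps charR) (_ * _)) -theta1_prod /P !rmorphM.
  by rewrite !(rmorphXn, rmorphM).
have X0 k : F (fpsX k) != 0 by rewrite tofrac_eq0 fpsX_neq0.
have a0 : F e1 != 0 by rewrite tofrac_eq0 eta_neq0.
have b0 : F e13 != 0 by rewrite tofrac_eq0 eta_neq0.
apply/eqP; rewrite -tofrac_eq; apply/eqP.
rewrite !(rmorphXn, rmorphM, rmorphD, rmorph1) /=.
apply: (eta_relation_char2_field (X0 286%N) (X0 104%N) (X0 169%N) a0 b0 _ _ _ PE _ e).
- by rewrite -!rmorphXn -rmorphM !fpsXX -fpsXD.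
- by rewrite -!rmorphXn -rmorphM !fpsXX -fpsXD.
- by have := W _ _ et; rewrite !(rmorphXn, rmorphM).
- by rewrite Psi_char2 rmorphM rmorphXn.
Qed.

End Char2Relation.

(** * The relation between the two eta products modulo 3 *)

Lemma eta_relation_char3_field (K : fieldType) (x w u a b k P Y : K) :
  x != 0 -> w != 0 -> a != 0 -> b != 0 -> Y != 0 ->
  Y = x * w * b ^+ 6 -> w * w * x = u ^+ 3 ->
  P = - (x * (a * b ^+ 5)) -> P / Y + Y / P = Y * k ^+ 3 ->
  (a ^+ 2 + w ^+ 2 * b ^+ 2) * (a * b) ^+ 2 = (- (u * b ^+ 3 * a * k)) ^+ 3.
Proof.
move=> x0 w0 a0 b0 Y0 YE uE ->; rewrite invrN mulrN mulNr => e.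
have -> : (- (u * b ^+ 3 * a * k)) ^+ 3 = - (u ^+ 3 * b ^+ 9 * a ^+ 3) * k ^+ 3 by ring.
have -> : k ^+ 3 = (- (x * (a * b ^+ 5) / Y) - Y / (x * (a * b ^+ 5))) / Y.
  by rewrite e mulrC mulKf.
rewrite -uE YE; field.
by rewrite x0 w0 a0 b0.
Qed.

Section Char3Relation.
Variable R : fieldType.
Hypotheses (charR : 3 \in [pchar R]) (frobR : forall a : R, a ^+ 3 = a).
Local Notation F := (@FracField.tofrac (fps R)).
Local Notation E a := (F (theta1 R a)).
Local Notation e1 := (eta R 104).
Local Notation e13 := (eta R 1352).
Local Notation phi := (theta_class 2 (evenchi R) 0).

Let three0 : 3 = 0 :> fps R.
Proof. exact: pchar_natr0 (pchar_fps charR). Qed.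

Let two_neq0 : 2 != 0 :> R.
Proof.
apply/eqP => two0; have /eqP[] := oner_neq0 R.
have e : (1 : R) = 3%:R - 2%:R by ring.
by rewrite e two0 (pchar_natr0 charR) subr0.
Qed.

(** Half the product of the three null values [theta2 0], [theta3 0], [theta4 0]: the constant of
    the classical duplication formula. *)
Definition Y3 := Psi R * phi ^+ 2.

Lemma Y3E : Y3 = fpsX 169 * e13 ^+ 3.
Proof.
have ePsi := psi_eta R (erefl 1352%N); have ephi := phi_eta R (erefl 1352%N).
set g := eta R (1352 + 1352) in ePsi ephi.
have g0 : g != 0 by apply: eta_neq0.
apply: (mulIf (mulf_neq0 (eta_neq0 R 1352) (expf_neq0 2 g0))).
transitivity ((Psi R * e13) * (phi * g) ^+ 2); first by rewrite /Y3; ring.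
by rewrite ePsi ephi; ring.
Qed.

Lemma theta1_double_T a : Y3 * theta1 R (a + a) = theta1 R a * theta2 R a * theta3 R a * theta4 R a.
Proof.
rewrite theta1_theta2 // -mulrA theta3_theta4 //.
transitivity ((theta1 R (a + a) * Psi R) * phi ^+ 2); first by rewrite /Y3; ring.
by rewrite theta1_double; ring.
Qed.

Lemma theta_sq_prod : theta2 R 0 ^+ 2 * theta3 R 0 ^+ 2 * theta4 R 0 ^+ 2 = Y3 ^+ 2.
Proof.
rewrite -mulrA -exprMn theta3_theta4 // theta2_0 /Y3.
transitivity ((Psi R * phi ^+ 2) ^+ 2 + 3 * (Psi R * phi ^+ 2) ^+ 2); first by ring.
by rewrite three0 mul0r addr0.
Qed.

Let C2 := theta2 R 0 ^+ 2.
Let C3 := theta3 R 0 ^+ 2.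
Let C4 := theta4 R 0 ^+ 2.
Let A2 := theta2 R 1 ^+ 2.
Let A3 := theta3 R 1 ^+ 2.
Let A4 := theta4 R 1 ^+ 2.
Let Esq a : theta1 R a ^+ 2 = theta2_2 R a * theta3_2 R 0 - theta3_2 R a * theta2_2 R 0.
Proof. by rewrite -theta1_mul ?addr0 ?subr0 expr2. Qed.

(** The addition formula expresses each $\theta_i(a)^2\,\theta_1(1)^2$, $i = 2, 3, 4$, through
    values at 0 and 1; this is inserted in the square of [theta1_double_T]. *)
Lemma double_value a : Y3 ^+ 2 * theta1 R (a + a) ^+ 2 * theta1 R 1 ^+ 6 = theta1 R a ^+ 2 *
  ((theta1 R a ^+ 2 * A2 - C2 * (theta1 R (a + 1) * theta1 R (a - 1))) *
   (theta1 R a ^+ 2 * A3 - C3 * (theta1 R (a + 1) * theta1 R (a - 1))) *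
   (theta1 R a ^+ 2 * A4 - C4 * (theta1 R (a + 1) * theta1 R (a - 1)))).
Proof.
have t2 : theta2 R a ^+ 2 * theta1 R 1 ^+ 2 =
    theta1 R a ^+ 2 * A2 - C2 * (theta1 R (a + 1) * theta1 R (a - 1)).
  by rewrite (theta1_mul R a 1) !Esq /A2 /C2 !theta2_sq; ring.
have t3 : theta3 R a ^+ 2 * theta1 R 1 ^+ 2 =
    theta1 R a ^+ 2 * A3 - C3 * (theta1 R (a + 1) * theta1 R (a - 1)).
  by rewrite (theta1_mul R a 1) !Esq /A3 /C3 !theta3_sq; ring.
have t4 : theta4 R a ^+ 2 * theta1 R 1 ^+ 2 =
    theta1 R a ^+ 2 * A4 - C4 * (theta1 R (a + 1) * theta1 R (a - 1)).
  by rewrite (theta1_mul R a 1) !Esq /A4 /C4 !theta4_sq; ring.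
by rewrite -t2 -t3 -t4 -[Y3 ^+ 2 * _]exprMn theta1_double_T; ring.
Qed.

Lemma A_C_23 : A2 * C3 - A3 * C2 = C4 * theta1 R 1 ^+ 2.
Proof. by rewrite Esq /A2 /A3 /C2 /C3 /C4 !theta2_sq !theta3_sq !theta4_sq; ring. Qed.
Lemma A_C_24 : A2 * C4 - A4 * C2 = C3 * theta1 R 1 ^+ 2.
Proof. by rewrite Esq /A2 /A4 /C2 /C3 /C4 !theta2_sq !theta3_sq !theta4_sq; ring. Qed.
Lemma A_C_34 : A3 * C4 - A4 * C3 = C2 * theta1 R 1 ^+ 2.
Proof. by rewrite Esq /A3 /A4 /C2 /C3 /C4 !theta2_sq !theta3_sq !theta4_sq; ring. Qed.

Lemma eta_relation_char3 : exists h : fps R,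
  (e1 ^+ 2 + fpsX 104 * e13 ^+ 2) * (e1 * e13) ^+ 2 = h ^+ 3.
Proof.
have three0F : 3 = 0 :> {fraction (fps R)}.
  by rewrite -[3](rmorph_nat F) (pchar_natr0 (pchar_fps charR)) rmorph0.
have nz (f : fps R) : f != 0 -> F f != 0 by rewrite tofrac_eq0.
have [[n1 n2 n3 n4 n5] n6] := theta1_neq0 R.
have [y [Y0 YE TS DV]] : exists y : fps R, [/\ y != 0, y = fpsX 169 * e13 ^+ 3,
    C2 * C3 * C4 = y ^+ 2 & forall a, y ^+ 2 * theta1 R (a + a) ^+ 2 * theta1 R 1 ^+ 6 =
      theta1 R a ^+ 2 *
      ((theta1 R a ^+ 2 * A2 - C2 * (theta1 R (a + 1) * theta1 R (a - 1))) *
       (theta1 R a ^+ 2 * A3 - C3 * (theta1 R (a + 1) * theta1 R (a - 1))) *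
       (theta1 R a ^+ 2 * A4 - C4 * (theta1 R (a + 1) * theta1 R (a - 1))))].
  exists Y3; split; [|exact: Y3E|exact: theta_sq_prod|exact: double_value].
  by rewrite Y3E mulf_neq0 ?fpsX_neq0 ?expf_neq0 ?eta_neq0.
have := @theta13_char3 _ (E 1) (E 2) (E 3) (E 4) (E 5) (E 6) (nz _ n1) (nz _ n2) (nz _ n3)
  (nz _ n4) (nz _ n5) (nz _ n6).
have W (a b : fps R) : a = b -> F a = F b by move->.
have := W _ _ (theta1_W32 R); rewrite !(rmorphXn, rmorphM, rmorphB) /= => w1 /(_ w1) {w1}.
have := W _ _ (theta1_W42 R); rewrite !(rmorphXn, rmorphM, rmorphB) /= => w1 /(_ w1) {w1}.
have := W _ _ (theta1_W52 R); rewrite !(rmorphXn, rmorphM, rmorphB, rmorphN) /= => w1 /(_ w1) {w1}.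
have := W _ _ (theta1_W3426 R); rewrite !(rmorphXn, rmorphM, rmorphD) /= => w1 /(_ w1) {w1}.
move=> /(_ (F y ^+ 2) (F A2) (F A3) (F A4) (F C2) (F C3) (F C4) three0F).
move=> /(_ (expf_neq0 2 (nz _ Y0))).
have := W _ _ TS; rewrite !(rmorphXn, rmorphM) /= => w1 /(_ w1) {w1}.
(* At $a = 1$ the factor [theta1 0] vanishes, and the sixth power cancels. *)
have e1v : y ^+ 2 * theta1 R 2 ^+ 2 = theta1 R 1 ^+ 2 * (A2 * A3 * A4).
  apply: (mulIf (expf_neq0 6 n1)); have := DV 1; rewrite -[theta1 R (1 + 1)]/(theta1 R 2).
  by rewrite -[theta1 R (1 - 1)]/(theta1 R 0) theta1_0 => ->; ring.
have := W _ _ e1v; rewrite !(rmorphXn, rmorphM) /= => w1 /(_ w1) {w1}.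
have := W _ _ (DV 2); rewrite !(rmorphXn, rmorphM, rmorphB) /= => w1 /(_ w1) {w1}.
have e3v := DV 3; rewrite -[theta1 R (3 + 3)]/(theta1 R 6) in e3v.
have := W _ _ e3v; rewrite !(rmorphXn, rmorphM, rmorphB) /= => w1 /(_ w1) {w1}.
have := W _ _ A_C_23; rewrite !(rmorphXn, rmorphM, rmorphB) /= => w1 /(_ w1) {w1}.
have := W _ _ A_C_24; rewrite !(rmorphXn, rmorphM, rmorphB) /= => w1 /(_ w1) {w1}.
have := W _ _ A_C_34; rewrite !(rmorphXn, rmorphM, rmorphB) /= => w1 /(_ w1) {w1}.
set P := E 1 * _ * _ * _ * _ * _ => -[k e].
have PE : P = - (F (fpsX 286) * (F e1 * F e13 ^+ 5)).
  have -> : P = F (- (fpsX 286 * (e1 * e13 ^+ 5))) by rewrite -theta1_prod /P !rmorphM.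
  by rewrite !(rmorphXn, rmorphM, rmorphN).
have X0 k' : F (fpsX k') != 0 by rewrite tofrac_eq0 fpsX_neq0.
have a0 : F e1 != 0 by rewrite tofrac_eq0 eta_neq0.
have b0 : F e13 != 0 by rewrite tofrac_eq0 eta_neq0.
(* The power $z^{130}$ arises as a cube root: $52 + 52 + 286 = 3 \cdot 130$, where $z^{52}$ is the
   square root of $q$. *)
apply: (frac_expr charR frobR (k := - (F (fpsX 130) * F e13 ^+ 3 * F e1 * k))).
rewrite -(eta_relation_char3_field (X0 286%N) (X0 52%N) a0 b0 (expf_neq0 2 (nz _ Y0)) _ _ PE e).
- rewrite !(rmorphXn, rmorphM, rmorphD) /=; congr ((_ + _ * _) * _).
  by rewrite -rmorphXn fpsXX.
- by rewrite YE -!rmorphXn -!rmorphM -fpsXD exprMn fpsXX -exprM.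
- by rewrite -!rmorphXn -!rmorphM -!fpsXD fpsXX.
Qed.

End Char3Relation.

(** * Dissections of the generating function *)

Section CubeDissection.
Variables (K : idomainType) (x r f d a g c a' : K).
Hypothesis three0 : 3 = 0 :> K.

Lemma cubeD (y z : K) : (y + z) ^+ 3 = y ^+ 3 + z ^+ 3.
Proof.
transitivity (y ^+ 3 + z ^+ 3 + 3 * (y * z * (y + z))); first by ring.
by rewrite three0 mul0r addr0.
Qed.

Hypotheses (rf : r ^+ 3 * f = 1 + x * f ^+ 2) (d0 : r ^+ 6 - x != 0).
Hypothesis ad : a * (r ^+ 6 - x) = r ^+ 5 + f * r ^+ 2 * x.
Hypothesis gd : g * (r ^+ 6 - x) = r ^+ 3 + x * f.
Hypothesis cd : c * (r ^+ 6 - x) = r + f * r ^+ 4.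
Hypothesis a'd : a' * (r ^+ 6 - x) = r ^+ 5 + x * c * r ^+ 4 + x * r ^+ 2 * g + x * a.

Let d3 : (r ^+ 6 - x) ^+ 3 = r ^+ 18 - x ^+ 3.
Proof. by rewrite cubeD; ring. Qed.

Let a3 : a ^+ 3 * (r ^+ 18 - x ^+ 3) = r ^+ 15 + f ^+ 3 * r ^+ 6 * x ^+ 3.
Proof. by rewrite -d3 -exprMn ad cubeD; ring. Qed.

Let g3 : g ^+ 3 * (r ^+ 18 - x ^+ 3) = r ^+ 9 + f ^+ 3 * x ^+ 3.
Proof. by rewrite -d3 -exprMn gd cubeD; ring. Qed.

Let c3 : c ^+ 3 * (r ^+ 18 - x ^+ 3) = r ^+ 3 + f ^+ 3 * r ^+ 12.
Proof. by rewrite -d3 -exprMn cd cubeD; ring. Qed.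

(** The relation [rf] yields $f(r^6 - x) = r^3 + x^2f^3$. Multiplying by $r^{12} + xr^6 + x^2$ turns
    the denominator into the cube $r^{18} - x^3$, and sorting the numerator by powers of $x$ mod 3
    leaves a cube in each class. *)
Lemma cube_dissection : f = a ^+ 3 + x * g ^+ 3 + x ^+ 2 * c ^+ 3.
Proof.
apply: (mulIf (expf_neq0 3 d0)); rewrite d3.
have fd : f * (r ^+ 6 - x) = r ^+ 3 + x ^+ 2 * f ^+ 3.
  transitivity (r ^+ 3 * (r ^+ 3 * f) - x * f); first by ring.
  rewrite rf; transitivity (r ^+ 3 + x * f * (r ^+ 3 * f) - x * f); first by ring.
  by rewrite rf; ring.
transitivity (f * (r ^+ 6 - x) * (r ^+ 12 + x * r ^+ 6 + x ^+ 2)); first by ring.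
rewrite fd; transitivity (a ^+ 3 * (r ^+ 18 - x ^+ 3) + x * (g ^+ 3 * (r ^+ 18 - x ^+ 3))
  + x ^+ 2 * (c ^+ 3 * (r ^+ 18 - x ^+ 3))); last by ring.
by rewrite a3 g3 c3; ring.
Qed.

(** The same denominator is cleared in the definition of $g$, and $f$ is replaced by its dissection.
    The class of $x^2$ cancels and that of $x$ gives $-g^3$. *)
Lemma cube_dissection_snd : g = a' ^+ 3 + x * (- g) ^+ 3.
Proof.
have a'3 : a' ^+ 3 * (r ^+ 6 - x) ^+ 3 =
    r ^+ 15 + x ^+ 3 * c ^+ 3 * r ^+ 12 + x ^+ 3 * r ^+ 6 * g ^+ 3 + x ^+ 3 * a ^+ 3.
  by rewrite -exprMn a'd !cubeD; ring.
apply: (mulIf (expf_neq0 3 d0)); rewrite mulrDl a'3.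
apply/eqP; rewrite -subr_eq0 d3.
have -> : g * (r ^+ 18 - x ^+ 3) = (r ^+ 3 + x * f) * (r ^+ 12 + x * r ^+ 6 + x ^+ 2).
  by rewrite -gd; ring.
rewrite [Z in r ^+ 3 + _ * Z]cube_dissection; apply/eqP.
apply: (mulIf (expf_neq0 3 d0)); rewrite d3 mul0r.
transitivity (x * ((r ^+ 12 + x * r ^+ 6) * (a ^+ 3 * (r ^+ 18 - x ^+ 3))
    + (x * r ^+ 12 + r ^+ 18) * (g ^+ 3 * (r ^+ 18 - x ^+ 3))
    + (x ^+ 3 * r ^+ 6 + x ^+ 4) * (c ^+ 3 * (r ^+ 18 - x ^+ 3))
    + (r ^+ 9 + x * r ^+ 3) * (r ^+ 18 - x ^+ 3))); first by ring.
rewrite a3 g3 c3.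
transitivity (3 * (x * (r ^+ 27 + x * r ^+ 21 + f ^+ 3 * x ^+ 3 * r ^+ 18 + f ^+ 3 * x ^+ 4 * r ^+ 12))).
  by ring.
by rewrite three0 mul0r.
Qed.

End CubeDissection.

(** * Vanishing modulo 3 *)

Section RegularChar3.
Variable R : fieldType.
Hypotheses (charR : 3 \in [pchar R]) (frobR : forall a : R, a ^+ 3 = a).
Let f : fps R := Fps (fun n => (b 13 n)%:R).
Local Notation X := (fpsX 1 : fps R).

Let three0 : 3 = 0 :> fps R.
Proof. exact: pchar_natr0 (pchar_fps charR). Qed.

Let cf_f0 : cf f 0 = 1. Proof. by []. Qed.

(** Multiplied by $(f_1f_{13})^3$, the series $f^{-1} + Xf$ becomes the left-hand side of
    [eta_relation_char3], up to the dilation by 104. *)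
Lemma regular13_cube_root : exists r : fps R, r ^+ 3 * f = 1 + X * f ^+ 2.
Proof.
have f_unit : f \is a GRing.unit by rewrite fps_unitE cf_f0 oner_eq0.
pose s := f^-1 + X * f.
have sf : s * f = 1 + X * f ^+ 2 by rewrite mulrDl mulVr // -mulrA.
have se : s * (eta R 1 * eta R 13) = eta R 1 ^+ 2 + X * eta R 13 ^+ 2.
  rewrite -(regular_gf_eta R (isT : (0 < 13)%N)) -/f.
  transitivity (s * f * eta R 1 ^+ 2); first by ring.
  by rewrite sf; ring.
have [h eh] := eta_relation_char3 charR frobR.
have [] := @frac_expr _ _ charR frobR (dilate 104 s)
   (FracField.tofrac h / FracField.tofrac (eta R 104 * eta R 1352)).
  rewrite exprMn exprVn -!rmorphXn /= -eh.
  have /(congr1 (dilate 104)) := se.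
  rewrite !(dilateM, dilateD, dilateX, dilate_eta, dilate_fpsX) //= => <-.
  rewrite -mulrA -exprS rmorphM mulfK // tofrac_eq0 expf_neq0 // mulf_neq0 //; exact: eta_neq0.
move=> g; rewrite (expr_dilate charR frobR) => eg; exists (dissect 3 0 s); rewrite -sf; congr (_ * _); apply/esym.
apply: (dissect0_expr charR frobR) => i i3; apply: fpsP => n /=.
have := congr1 (fun u => cf u (104 * (n * 3 + i))) eg.
rewrite [LHS]/= [RHS]/= mulKn // dvdn_mulr // => ->.
(* Since 3 does not divide 104, an index prime to 3 remains so after the dilation, hence the series
   in $q$ is itself a cube. *)
by rewrite Euclid_dvdM //= dvdn_addr ?dvdn_mull // gtnNdvd //; case/andP: i3.
Qed.

Lemma regular13_dissection : exists g : fps R, [/\ dissect 3 1 f = g, dissect 3 2 g = 0 & dissect 3 1 g = - g].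
Proof.
have [r rf] := regular13_cube_root.
pose D := r ^+ 6 - X.
have r0 : cf r 0 = 1.
  have := congr1 (fun u => cf u 0%N) rf.
  by rewrite cfM0 cfX0 cfD cf_fpsXM cf_f0 /= mulr1 frobR addr0.
have D_unit : D \is a GRing.unit by rewrite fps_unitE cfB cfX0 r0 expr1n /= subr0 oner_eq0.
have D0 : D != 0 by apply: contraTneq D_unit => ->; rewrite unitr0.
pose a := (r ^+ 5 + f * r ^+ 2 * X) / D.
pose g := (r ^+ 3 + X * f) / D.
pose c := (r + f * r ^+ 4) / D.
pose a' := (r ^+ 5 + X * c * r ^+ 4 + X * r ^+ 2 * g + X * a) / D.
have fE : f = a ^+ 3 + X * g ^+ 3 + X ^+ 2 * c ^+ 3.
  by apply: (cube_dissection three0 rf D0); rewrite divrK.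
have gE : g = a' ^+ 3 + X * (- g) ^+ 3.
  by apply: (cube_dissection_snd three0 rf D0 (a := a) (c := c)); rewrite divrK.
have dissect_cube i (h : fps R) : (i < 3)%N -> dissect 3 i (h ^+ 3) = (i == 0%N)%:R * h.
  by move=> i3; rewrite -[h ^+ 3]mul1r dissect_exprM // -(fpsX0 R) dissect_fpsX.
have XX2 : X ^+ 2 = fpsX 2 by rewrite fpsXX.
exists g; split.
- by rewrite fE XX2 !dissectD dissect_cube // !dissect_exprM // !dissect_fpsX //= !mul0r mul1r addr0 add0r.
- by rewrite gE dissectD dissect_cube // !dissect_exprM // !dissect_fpsX //= !mul0r addr0.
- by rewrite [in LHS]gE dissectD dissect_cube // !dissect_exprM // !dissect_fpsX //= mul0r mul1r add0r.
Qed.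

(** The step $M = 3M' + 1$ reads $2M + 1 = 3(2M' + 1)$: each dissection removes a factor 3, down to
    $2K + 1 = 5$, the index $K = 2$ where $g$ vanishes. *)
Lemma regular13_cf_eq0 k m M : (M.*2.+1 = 5 * 3 ^ k.+1)%N ->
  cf f (3 ^ k.+2 * m + M) = 0.
Proof.
have [g [f1 g2 g1]] := regular13_dissection => eM.
have g0 j K : (K.*2.+1 = 5 * 3 ^ j)%N -> cf g (3 ^ j.+1 * m + K) = 0.
  elim: j K => [|j IH] K eK.
    have -> : (3 ^ 1 * m + K = m * 3 + 2)%N by lia.
    by rewrite -[LHS]/(cf (dissect 3 2 g) m) g2.
  have [K' eK'] : exists K', K = (3 * K' + 1)%N.
    exists (K %/ 3)%N; move: eK; rewrite expnS; lia.
  have -> : (3 ^ j.+2 * m + K = (3 ^ j.+1 * m + K') * 3 + 1)%N by rewrite eK' [(3 ^ _.+2)%N]expnS; lia.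
  rewrite -[LHS]/(cf (dissect 3 1 g) _) g1 cfN IH ?oppr0 //.
  move: eK; rewrite eK' expnS; lia.
have [M' eM'] : exists M', M = (3 * M' + 1)%N.
  exists (M %/ 3)%N; move: eM; rewrite expnS; lia.
have -> : (3 ^ k.+2 * m + M = (3 ^ k.+1 * m + M') * 3 + 1)%N by rewrite eM' [(3 ^ _.+2)%N]expnS; lia.
rewrite -[LHS]/(cf (dissect 3 1 f) _) f1 g0 //.
move: eM; rewrite eM' expnS; lia.
Qed.

End RegularChar3.

(** * Vanishing modulo 2 at even indices *)

Section RegularChar2.
Variable R : fieldType.
Hypotheses (charR : 2 \in [pchar R]) (frobR : forall a : R, a ^+ 2 = a).
Let f : fps R := Fps (fun n => (b 13 n)%:R).
Local Notation X := (fpsX 1 : fps R).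

Lemma regular13_even : dissect 2 0 f = eta R 1 ^+ 6 + fpsX 3 * eta R 13 ^+ 6.
Proof.
have fe : f * eta R 1 = eta R 13 := regular_gf_eta R (isT : (0 < 13)%N).
(* With $t = Xf^2$ and $f f_1 = f_{13}$ one has $f_1^6t^3 = X^3f_{13}^6$, so the eta relation reads
   $f = A^2(1 + Xf^2)$ for $A = f_1^6 + X^3f_{13}^6$. *)
have fE : f = (eta R 1 ^+ 6 + fpsX 3 * eta R 13 ^+ 6) ^+ 2
              + X * ((eta R 1 ^+ 6 + fpsX 3 * eta R 13 ^+ 6) * f) ^+ 2.
  have e13 : eta R 13 = eta R 1 ^+ 13 * (1 + (X * f ^+ 2) ^+ 3) ^+ 2 * (1 + X * f ^+ 2).
    apply: (@dilate_inj R 104) => //.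
    have := @eta_relation_char2 R charR frobR (dilate 104 (X * f ^+ 2)).
    have -> : eta R 104 = dilate 104 (eta R 1) by rewrite dilate_eta.
    have -> : eta R 1352 = dilate 104 (eta R 13) by rewrite dilate_eta.
    have -> : fpsX 104 = dilate 104 X by rewrite dilate_fpsX.
    rewrite -!dilateX // -!dilateM // => ->; last by congr dilate; rewrite -mulrA -exprMn fe.
    by rewrite !(dilateM, dilateD, dilateX, dilate1).
  apply: (mulIf (eta_neq0 R 1)); rewrite fe {1}e13 -fe.
  rewrite -[fpsX 3]/(fpsX (1 * 3)) -fpsXX; ring.
rewrite fE dissectD -[X in dissect 2 0 X]mul1r !dissect_exprM // -(fpsX0 R) !dissect_fpsX //=.
by rewrite mul1r mul0r addr0.
Qed.

(** Modulo 2 the cube is [Psi] in disguise: index $n$ corresponds to $1352n + 169 = 169(8n+1)$,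
    which has to be a square. *)
Lemma cf_eta_cube n : cf (eta R 1 ^+ 3) n != 0 -> exists j, (8 * n + 1 = j ^ 2)%N.
Proof.
have -> : cf (eta R 1 ^+ 3) n = cf (Psi R) (1352 * n + 169).
  rewrite (Psi_char2 charR frobR) cf_fpsXM leq_addl addnK.
  by rewrite -[1352%N]muln1 -dilate_eta // -dilateX //= !muln1 dvdn_mulr // mulKn.
rewrite /Psi /theta /= => nz.
have [k ek] : exists k : int, (k ^+ 2 = (1352 * n + 169)%:Z).
  apply: contrapT => H; move/negP: nz; apply; apply/eqP; apply: big1 => k _.
  case: ifP => // e; by case: H; exists k; rewrite -(eqP e) mul1r.
have [j ej] : exists j, `|k|%N = (13 * j)%N.
  suff /dvdnP[j ej] : (13 %| `|k|)%N by exists j; rewrite ej mulnC.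
  suff : (13 %| `|k| ^ 2)%N by rewrite Euclid_dvdX // => /andP[].
  apply/dvdnP; exists (104 * n + 13)%N; move: ek; lia.
exists j; suff : (`|k| ^ 2 = 1352 * n + 169)%N by rewrite ej; lia.
by move: ek; lia.
Qed.

Lemma cf_eta_sixth n : cf (eta R 1 ^+ 6) n != 0 -> exists j, (4 * n + 1 = j ^ 2)%N.
Proof.
rewrite (exprM _ 3 2) (expr_dilate charR frobR) /=; case: ifP => [/dvdnP[m ->]|]; last by rewrite eqxx.
by rewrite mulnK // => /cf_eta_cube[j ej]; exists j; lia.
Qed.

Lemma cf_eta_sixth13 n : cf (fpsX 3 * eta R 13 ^+ 6) n != 0 -> exists j, (4 * n + 1 = 13 * j ^ 2)%N.
Proof.
have -> : eta R 13 = dilate 13 (eta R 1) by rewrite dilate_eta.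
rewrite -dilateX // cf_fpsXM; case: (leqP 3 n) => [le3|_]; last by rewrite /= eqxx.
rewrite /=; case: ifP => [/dvdnP[m em]|]; last by rewrite eqxx.
by rewrite em mulnK // => /cf_eta_sixth[j ej]; exists j; lia.
Qed.

Lemma regular13_cf_even n : (forall j, 4 * n + 1 != j ^ 2)%N ->
  (forall j, 4 * n + 1 != 13 * j ^ 2)%N -> cf f (n * 2) = 0.
Proof.
move=> n1 n13; rewrite -[(n * 2)%N]addn0 -[LHS]/(cf (dissect 2 0 f) n).
rewrite regular13_even cfD.
have -> : cf (eta R 1 ^+ 6) n = 0.
  by apply/eqP/contraT => /cf_eta_sixth[j ej]; have := n1 j; rewrite ej eqxx.
rewrite add0r; apply/eqP/contraT => /cf_eta_sixth13[j ej].
by have := n13 j; rewrite ej eqxx.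
Qed.

End RegularChar2.

(** * From the two prime fields to the congruences *)

Local Open Scope nat_scope.

Lemma Fp_frob l (a : 'F_l) : prime l -> (a ^+ l = a)%R.
Proof. by move=> pl; have := finfield.expf_card a; rewrite card_Fp. Qed.

Lemma natr_Fp_eq0 l m : prime l -> (m%:R = 0 :> 'F_l)%R -> l %| m.
Proof. by move=> pl e0; rewrite (dvdn_pcharf (pchar_Fp pl)) e0. Qed.

Lemma regular13_dvd3 k m M : M.*2.+1 = 5 * 3 ^ k.+1 -> 3 %| b 13 (3 ^ k.+2 * m + M).
Proof.
move=> eM; apply: natr_Fp_eq0 => //.
by have := @regular13_cf_eq0 'F_3 (pchar_Fp (isT : prime 3)) (fun a => Fp_frob a (isT : prime 3)) k m M eM.
Qed.

Lemma regular13_dvd2 n : (forall j, 4 * n + 1 != j ^ 2) ->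
  (forall j, 4 * n + 1 != 13 * j ^ 2) -> 2 %| b 13 (n * 2).
Proof.
move=> n1 n13; apply: natr_Fp_eq0 => //.
by have := @regular13_cf_even 'F_2 (pchar_Fp (isT : prime 2)) (fun a => Fp_frob a (isT : prime 2)) n n1 n13.
Qed.

Lemma pow9_sqr_descent v j a c : coprime 3 v -> 9 ^ a * c = v * j ^ 2 ->
  exists i, c = v * i ^ 2.
Proof.
move=> v3; elim: a j => [|a IH] j e; first by exists j; rewrite -e mul1n.
have /dvdnP[i ei] : 3 %| j.
  have : 3 %| v * j ^ 2 by rewrite -e expnS -!mulnA dvdn_mulr.
  by rewrite Gauss_dvdr // Euclid_dvdX // => /andP[].
by apply: (IH i); move: e; rewrite expnS ei; nia.
Qed.

(** Applied with $v = 1$ and $v = 13$, both 1 mod 3: then $vi^2$ is never 2 mod 3, and $3u = vi^2$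
    would force 3 to divide $i$ and hence $u$. *)
Lemma pow9_neq_sqr v j a u r : v %% 3 = 1 -> u %% 3 = 2 -> r < 2 ->
  9 ^ a * (3 ^ r * u) != v * j ^ 2.
Proof.
move=> v1 u2 r2; apply/eqP => /pow9_sqr_descent[|i].
  by rewrite prime_coprime // /dvdn v1.
case: r r2 => [|[|//]] _.
  rewrite mul1n => /(congr1 (modn^~ 3)); rewrite u2 -modnMm v1 -modnXm.
  by have := ltn_pmod i (isT : 0 < 3); case: (i %% 3) => [|[|[|]]].
rewrite expn1 => e; have /dvdnP[t et] : 3 %| i.
  have : 3 %| v * i ^ 2 by rewrite -e dvdn_mulr.
  by rewrite Gauss_dvdr ?Euclid_dvdX // ?prime_coprime // /dvdn ?v1 // => /andP[].
have e' : u = 3 * (v * t ^ 2) by move: e; rewrite et; nia.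
by move: u2; rewrite e' modnMr.
Qed.

(** The hypothesis mod 4 makes $N = 2m$ even, with $4m + 1 = 2N + 1$. *)
Lemma regular13_dvd2_pow9 N a u r : N.*2.+1 = 9 ^ a * (3 ^ r * u) ->
  r < 2 -> u %% 3 = 2 -> 3 ^ r * u %% 4 = 1 -> 2 %| b 13 N.
Proof.
move=> eN r2 u2 u4.
have [m em] : exists m, N = m * 2.
  exists (N %/ 2); have : N.*2.+1 %% 4 = 1.
    by rewrite eN -modnMm u4 muln1 modn_mod -modnXm exp1n.
  lia.
have e4 : 4 * m + 1 = 9 ^ a * (3 ^ r * u) by rewrite -eN em; lia.
rewrite em; apply: regular13_dvd2 => j; rewrite e4; last exact: pow9_neq_sqr.
by rewrite -[j ^ 2]mul1n; exact: pow9_neq_sqr.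
Qed.

Theorem theorem3p15 (alpha n : nat) : 1 <= alpha ->
  b 13 (4 * 3 ^ (2 * alpha + 1) * n + (17 * 3 ^ (2 * alpha) - 1) %/ 2) %% 6 = 0 /\
  b 13 (4 * 3 ^ (2 * alpha) * n + (11 * 3 ^ (2 * alpha - 1) - 1) %/ 2) %% 6 = 0.
Proof.
case: alpha => // a _.
have dvd6 N : 2 %| N -> 3 %| N -> N %% 6 = 0 by lia.
have o9 : odd (9 ^ a) by rewrite oddX orbT.
have e9 : 3 ^ (2 * a) = 9 ^ a by rewrite expnM.
have -> : 2 * a.+1 + 1 = (2 * a).+3 by lia.
have -> : 2 * a.+1 = (2 * a).+2 by lia.
have -> : (2 * a).+2 - 1 = (2 * a).+1 by lia.
have [q eq] : exists q, 9 ^ a = q.*2.+1 by exists (9 ^ a)./2; lia.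
split; apply: dvd6.
(* For the first progression $2N + 1 = 3^{2\alpha}(24n + 17)$, with $\alpha = a + 1$. *)
- apply: (@regular13_dvd2_pow9 _ a.+1 (24 * n + 17) 0) => //; last 2 first.
  + lia.
  + by rewrite mul1n; lia.
  by rewrite !expnS e9 eq; lia.
(* From $24n + 17 = 6(4n + 2) + 5$. *)
- rewrite (_ : _ + _ = 3 ^ (2 * a).+3 * (4 * n + 2) + (5 * 3 ^ (2 * a).+2 - 1) %/ 2).
    by apply: (@regular13_dvd3 (2 * a).+1); rewrite !expnS e9 eq; lia.
  by rewrite !expnS e9 eq; lia.
(* For the second progression $2N + 1 = 3^{2\alpha-1}(24n + 11)$, an odd power of 3. *)
- apply: (@regular13_dvd2_pow9 _ a (24 * n + 11) 1) => //; last 2 first.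
  + lia.
  + lia.
  by rewrite !expnS e9 eq; lia.
(* From $24n + 11 = 6(4n + 1) + 5$. *)
rewrite (_ : _ + _ = 3 ^ (2 * a).+2 * (4 * n + 1) + (5 * 3 ^ (2 * a).+1 - 1) %/ 2).
  by apply: regular13_dvd3; rewrite !expnS e9 eq; lia.
by rewrite !expnS e9 eq; lia.
Qed.
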